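(* Let $1\le p\le\infty$. There exists a constant $c>0$, depending only on $p$, such that the following holds. Let $X$ be a complex Banach space, let $M:\mathbb R_+\to[2,\infty)$ be continuous and increasing, and let $f\in L^p(\mathbb R_+,X)$. Assume that the Laplace transform $\widehat f$ extends analytically to $\Omega_M$ and that the extension satisfies $$\|\widehat f(\lambda)\|\le M(|\operatorname{Im}\lambda|),\qquad \lambda\in\Omega_M .$$ Then the function $$t\mapsto M_{\log}^{-1}(ct)\Big(\widehat f(0)-\int_0^t f(s)\,ds\Big)$$ belongs to $L^p(\mathbb R_+,X)$.
   Context: $\mathbb R_+=[0,\infty)$. For measurable $f:\mathbb R_+\to X$, $\widehat f(\lambda)=\int_0^\infty e^{-\lambda t}f(t)\,dt$ is the Laplace transform, which for $f\in L^p(\mathbb R_+,X)$ is holomorphic on $\{\operatorname{Re}\lambda>0\}$; the same symbol $\widehat f$ denotes its holomorphic extension to a larger connected open set. For a continuous increasing function $M:\mathbb R_+\to[2,\infty)$, $$M_{\log}(s)=M(s)\,[\log(1+M(s))+\log(1+s)],\qquad \Omega_M=\Big\{\lambda\in\mathbb C:\operatorname{Re}\lambda>-\frac1{M(|\operatorname{Im}\lambda|)}\Big\}.$$ $M_{\log}$ is continuous, strictly increasing and tends to $\infty$, so it has an inverse $M_{\log}^{-1}$ defined on $[M_{\log}(0),\infty)$. The values of the weight on a bounded initial interval are unimportant; for definiteness, in the claim $M_{\log}^{-1}(t)$ is replaced by $1$ for $0\le t\le M_{\log}(1)$. *)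

(* Defs.v *)
From HB Require Import structures.
From mathcomp Require Import all_boot all_order all_algebra.
From mathcomp Require Export complex.
From mathcomp Require Export all_classical all_reals all_analysis.

Set Implicit Arguments.
Unset Strict Implicit.
Unset Printing Implicit Defensive.
Import Order.TTheory GRing.Theory Num.Theory numFieldNormedType.Exports.

Local Open Scope classical_set_scope.
Local Open Scope complex_scope.
Local Open Scope ring_scope.

(* The norm of a normed module over R[i] takes its values in R[i]; [rnorm] is
   the same number, seen as an element of R. *)
Definition rnorm (R : realType) (X : normedModType R[i]) (x : X) : R :=
  complex.Re `|x|.

Section Bochner.
Context d (T : measurableType d) (R : realType).
Variables (X : normedModType R[i]) (mu : {measure set T -> \bar R}) (D : set T).

(* Vector-valued simple functions on D are the functions with finite range and
   measurable level sets, supported in D on a set of finite measure. *)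
Definition simple_on (s : T -> X) : Prop :=
  finite_set (range s) /\
  forall x : X, measurable (D `&` s @^-1` [set x]) /\
    (x != 0 -> (mu (D `&` s @^-1` [set x]) < +oo)%E).

(* The sum has finite support; the junk value [fine +oo] can only occur as the
   coefficient of x = 0. *)
Definition simple_integral (s : T -> X) : X :=
  \sum_(x \in [set: X]) (fine (mu (D `&` s @^-1` [set x])))%:C *: x.

Definition ae_approx (s : nat -> T -> X) (f : T -> X) : Prop :=
  (forall n, simple_on (s n)) /\
  {ae mu, forall t, D t -> s n t @[n --> \oo] --> f t}.

(* Since the limit is only taken almost everywhere, it does not matter whether
   "measurable" refers to a sigma-algebra (Borel, for [lebesgue_measure]) or to
   its completion. *)
Definition strongly_measurable (f : T -> X) : Prop :=
  exists s : nat -> T -> X, ae_approx s f.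

Definition is_bochner (f : T -> X) (x : X) : Prop :=
  exists s : nat -> T -> X,
    [/\ ae_approx s f,
        (\int[mu]_(t in D) (rnorm (f t - s n t))%:E)%E @[n --> \oo] --> 0%E
      & simple_integral (s n) @[n --> \oo] --> x].

(* Equal to 0 if f is not Bochner integrable on D. *)
Definition bochner (f : T -> X) : X := xget 0 [set x | is_bochner f x].

Definition memLp (p : \bar R) (f : T -> X) : Prop :=
  strongly_measurable f /\
  ('N[mu]_p[EFin \o ((fun t => rnorm (f t)) \_ D)] < +oo)%E.

End Bochner.

Section Laplace.
Context (R : realType).

Definition cexp (z : R[i]) : R[i] :=
  let: a +i* b := z in (expR a * cos b) +i* (expR a * sin b).

Definition Rplus : set R := `[0, +oo[.

Definition laplace (X : normedModType R[i]) (f : R -> X) (z : R[i]) : X :=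
  bochner (@lebesgue_measure R) Rplus (fun t => cexp (- (z * t%:C)) *: f t).

Definition primitive (X : normedModType R[i]) (f : R -> X) (t : R) : X :=
  bochner (@lebesgue_measure R) `[0, t] f.

(* For open U: complex differentiability at each point of U. *)
Definition holomorphic_on (X : normedModType R[i]) (U : set R[i])
    (F : R[i] -> X) : Prop :=
  forall z, U z -> derivable (F : R[i]^o -> X) z 1.

Definition Omega (M : R -> R) : set R[i] :=
  [set z | - (M `|complex.Im z|)^-1 < complex.Re z].

Definition Mlog (M : R -> R) (s : R) : R := M s * (ln (1 + M s) + ln (1 + s)).

Definition Mlog_inv (M : R -> R) : R -> R := 'pinv_(fun=> 0) Rplus (Mlog M).

(* The value on the initial interval is a mere convention: [Mlog_inv] is only
   meaningful from [Mlog M 0] on. *)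
Definition weight (M : R -> R) (t : R) : R :=
  if t <= Mlog M 1 then 1 else Mlog_inv M t.

End Laplace.
Arguments Rplus {R}.

(* Main.v *)
Require Import Defs.
From HB Require Import structures.
From mathcomp Require Import all_boot all_order all_algebra complex.
From mathcomp Require Import all_classical all_reals all_analysis.
From mathcomp Require Import measurable_realfun ess_sup_inf ring lra.

Set Implicit Arguments.
Unset Strict Implicit.
Unset Printing Implicit Defensive.
Import Order.TTheory GRing.Theory Num.Theory numFieldNormedType.Exports.

Local Open Scope classical_set_scope.
Local Open Scope complex_scope.
Local Open Scope ring_scope.
Import ComplexField.Normc.

(** Fix a large time [t] and write [g = F 0 - primitive f t]. With
    [c = 1 / 16] put [rho = weight M (c * t)] and [m = M rho], so that
    [t = 16 * m * (ln (1 + m) + ln (1 + rho))]. The core is a bound of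
    [rho * rnorm g] by [t ^- 2] plus a convolution of [rnorm f] with an
    approximate identity of width [rho ^-1], up to constant factors. By the
    theorem of Hahn and Banach it is enough to bound [l g] for the real
    functionals [l] of norm at most 1, and so every integral below is scalar.

    Consider [exp (t z) * cutoff z / z *: (F 0 - F z)] on the rectangle with
    sides [Re z = 1 / t], [Re z = - 1 / (2 m)] and [Im z = rho], [Im z = - rho],
    where [cutoff] is a polynomial with double zeros at the two corners on the
    right. This function is holomorphic except for a removable singularity at
    0, so [l] of its integral over the right side equals that over the other
    three ([goursat_punctured], [contour_bound]). On the horizontal sides the
    double zeros yield the decay in [t]; on the left side [exp (t z)] has size
    [((1 + m) * (1 + rho)) ^- 8]. Altogether the contribution, even after
    multiplication by [rho], is [O(t ^- 2)] ([contour_budget]). On the right side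
    [F] is the Laplace transform of [f], and Fubini's theorem expresses the
    integral as [V t * l (F 0)] minus the integral of [l (f s) * V (t - s)]
    over [s], with [V = skern] a smoothed step function ([contour_identity]).
    Since [V t] is bounded below ([skern_lb]), comparing with
    [V t * l (primitive f t)] leaves the integral of [l (f s)] against the
    defect [V (t - s) - V t * 1_(s <= t)], which is of order
    [(1 + rho * |t - s|) ^- 2]. That is the asserted bound
    ([primitive_estimate], [weighted_remainder_bound]).

    The kernel [ck rho (t - s)] has integral at most [pi] in [s]. Its width
    depends on [t], but the logarithms in [Mlog] make [ln (1 + weight M v)] a
    Lipschitz function of [v], so the kernel is comparable to the one with the
    width taken at [s], up to a fixed integrable kernel, and its integral in
    [t] is bounded as well. Schur's test then gives the claim in [L^p]
    ([schur_power], [schur_L1], [weighted_Lp]).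

    The vector-valued integrals enter only through their images under
    functionals. This requires that [bochner] is not a junk value: the
    integral of a strongly measurable function with integrable norm exists and
    commutes with functionals ([bochner_linear]). *)

(** * Norming real functionals *)

Lemma RplusE {R : realType} (t : R) : Rplus t = (0 <= t) :> Prop.
Proof. by rewrite /Rplus/= in_itv/= andbT. Qed.

Section RealNorm.
Context {R : realType} {X : normedModType R[i]}.
Implicit Types (x y : X) (c : R[i]).

Lemma rnormE x : (rnorm x)%:C = `|x|.
Proof. by rewrite /rnorm RRe_real// ger0_real. Qed.

Lemma rnorm_ge0 x : 0 <= rnorm x.
Proof. by rewrite -lecR rnormE normr_ge0. Qed.

Lemma rnorm0 : rnorm (0 : X) = 0.
Proof. by apply: complexI; rewrite rnormE normr0. Qed.

Lemma rnorm_eq0 x : (rnorm x == 0) = (x == 0).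
Proof.
rewrite -[x == 0]normr_eq0 -rnormE; apply/eqP/eqP => [->//|/complexI//].
Qed.

Lemma rnormD x y : rnorm (x + y) <= rnorm x + rnorm y.
Proof. by rewrite -lecR rmorphD/= !rnormE ler_normD. Qed.

Lemma rnormN x : rnorm (- x) = rnorm x.
Proof. by apply: complexI; rewrite !rnormE normrN. Qed.

Lemma rnormB x y : rnorm (x - y) <= rnorm x + rnorm y.
Proof. by rewrite (le_trans (rnormD _ _))// rnormN. Qed.

Lemma rnormZ c x : rnorm (c *: x) = normc c * rnorm x.
Proof.
apply: complexI; rewrite rnormE normrZ rmorphM/= rnormE; congr (_ * _).
Qed.

Lemma normc_real (r : R) : normc r%:C = `|r|.
Proof. by rewrite /= expr0n/= addr0 sqrtr_sqr. Qed.

Lemma rnormZr (r : R) x : rnorm (r%:C *: x) = `|r| * rnorm x.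
Proof. by rewrite rnormZ normc_real. Qed.

Lemma cvg_rnormP (u : nat -> X) x :
  (u n @[n --> \oo] --> x) <-> (rnorm (x - u n) @[n --> \oo] --> (0 : R)).
Proof.
split=> [/cvgrPdist_lt ux|ux].
  apply/cvgrPdist_lt => e e0; near=> n.
  rewrite sub0r normrN ger0_norm ?rnorm_ge0// -ltcR rnormE.
  by near: n; apply: ux; rewrite ltcR.
apply/cvgrPdist_lt => e e0.
have eE : e = (complex.Re e)%:C by rewrite RRe_real// gtr0_real.
have : 0 < complex.Re e by rewrite -ltcR -eE.
move/cvgrPdist_lt : ux => /[apply]; apply: filterS => n.
by rewrite sub0r normrN ger0_norm ?rnorm_ge0// -ltcR rnormE eE.
Unshelve. all: by end_near. Qed.

(** Linearity over the reals suffices to estimate norms, and gives real-valued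
    functionals directly; multiplication by ['i] is handled by evaluating at
    ['i *: x], as in [real_linear_complex]. *)
Definition real_linear (l : X -> R) :=
  (forall x y, l (x + y) = l x + l y) /\
  (forall (r : R) x, l (r%:C *: x) = r * l x).

Definition bounded_by (C : R) (l : X -> R) := forall x, `|l x| <= C * rnorm x.

Lemma real_linear0 l : real_linear l -> l 0 = 0.
Proof. by case=> _ /(_ 0 0); rewrite scaler0 mul0r. Qed.

Lemma real_linearN l x : real_linear l -> l (- x) = - l x.
Proof.
by case=> _ /(_ (-1) x); rewrite rmorphN/= rmorph1 scaleN1r mulN1r.
Qed.

Lemma real_linearB l x y : real_linear l -> l (x - y) = l x - l y.
Proof. by move=> ll; rewrite (proj1 ll) real_linearN. Qed.

Lemma real_linear_sum l (I : Type) (r : seq I) (P : pred I) (F : I -> X) :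
  real_linear l -> l (\sum_(i <- r | P i) F i) = \sum_(i <- r | P i) l (F i).
Proof.
move=> ll; apply: (big_morph l) => [x y|]; first exact: (proj1 ll).
exact: real_linear0.
Qed.

Lemma real_linear_scale l c : real_linear l -> real_linear (fun x => l (c *: x)).
Proof.
case=> lD lZ; split=> [x y|r x]; first by rewrite scalerDr lD.
by rewrite scalerA mulrC -scalerA lZ.
Qed.

Lemma bounded_by_scale l C c : bounded_by C l ->
  bounded_by (C * normc c) (fun x => l (c *: x)).
Proof. by move=> lC x; rewrite (le_trans (lC _))// rnormZ mulrA. Qed.

Lemma real_linear_complex l (a b : R) x : real_linear l ->
  l ((a +i* b) *: x) = a * l x + b * l ('i *: x).
Proof.
case=> lD lZ; rewrite -lZ -lZ -lD; congr l; rewrite scalerA -scalerDl.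
by congr (_ *: _); apply/eqP; rewrite eq_complex/=; apply/andP; split; apply/eqP; ring.
Qed.

(** One inequality is asked for in place of positive homogeneity, because that
    is what passes to infima; the other follows in [sublinear_homog]. *)
Definition sublinear (q : X -> R) :=
  (forall x y, q (x + y) <= q x + q y) /\
  (forall (r : R) x, 0 < r -> q (r%:C *: x) <= r * q x).

Lemma sublinear_homog q r x : sublinear q -> 0 < r -> q (r%:C *: x) = r * q x.
Proof.
move=> [_ qZ] r0; apply/eqP; rewrite eq_le qZ//=.
have := qZ r^-1 (r%:C *: x); rewrite invr_gt0 r0 => /(_ isT).
rewrite scalerA -rmorphM/= mulVf ?gt_eqF// rmorph1 scale1r.
by rewrite ler_pdivlMl.
Qed.

Lemma sublinear0 q : sublinear q -> q 0 = 0.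
Proof.
move=> ql; have := @sublinear_homog q 2 0 ql (ltr0Sn _ _).
by rewrite scaler0; lra.
Qed.

Lemma sublinear_geN q x : sublinear q -> - q (- x) <= q x.
Proof.
move=> ql; have := proj1 ql x (- x); rewrite subrr sublinear0//; lra.
Qed.

(** The two infima formed below, over a chain of sublinear functions and over
    the translates of a single one, are sublinear for the same reason. *)
Lemma inf_sublinear (Q : set (X -> R)) (b : X -> R) :
  Q !=set0 -> (forall s x, Q s -> b x <= s x) ->
  (forall s1 s2 x y, Q s1 -> Q s2 -> exists2 s, Q s & s (x + y) <= s1 x + s2 y) ->
  (forall s r x, Q s -> 0 < r -> exists2 s', Q s' & s' (r%:C *: x) <= r * s x) ->
  sublinear (fun x => inf [set s x | s in Q]).
Proof.
move=> [s0 Qs0] bQ QD QZ.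
have hb x : has_lbound [set s x | s in Q].
  by exists (b x) => _ [s Qs <-]; exact: bQ.
have ne x : [set s x | s in Q] !=set0 by exists (s0 x), s0.
split=> [x y|r x r0].
  rewrite -lerBlDr; apply: lb_le_inf => // _ [s1 Qs1 <-].
  rewrite lerBlDr -lerBlDl; apply: lb_le_inf => // _ [s2 Qs2 <-].
  rewrite lerBlDl.
  have [s Qs sle] := QD _ _ x y Qs1 Qs2.
  by apply: le_trans sle; apply: ge_inf => //; exists s.
rewrite -ler_pdivrMl//; apply: lb_le_inf => // _ [s Qs <-].
rewrite ler_pdivrMl//; have [s' Qs' sle] := QZ _ _ x Qs r0.
by apply: le_trans sle; apply: ge_inf => //; exists s'.
Qed.

(** The largest sublinear function below [q] with value [- q y] at [- y]. A
    minimal [q] has to coincide with it, hence is odd and additive. *)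
Definition directional (q : X -> R) (y x : X) : R :=
  inf [set s x | s in [set fun x => q (x + t%:C *: y) - t * q y | t in Rplus]].

Lemma directional_lb q y t x : sublinear q -> 0 <= t ->
  - q (- x) <= q (x + t%:C *: y) - t * q y.
Proof.
move=> ql t0; have tq : q (t%:C *: y) = t * q y.
  move: t0; rewrite le_eqVlt => /predU1P[<-|t0]; last exact: sublinear_homog.
  by rewrite scale0r mul0r sublinear0.
by have := proj1 ql (x + t%:C *: y) (- x); rewrite addrC addKr tq; lra.
Qed.

Lemma directional_le q y t x : sublinear q -> 0 <= t ->
  directional q y x <= q (x + t%:C *: y) - t * q y.
Proof.
move=> ql t0; apply: ge_inf.
  exists (- q (- x)) => _ [_ [s s0 <-] <-]; apply: directional_lb => //.
  by rewrite -RplusE.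
by exists (fun x => q (x + t%:C *: y) - t * q y) => //; exists t; rewrite ?RplusE.
Qed.

Lemma directional_sublinear q y : sublinear q -> sublinear (directional q y).
Proof.
move=> ql; apply: (@inf_sublinear _ (fun x => - q (- x))).
- by exists (fun x => q (x + 0%:C *: y) - 0 * q y), 0; rewrite ?RplusE.
- move=> _ x [t + <-]; rewrite RplusE => t0.
  exact: directional_lb.
- move=> _ _ x x' [t1 + <-] [t2 + <-]; rewrite !RplusE => t10 t20.
  exists (fun x => q (x + (t1 + t2)%:C *: y) - (t1 + t2) * q y).
    by exists (t1 + t2); rewrite ?RplusE ?addr_ge0.
  have := proj1 ql (x + t1%:C *: y) (x' + t2%:C *: y).
  rewrite addrACA -scalerDl -rmorphD/=; lra.
- move=> _ r x [t + <-] r0; rewrite RplusE => t0.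
  exists (fun x => q (x + (r * t)%:C *: y) - (r * t) * q y).
    by exists (r * t); rewrite ?RplusE ?mulr_ge0// ltW.
  rewrite mulrBr mulrA lerB//.
  by rewrite -(sublinear_homog _ ql r0) scalerDr scalerA -rmorphM.
Qed.

Lemma directional_le_self q y x : sublinear q -> directional q y x <= q x.
Proof.
move=> ql; have := @directional_le q y 0 x ql (lexx _).
by rewrite scale0r addr0 mul0r subr0.
Qed.

(** A minimal sublinear function is linear, so a minimal one below the norm,
    which exists by Zorn's lemma, is a functional of norm at most 1. Starting
    from [directional rnorm x0] instead of [rnorm] forces its value at [x0]. *)
Lemma hahn_banach_norming (x0 : X) :
  exists l, [/\ real_linear l, bounded_by 1 l & l x0 = rnorm x0].
Proof.
have nl : sublinear (@rnorm R X).
  split=> [|r x r0]; first exact: rnormD.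
  by rewrite rnormZr gtr0_norm.
pose q0 := directional (@rnorm R X) x0.
have q0l : sublinear q0 by exact: directional_sublinear.
pose T := {q : X -> R | sublinear q /\ forall x, q x <= q0 x}.
pose mk (q : X -> R) (ql : sublinear q) (qq0 : forall x, q x <= q0 x) : T :=
  exist _ q (conj ql qq0).
pose t0 : T := mk q0 q0l (fun x => lexx _).
pose rel (q1 q2 : T) := `[< forall x, sval q2 x <= sval q1 x >].
have [|||[l [ll lq0]] lmin] := @ZL_preorder T t0 rel.
- by move=> q; apply/asboolP.
- by move=> r s t /asboolP h1 /asboolP h2; apply/asboolP => x; exact: le_trans (h1 x).
- move=> A Atot.
  have [A0|/set0P[a Aa]] := eqVneq A set0.
    by exists t0 => s; rewrite A0.
  have bA (s : T) x : - q0 (- x) <= sval s x.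
    case: s => q [ql qq0] /=; rewrite (le_trans _ (sublinear_geN _ ql))//.
    by rewrite lerN2.
  pose Q : set (X -> R) := [set sval s | s in A].
  have il : sublinear (fun x => inf [set s x | s in Q]).
    apply: (@inf_sublinear _ (fun x => - q0 (- x))).
    - by exists (sval a), a.
    - by move=> _ x [s As <-].
    - move=> _ _ x y [s1 A1 <-] [s2 A2 <-].
      have [/asboolP h|/asboolP h] := Atot _ _ A1 A2.
      + exists (sval s2); first by exists s2.
        by rewrite (le_trans (proj1 (proj1 (svalP s2)) _ _))// lerD2r.
      + exists (sval s1); first by exists s1.
        by rewrite (le_trans (proj1 (proj1 (svalP s1)) _ _))// lerD2l.
    - move=> _ r x [s As <-] r0; exists (sval s); first by exists s.
      by apply: (proj2 (proj1 (svalP s))).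
  have ib x (s : T) : A s -> inf [set s x | s in Q] <= sval s x.
    move=> As; apply: ge_inf; last by exists (sval s) => //; exists s.
    by exists (- q0 (- x)) => _ [_ [s' As' <-] <-].
  have iq x : inf [set s x | s in Q] <= q0 x.
    by apply: le_trans (proj2 (svalP a) x); exact: ib.
  exists (mk _ il iq) => s As; apply/asboolP => x; exact: ib.
- have lD x y : l (x + y) = l x + l y.
    apply/eqP; rewrite eq_le (proj1 ll)/=.
    have yl : sublinear (directional l y) by exact: directional_sublinear.
    have ylq x' : directional l y x' <= q0 x'.
      by rewrite (le_trans _ (lq0 _))// directional_le_self.
    have /asboolP/(_ x)/= h : rel (mk _ yl ylq) (mk _ ll lq0).
      by apply: lmin; apply/asboolP => x' /=; exact: directional_le_self.
    have := le_trans h (@directional_le l y 1 x ll ler01).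
    rewrite rmorph1 scale1r mul1r; lra.
  have lN x : l (- x) = - l x.
    by have := lD x (- x); rewrite subrr sublinear0//; lra.
  have lle x : l x <= rnorm x.
    by rewrite (le_trans (lq0 x))// directional_le_self.
  exists l; split.
  + split=> // r x; have [r0|r0|->] := ltgtP r 0.
    * have -> : r%:C *: x = - ((- r)%:C *: x) by rewrite rmorphN/= scaleNr opprK.
      by rewrite lN sublinear_homog// ?oppr_gt0// mulNr opprK.
    * exact: sublinear_homog.
    * by rewrite scale0r mul0r sublinear0.
  + move=> x; rewrite mul1r ler_norml lle andbT lerNl -lN.
    by rewrite -(rnormN x).
  + apply/eqP; rewrite eq_le lle/= -lerN2 -lN (le_trans (lq0 _))//.
    rewrite (le_trans (@directional_le _ x0 1 _ nl ler01))//.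
    by rewrite rmorph1 scale1r mul1r addNr rnorm0 sub0r.
Qed.

End RealNorm.

(** * Closed forms on rectangles *)

Section SegmentIntegral.
Context {R : realType}.
Notation mu := (@lebesgue_measure R).
Implicit Types (h k : R -> R) (a b c e : R).

Lemma continuous_atP h x : {for x, continuous h} <->
  forall e, 0 < e ->
    exists2 d : R, 0 < d & forall y, `|y - x| < d -> `|h y - h x| <= e.
Proof.
split=> [/cvgrPdist_le hx e /hx /nbhs_normP[d d0 hd]|hx].
  exists d => // y yd; rewrite distrC; apply: hd.
  by rewrite /= distrC.
apply/cvgrPdist_le => e /hx[d d0 hd]; apply/nbhs_normP; exists d => // y.
by rewrite /= distrC => /hd; rewrite distrC.
Qed.

Definition sint h a b : R := \int[mu]_(x in `[a, b]) h x.

Definition cont_on h a b := forall x, a <= x <= b -> {for x, continuous h}.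

Lemma cont_onW h a b a' b' : a <= a' -> b' <= b -> cont_on h a b ->
  cont_on h a' b'.
Proof.
move=> aa bb hc x /andP[ax xb]; apply: hc.
by rewrite (le_trans aa ax) (le_trans xb bb).
Qed.

Lemma cont_on_within h a b : cont_on h a b -> {within `[a, b], continuous h}.
Proof.
move=> hc; apply: continuous_in_subspaceT => x.
by rewrite inE/= in_itv/= => xab; exact: hc.
Qed.

Lemma cont_on_integrable h a b : cont_on h a b ->
  mu.-integrable `[a, b] (EFin \o h).
Proof.
move=> hc; apply: continuous_compact_integrable; first exact: segment_compact.
exact: cont_on_within.
Qed.

Lemma cont_on_cst (k : R) a b : cont_on (fun=> k) a b.
Proof. by move=> x _; exact: cvg_cst. Qed.

Lemma cont_onD h k a b : cont_on h a b -> cont_on k a b ->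
  cont_on (fun x => h x + k x) a b.
Proof. by move=> hc kc x xab; apply: cvgD; [exact: hc|exact: kc]. Qed.

Lemma cont_onB h k a b : cont_on h a b -> cont_on k a b ->
  cont_on (fun x => h x - k x) a b.
Proof. by move=> hc kc x xab; apply: cvgB; [exact: hc|exact: kc]. Qed.

Lemma cont_onM h k a b : cont_on h a b -> cont_on k a b ->
  cont_on (fun x => h x * k x) a b.
Proof. by move=> hc kc x xab; apply: cvgM; [exact: hc|exact: kc]. Qed.

Lemma cont_on_norm h a b : cont_on h a b -> cont_on (fun x => `|h x|) a b.
Proof. by move=> hc x xab; apply: cvg_norm; exact: hc. Qed.

Lemma sint_cst (k : R) a b : a <= b -> sint (fun=> k) a b = k * (b - a).
Proof.
move=> ab; rewrite /sint Rintegral_cst//= lebesgue_measure_itv/= lte_fin.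
by move: ab; rewrite le_eqVlt => /predU1P[->|->//]; rewrite ltxx subrr.
Qed.

Lemma sintD h k a b : cont_on h a b -> cont_on k a b ->
  sint (fun x => h x + k x) a b = sint h a b + sint k a b.
Proof.
by move=> hc kc; rewrite /sint RintegralD//; exact: cont_on_integrable.
Qed.

Lemma sintB h k a b : cont_on h a b -> cont_on k a b ->
  sint (fun x => h x - k x) a b = sint h a b - sint k a b.
Proof.
by move=> hc kc; rewrite /sint RintegralB//; exact: cont_on_integrable.
Qed.

Lemma sintZ h (r : R) a b : cont_on h a b ->
  sint (fun x => r * h x) a b = r * sint h a b.
Proof. by move=> hc; rewrite /sint RintegralZl//; exact: cont_on_integrable. Qed.

Lemma eq_sint h k a b : (forall x, a <= x <= b -> h x = k x) ->
  sint h a b = sint k a b.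
Proof.
by move=> hk; apply: eq_Rintegral => x; rewrite inE/= in_itv/= => /hk.
Qed.

Lemma le_sint h k a b : cont_on h a b -> cont_on k a b ->
  (forall x, a <= x <= b -> h x <= k x) -> sint h a b <= sint k a b.
Proof.
move=> hc kc hk; apply: le_Rintegral => //; try exact: cont_on_integrable.
Qed.

Lemma sint_split h a b c : a <= c -> c <= b -> cont_on h a b ->
  sint h a b = sint h a c + sint h c b.
Proof.
move=> ac cb hc; rewrite /sint.
have ih := cont_on_integrable hc.
have := @Rintegral_itvB _ h (BLeft a) (BRight b) c ih.
rewrite !bnd_simp => /(_ ac cb) /(congr1 (fun z => z + sint h a c)).
rewrite subrK /sint => ->; rewrite addrC; congr (_ + _).
rewrite Rintegral_itv_obnd_cbnd//; apply: integrableS ih => //.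
apply: subset_itvr; rewrite bnd_simp//.
Qed.

Lemma le_norm_sint h k a b : a <= b -> cont_on h a b -> cont_on k a b ->
  (forall x, a <= x <= b -> `|h x| <= k x) -> `|sint h a b| <= sint k a b.
Proof.
move=> ab hc kc hk; rewrite /sint.
apply: (le_trans (le_normr_Rintegral _ _)) => //.
  exact: cont_on_integrable.
by apply: le_sint => //; exact: cont_on_norm.
Qed.

Lemma sint_near_cst h (k : R) e a b : a <= b -> cont_on h a b ->
  (forall x, a <= x <= b -> `|h x - k| <= e) ->
  `|sint h a b - k * (b - a)| <= e * (b - a).
Proof.
move=> ab hc hk; rewrite -!sint_cst// -sintB//; last exact: cont_on_cst.
apply: le_norm_sint => //; last exact: cont_on_cst.
by apply: cont_onB => //; exact: cont_on_cst.
Qed.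

Lemma le_norm_sint_cst h e a b : a <= b -> cont_on h a b ->
  (forall x, a <= x <= b -> `|h x| <= e) -> `|sint h a b| <= e * (b - a).
Proof.
move=> ab hc hk; have := @sint_near_cst h 0 e a b ab hc.
by rewrite mul0r subr0; apply=> x /hk; rewrite subr0.
Qed.

End SegmentIntegral.

Section Goursat.
Context {R : realType}.
Implicit Types (P Q : R -> R -> R) (x y : R) (i : R * R).

(** [P] and [Q] are the coefficients of a form [P dx + Q dy]; both are
    differentiable at the point, and the two mixed derivatives agree, which is
    all that a complex derivative provides. *)
Definition closed_at P Q x0 y0 := exists a b c : R, forall e, 0 < e ->
  exists2 d : R, 0 < d & forall x y, `|x - x0| < d -> `|y - y0| < d ->
   `|P x y - P x0 y0 - a * (x - x0) - b * (y - y0)| <= e * (`|x - x0| + `|y - y0|)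
   /\ `|Q x y - Q x0 y0 - b * (x - x0) - c * (y - y0)|
       <= e * (`|x - x0| + `|y - y0|).

Lemma closed_at_sym P Q x y : closed_at P Q x y ->
  closed_at (fun y x => Q x y) (fun y x => P x y) y x.
Proof.
move=> [a [b [c PQ]]]; exists c, b, a => e /PQ[d d0 {}PQ]; exists d => // y' x' yd xd.
have [Pd Qd] := PQ _ _ xd yd.
by split; rewrite [X in `|X|]addrAC [leRHS]mulrC [`|y' - _| + _]addrC mulrC.
Qed.

Lemma closed_at_contl P Q x y : closed_at P Q x y ->
  {for x, continuous (P ^~ y)}.
Proof.
move=> [a [b [c PQ]]]; apply/continuous_atP => e e0.
have [d d0 {}PQ] := PQ 1 ltr01.
have M0 : 0 < 1 + `|a| by rewrite ltr_pwDl.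
exists (Num.min d (e / (1 + `|a|))) => [|x']; first by rewrite lt_min d0 divr_gt0.
rewrite lt_min => /andP[xd xe].
have [|] := PQ x' y xd; rewrite subrr normr0//.
rewrite mulr0 addr0 subr0 mul1r => Pd _.
have : `|P x' y - P x y| <= (1 + `|a|) * `|x' - x|.
  rewrite mulrDl mul1r -normrM; set u := P x' y - P x y in Pd *.
  by rewrite -[u](subrK (a * (x' - x))) (le_trans (ler_normD _ _))// lerD2r.
move=> /le_trans; apply.
by rewrite mulrC -ler_pdivlMr// ltW.
Qed.

Lemma closed_at_contr P Q x y : closed_at P Q x y ->
  {for y, continuous (Q x)}.
Proof. by move=> /closed_at_sym /closed_at_contl. Qed.

(** The integral of [P dx + Q dy] over the boundary of [i] times [j]. *)
Definition circulation P Q i j : R :=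
  sint (fun x => P x j.1 - P x j.2) i.1 i.2 +
  sint (fun y => Q i.2 y - Q i.1 y) j.1 j.2.

Definition cont_form P Q i j := forall x y,
  i.1 <= x <= i.2 -> j.1 <= y <= j.2 ->
  {for x, continuous (P ^~ y)} /\ {for y, continuous (Q x)}.

Lemma circulation_splitx P Q (x1 x2 c y1 y2 : R) :
  x1 <= c -> c <= x2 -> y1 <= y2 -> cont_form P Q (x1, x2) (y1, y2) ->
  circulation P Q (x1, x2) (y1, y2) =
  circulation P Q (x1, c) (y1, y2) + circulation P Q (c, x2) (y1, y2).
Proof.
move=> x1c cx2 y12 PQ; have x12 := le_trans x1c cx2.
have y1y : y1 <= y1 <= y2 by rewrite lexx y12.
have y2y : y1 <= y2 <= y2 by rewrite lexx y12.
have cP : cont_on (fun x => P x y1 - P x y2) x1 x2.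
  apply: cont_onB => x xi; [exact: (proj1 (PQ x y1 xi y1y))|
    exact: (proj1 (PQ x y2 xi y2y))].
have cQ x : x1 <= x <= x2 -> cont_on (Q x) y1 y2.
  by move=> xi y yj; exact: (proj2 (PQ _ _ xi yj)).
have [cQ1 cQ2 cQc] : [/\ cont_on (Q x1) y1 y2, cont_on (Q x2) y1 y2
    & cont_on (Q c) y1 y2].
  by split; apply: cQ; rewrite ?lexx ?x12 ?x1c ?cx2.
rewrite /circulation/= (sint_split x1c cx2 cP).
rewrite (sintB cQ2 cQ1) (sintB cQc cQ1) (sintB cQ2 cQc); lra.
Qed.

Lemma circulation_sym P Q i j : i.1 <= i.2 -> j.1 <= j.2 ->
  cont_form P Q i j ->
  circulation P Q i j = - circulation (fun y x => Q x y) (fun y x => P x y) j i.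
Proof.
case: i j => [x1 x2] [y1 y2]/= x12 y12 PQ.
have ends (u v : R) : u <= v -> (u <= u <= v) * (u <= v <= v).
  by move=> uv; rewrite !lexx uv.
have cP y : y1 <= y <= y2 -> cont_on (P ^~ y) x1 x2.
  by move=> yj x xi; exact: (proj1 (PQ _ _ xi yj)).
have cQ x : x1 <= x <= x2 -> cont_on (Q x) y1 y2.
  by move=> xi y yj; exact: (proj2 (PQ _ _ xi yj)).
rewrite /circulation/= !sintB; try (by apply: cP; rewrite !ends);
  try (by apply: cQ; rewrite !ends).
lra.
Qed.

Lemma cont_form_sym P Q i j : cont_form P Q i j ->
  cont_form (fun y x => Q x y) (fun y x => P x y) j i.
Proof. by move=> PQ x y xj yi; have [] := PQ y x yi xj. Qed.

Lemma circulation_splity P Q (x1 x2 c y1 y2 : R) :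
  y1 <= c -> c <= y2 -> x1 <= x2 -> cont_form P Q (x1, x2) (y1, y2) ->
  circulation P Q (x1, x2) (y1, y2) =
  circulation P Q (x1, x2) (y1, c) + circulation P Q (x1, x2) (c, y2).
Proof.
move=> y1c cy2 x12 PQ.
have PQ1 : cont_form P Q (x1, x2) (y1, c).
  by move=> x y xi /andP[y1y yc]; apply: PQ => //=; rewrite y1y (le_trans yc).
have PQ2 : cont_form P Q (x1, x2) (c, y2).
  by move=> x y xi /andP[cy yy2]; apply: PQ => //=; rewrite yy2 (le_trans y1c).
rewrite circulation_sym//=; last exact: le_trans cy2.
rewrite (circulation_splitx y1c cy2 x12 (cont_form_sym PQ)).
by rewrite opprD -!circulation_sym.
Qed.

(** Subtracting the linear parts of [P] and [Q], whose circulation vanishes,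
    leaves an error that is quadratic in the size of the rectangle. *)
Lemma circulation_local P Q x0 y0 e : closed_at P Q x0 y0 -> 0 < e ->
  exists2 d : R, 0 < d & forall i j,
    i.1 <= x0 <= i.2 -> j.1 <= y0 <= j.2 -> i.2 - i.1 < d -> j.2 - j.1 < d ->
    cont_form P Q i j ->
    `|circulation P Q i j| <= e * ((i.2 - i.1) + (j.2 - j.1)) ^+ 2.
Proof.
move=> [a [b [c PQ]]] e0; have e20 : 0 < e / 2 by rewrite divr_gt0.
have [d d0 {}PQ] := PQ _ e20; exists d => // -[x1 x2] [y1 y2] /=.
move=> /andP[x10 x02] /andP[y10 y02] xd yd cPQ.
have x12 := le_trans x10 x02; have y12 := le_trans y10 y02.
set w := x2 - x1 in xd *; set h := y2 - y1 in yd *.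
have dx x : x1 <= x <= x2 -> `|x - x0| <= w.
  by move=> /andP[? ?]; rewrite ler_norml; apply/andP; split; rewrite /w; lra.
have dy y : y1 <= y <= y2 -> `|y - y0| <= h.
  by move=> /andP[? ?]; rewrite ler_norml; apply/andP; split; rewrite /h; lra.
have PQe x y : x1 <= x <= x2 -> y1 <= y <= y2 ->
    `|P x y - P x0 y0 - a * (x - x0) - b * (y - y0)| <= e / 2 * (w + h) /\
    `|Q x y - Q x0 y0 - b * (x - x0) - c * (y - y0)| <= e / 2 * (w + h).
  move=> xi yi; have [] := PQ x y (le_lt_trans (dx _ xi) xd) (le_lt_trans (dy _ yi) yd).
  have le_e : e / 2 * (`|x - x0| + `|y - y0|) <= e / 2 * (w + h).
    by rewrite ler_pM2l// lerD// ?dx ?dy.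
  by move=> h1 h2; split; [exact: le_trans h1 _|exact: le_trans h2 _].
have i1 : x1 <= x1 <= x2 by rewrite lexx.
have i2 : x1 <= x2 <= x2 by rewrite lexx x12.
have j1 : y1 <= y1 <= y2 by rewrite lexx.
have j2 : y1 <= y2 <= y2 by rewrite lexx y12.
have Pb : `|sint (fun x => P x y1 - P x y2) x1 x2 - (- (b * h)) * w|
    <= e * (w + h) * w.
  apply: sint_near_cst => //.
    by apply: cont_onB => x xi; [exact: (proj1 (cPQ _ _ xi j1))|
      exact: (proj1 (cPQ _ _ xi j2))].
  move=> x xi; have [h1 _] := PQe x y1 xi j1; have [h2 _] := PQe x y2 xi j2.
  rewrite (_ : _ - _ = (P x y1 - P x0 y0 - a * (x - x0) - b * (y1 - y0)) -
    (P x y2 - P x0 y0 - a * (x - x0) - b * (y2 - y0))); last by rewrite /h; ring.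
  apply: (le_trans (ler_normB _ _) (le_trans (lerD h1 h2) _)).
  by rewrite -mulrDl -splitr.
have Qb : `|sint (fun y => Q x2 y - Q x1 y) y1 y2 - (b * w) * h|
    <= e * (w + h) * h.
  apply: sint_near_cst => //.
    by apply: cont_onB => y yj; [exact: (proj2 (cPQ _ _ i2 yj))|
      exact: (proj2 (cPQ _ _ i1 yj))].
  move=> y yj; have [_ h1] := PQe x1 y i1 yj; have [_ h2] := PQe x2 y i2 yj.
  rewrite (_ : _ - _ = (Q x2 y - Q x0 y0 - b * (x2 - x0) - c * (y - y0)) -
    (Q x1 y - Q x0 y0 - b * (x1 - x0) - c * (y - y0))); last by rewrite /w; ring.
  apply: (le_trans (ler_normB _ _) (le_trans (lerD h2 h1) _)).
  by rewrite -mulrDl -splitr.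
rewrite /circulation/= expr2 mulrA [leRHS]mulrDr.
apply: le_trans (lerD Pb Qb); apply: le_trans (ler_normD _ _).
by rewrite mulNr opprK addrACA [b * h * w]mulrAC subrr addr0.
Qed.

Definition half (lower : bool) i : R * R :=
  let m := (i.1 + i.2) / 2 in if lower then (i.1, m) else (m, i.2).

Lemma half_bounds lower i : i.1 <= i.2 -> [/\ i.1 <= (half lower i).1,
  (half lower i).1 <= (half lower i).2 & (half lower i).2 <= i.2].
Proof. by move=> i12; rewrite /half; case: lower; split=> /=; lra. Qed.

(** The common point is the supremum of the left end points. *)
Lemma nested_halves (s : nat -> R * R) : (s 0%N).1 <= (s 0%N).2 ->
  (forall n, exists lower, s n.+1 = half lower (s n)) ->
  (forall n, (s n).2 - (s n).1 = ((s 0%N).2 - (s 0%N).1) / 2 ^+ n) /\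
  exists x, forall n, (s n).1 <= x <= (s n).2.
Proof.
move=> s0 sS.
have sle n : (s n).1 <= (s n).2.
  by elim: n => // n ih; have [[] ->] := sS n; rewrite /half/=; lra.
have s_mono n : (s n).1 <= (s n.+1).1 /\ (s n.+1).2 <= (s n).2.
  by have := sle n; have [[] ->] := sS n; rewrite /half/=; lra.
have lo m n : (m <= n)%N -> (s m).1 <= (s n).1.
  by apply: (@homo_leq _ (fun n => (s n).1) (fun x y => x <= y)) => //;
    [exact: le_trans|move=> k; case: (s_mono k)].
have hi m n : (m <= n)%N -> (s n).2 <= (s m).2.
  by apply: (@homo_leq _ (fun n => (s n).2) (fun x y => y <= x)) => //;
    [move=> y x z xy yz; exact: le_trans xy|move=> k; case: (s_mono k)].
have lohi m n : (s m).1 <= (s n).2.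
  have [mn|/ltnW nm] := leqP m n; first exact: le_trans (lo _ _ mn) (sle n).
  exact: le_trans (sle m) (hi _ _ nm).
split.
  elim=> [|n ih]; first by rewrite expr0 divr1.
  rewrite exprS invfM mulrCA -ih; have [[] ->] := sS n; rewrite /half/=; lra.
pose L := [set (s n).1 | n in [set: nat]].
have L0 : L !=set0 by exists (s 0%N).1, 0%N.
have Lb : has_ubound L by exists (s 0%N).2 => _ [n _ <-].
exists (sup L) => n; apply/andP; split.
  by apply: ub_le_sup => //; exists n.
by apply: ge_sup => // _ [m _ <-].
Qed.

(** Goursat's argument: were the circulation nonzero, repeated quartering
    would lead to a point around which it is not [o(size^2)]. *)
Theorem goursat P Q i j : i.1 <= i.2 -> j.1 <= j.2 ->
  (forall x y, i.1 <= x <= i.2 -> j.1 <= y <= j.2 -> closed_at P Q x y) ->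
  circulation P Q i j = 0.
Proof.
move=> i12 j12 PQ; apply: contrapT => /eqP/negPf circ0.
(* [e] is small enough for the whole rectangle to exceed the quadratic bound
   that [circulation_local] gives near every point. *)
pose size (r : (R * R) * (R * R)) := (r.1.2 - r.1.1) + (r.2.2 - r.2.1).
have size_ge0 : 0 <= size (i, j) by rewrite /size/=; lra.
pose e := `|circulation P Q i j| / (1 + size (i, j) ^+ 2).
have S1 : 0 < 1 + size (i, j) ^+ 2 by rewrite ltr_pwDl// sqr_ge0.
have e0 : 0 < e by rewrite divr_gt0// normr_gt0 circ0.
pose sub (r : (R * R) * (R * R)) := [/\ i.1 <= r.1.1, r.1.1 <= r.1.2, r.1.2 <= i.2
  & [/\ j.1 <= r.2.1, r.2.1 <= r.2.2 & r.2.2 <= j.2]].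
pose bad r := sub r /\ e * size r ^+ 2 < `|circulation P Q r.1 r.2|.
have sub_cont r : sub r -> cont_form P Q r.1 r.2.
  move=> [h1 h2 h3 [h4 h5 h6]] x y /andP[? ?] /andP[? ?].
  have xy : closed_at P Q x y.
    by apply: PQ; apply/andP; split; [apply: le_trans h1 _|apply: le_trans h3|
      apply: le_trans h4 _|apply: le_trans h6].
  by split; [exact: closed_at_contl xy|exact: closed_at_contr xy].
have bad0 : bad (i, j).
  split; first by split=> //=.
  have -> : `|circulation P Q (i, j).1 (i, j).2| = e * (1 + size (i, j) ^+ 2).
    by rewrite /e divfK// gt_eqF.
  by rewrite ltr_pM2l// ltrDr.
have badS r : bad r -> exists bx by_, bad (half bx r.1, half by_ r.2).
  move=> [sr br]; apply: contrapT => nbad.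
  have sq (bx by_ : bool) : sub (half bx r.1, half by_ r.2).
    move: sr => [h1 h2 h3 [h4 h5 h6]].
    have [p1 p2 p3] := half_bounds bx h2; have [q1 q2 q3] := half_bounds by_ h5.
    by split; [exact: le_trans p1|by []|exact: le_trans h3|split];
      [exact: le_trans q1|by []|exact: le_trans h6].
  have le_q (bx by_ : bool) :
      `|circulation P Q (half bx r.1) (half by_ r.2)| <= e * (size r ^+ 2 / 4).
    have -> : size r ^+ 2 / 4 = size (half bx r.1, half by_ r.2) ^+ 2.
      by rewrite /size/half; case: bx; case: by_ => /=; field.
    rewrite leNgt; apply/negP => ltq; apply: nbad; exists bx, by_.
    by split; [exact: sq|].
  move: br; apply/negP; rewrite -leNgt.
  case: r sr sq le_q {nbad} => -[x1 x2] [y1 y2] sr sq le_q.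
  have cr := sub_cont _ sr; move: sr => [/= h1 h2 h3 [/= h4 h5 h6]].
  have mx1 : x1 <= (x1 + x2) / 2 by lra.
  have mx2 : (x1 + x2) / 2 <= x2 by lra.
  have my1 : y1 <= (y1 + y2) / 2 by lra.
  have my2 : (y1 + y2) / 2 <= y2 by lra.
  rewrite /= (circulation_splitx mx1 mx2 h5 cr).
  have cL : cont_form P Q (x1, (x1 + x2) / 2) (y1, y2).
    by move=> x y /= /andP[xl xr] ?; apply: cr => //=; rewrite xl (le_trans xr).
  have cR : cont_form P Q ((x1 + x2) / 2, x2) (y1, y2).
    by move=> x y /= /andP[xl xr] ?; apply: cr => //=; rewrite xr (le_trans _ xl).
  rewrite (circulation_splity my1 my2 mx1 cL) (circulation_splity my1 my2 mx2 cR).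
  have := le_q true true; have := le_q true false.
  have := le_q false true; have := le_q false false.
  rewrite /half/= => b1 b2 b3 b4.
  rewrite (le_trans (ler_normD _ _))//.
  rewrite (le_trans (lerD (ler_normD _ _) (ler_normD _ _)))//.
  move: (size _) b1 b2 b3 b4 => S b1 b2 b3 b4; lra.
pose step r := xget r [set r' | (exists bx by_, r' = (half bx r.1, half by_ r.2))
  /\ bad r'].
have stepP r : bad r -> (exists bx by_, step r = (half bx r.1, half by_ r.2))
    /\ bad (step r).
  move=> /badS[bx [by_ bq]]; rewrite /step.
  case: xgetP => [r' _ []//|/(_ (half bx r.1, half by_ r.2)) []].
  by split=> //; exists bx, by_.
pose s n := iter n step (i, j).
have sbad n : bad (s n) by elim: n => //= n /stepP[].
have sx n : exists lower, (s n.+1).1 = half lower (s n).1.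
  by rewrite -[s n.+1]/(step (s n)); have [[bx [by_ ->]] _] := stepP _ (sbad n); exists bx.
have sy n : exists lower, (s n.+1).2 = half lower (s n).2.
  by rewrite -[s n.+1]/(step (s n)); have [[bx [by_ ->]] _] := stepP _ (sbad n); exists by_.
have [wx [x0 x0s]] := @nested_halves (fun n => (s n).1) i12 sx.
have [wy [y0 y0s]] := @nested_halves (fun n => (s n).2) j12 sy.
have [d d0 dP] := circulation_local (PQ x0 y0 (x0s 0%N) (y0s 0%N)) e0.
have [n nd] : exists n, size (i, j) / 2 ^+ n < d.
  have : size (i, j) * 2^-1 ^+ n @[n --> \oo] --> size (i, j) * 0.
    by apply: cvgM; [exact: cvg_cst|apply: cvg_expr; rewrite ger0_norm; lra].
  rewrite mulr0 => /cvgrPdist_lt/(_ _ d0)[n _ /(_ n (leqnn n))] /=.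
  rewrite sub0r normrN => nd; exists n; rewrite -exprVn.
  exact: le_lt_trans (ler_norm _) nd.
have [sn] := sbad n; apply/negP; rewrite -leNgt.
have i0 : 0 <= i.2 - i.1 by lra.
have j0 : 0 <= j.2 - j.1 by lra.
have p2 : (0 : R) <= (2 ^+ n)^-1 by rewrite invr_ge0 exprn_ge0.
apply: dP (x0s n) (y0s n) _ _ (sub_cont _ sn).
- rewrite wx (le_lt_trans _ nd)// ler_wpM2r//=; rewrite /size/=; lra.
- rewrite wy (le_lt_trans _ nd)// ler_wpM2r//=; rewrite /size/=; lra.
Qed.

(** A point singularity near which [P] and [Q] stay bounded is harmless: cut
    out a square of side [2r] around it and let [r] tend to 0. *)
Theorem goursat_punctured P Q (x1 x2 y1 y2 B d : R) :
  x1 < 0 -> 0 < x2 -> y1 < 0 -> 0 < y2 -> 0 < d ->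
  (forall x y, x1 <= x <= x2 -> y1 <= y <= y2 -> (x != 0) || (y != 0) ->
     closed_at P Q x y) ->
  (forall x y, `|x| < d -> `|y| < d -> `|P x y| <= B /\ `|Q x y| <= B) ->
  sint (P ^~ y1) x1 x2 + sint (Q x2) y1 y2 =
  sint (P ^~ y2) x1 x2 + sint (Q x1) y1 y2.
Proof.
move=> x10 x20 y10 y20 d0 PQ PQB.
have cP (y a b : R) : y1 <= y <= y2 -> y != 0 -> x1 <= a -> b <= x2 ->
    cont_on (P ^~ y) a b.
  move=> yj yn0 ha hb x /andP[ax xb]; apply: (@closed_at_contl P Q).
  by apply: PQ => //; rewrite ?yn0 ?orbT// (le_trans ha ax) (le_trans xb hb).
have cQ (x a b : R) : x1 <= x <= x2 -> x != 0 -> y1 <= a -> b <= y2 ->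
    cont_on (Q x) a b.
  move=> xi xn0 ha hb y /andP[ay yb]; apply: (@closed_at_contr P Q).
  by apply: PQ => //; rewrite ?xn0// (le_trans ha ay) (le_trans yb hb).
set T1 := sint (P ^~ y1) x1 x2; set T2 := sint (Q x2) y1 y2.
set T3 := sint (P ^~ y2) x1 x2; set T4 := sint (Q x1) y1 y2.
have B0 : 0 <= B.
  have [||P0 _] := PQB 0 0; rewrite ?normr0//.
  exact: le_trans (normr_ge0 _) P0.
have key r : 0 < r -> r < d -> r < - x1 -> r < x2 -> r < - y1 -> r < y2 ->
    `|T1 + T2 - (T3 + T4)| <= 8 * B * r.
  move=> r0 rd rx1 rx2 ry1 ry2.
  have zero i j : x1 <= i.1 -> i.1 <= i.2 -> i.2 <= x2 ->
      y1 <= j.1 -> j.1 <= j.2 -> j.2 <= y2 ->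
      (0 < i.1) || (i.2 < 0) || (0 < j.1) || (j.2 < 0) ->
      circulation P Q i j = 0.
    move=> i1 i12 i2 j1 j12 j2 off; apply: goursat => // x y.
    move=> /andP[ix xi] /andP[jy yj]; apply: PQ.
    - by rewrite (le_trans i1 ix) (le_trans xi i2).
    - by rewrite (le_trans j1 jy) (le_trans yj j2).
    - rewrite -negb_and; apply/negP => /andP[/eqP x0 /eqP y0].
      by move: ix xi jy yj off; rewrite x0 y0 !ltNge => -> -> -> ->.
  have rn0 : r != 0 by rewrite gt_eqF.
  have Nrn0 : - r != 0 by rewrite oppr_eq0.
  have [x1n0 x2n0] : x1 != 0 /\ x2 != 0 by rewrite lt_eqF// gt_eqF.
  have [y1n0 y2n0] : y1 != 0 /\ y2 != 0 by rewrite lt_eqF// gt_eqF.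
  have [x1r y1r] : x1 <= - r /\ y1 <= - r by split; rewrite lerNr ltW.
  have Nr0 : - r < 0 by rewrite oppr_lt0.
  have Nrr : - r <= r by rewrite (le_trans (ltW Nr0))// ltW.
  have [rx2' ry2'] : r <= x2 /\ r <= y2 by split; exact: ltW.
  have [x1r' y1r'] : x1 <= r /\ y1 <= r by split; exact: le_trans Nrr.
  have [rx2N ry2N] : - r <= x2 /\ - r <= y2 by split; exact: le_trans Nrr _.
  have x12 : x1 <= x2 by exact: le_trans x1r' rx2'.
  have y12 : y1 <= y2 by exact: le_trans y1r' ry2'.
  have xin x : x \in [:: x1; x2; r; - r] -> x1 <= x <= x2 /\ x != 0.
    by rewrite !inE => /or4P[] /eqP ->; split=> //; rewrite ?lexx ?x12 ?x1r ?x1r' ?rx2' ?rx2N.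
  have yin y : y \in [:: y1; y2; r; - r] -> y1 <= y <= y2 /\ y != 0.
    by rewrite !inE => /or4P[] /eqP ->; split=> //; rewrite ?lexx ?y12 ?y1r ?y1r' ?ry2' ?ry2N.
  have Pc y a b : y \in [:: y1; y2; r; - r] -> x1 <= a -> b <= x2 ->
      cont_on (P ^~ y) a b.
    by move=> /yin[] ? ? ? ?; exact: cP.
  have Qc x a b : x \in [:: x1; x2; r; - r] -> y1 <= a -> b <= y2 ->
      cont_on (Q x) a b.
    by move=> /xin[] ? ? ? ?; exact: cQ.
  have [xl1 xl2 xl3 xl4] : [/\ x1 \in [:: x1; x2; r; - r], x2 \in [:: x1; x2; r; - r],
      r \in [:: x1; x2; r; - r] & - r \in [:: x1; x2; r; - r]].
    by rewrite !inE !eqxx ?orbT.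
  have [yl1 yl2 yl3 yl4] : [/\ y1 \in [:: y1; y2; r; - r], y2 \in [:: y1; y2; r; - r],
      r \in [:: y1; y2; r; - r] & - r \in [:: y1; y2; r; - r]].
    by rewrite !inE !eqxx ?orbT.
  have circ0 a b a' b' : a <= b -> a' <= b' ->
      a \in [:: x1; x2; r; - r] -> b \in [:: x1; x2; r; - r] ->
      a' \in [:: y1; y2; r; - r] -> b' \in [:: y1; y2; r; - r] ->
      (0 < a) || (b < 0) || (0 < a') || (b' < 0) ->
      sint (P ^~ a') a b - sint (P ^~ b') a b + (sint (Q b) a' b' - sint (Q a) a' b') = 0.
    move=> ab ab' ax bx ay by_ off.
    have [/andP[xa _] _] := xin _ ax; have [/andP[_ bx2] _] := xin _ bx.
    have [/andP[ya _] _] := yin _ ay; have [/andP[_ by2] _] := yin _ by_.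
    rewrite -(sintB (Pc _ _ _ ay xa bx2) (Pc _ _ _ by_ xa bx2)).
    rewrite -(sintB (Qc _ _ _ bx ya by2) (Qc _ _ _ ax ya by2)).
    exact: (zero (a, b) (a', b')).
  (* The frame around the square consists of four rectangles off the origin. *)
  have top := circ0 x1 x2 r y2 x12 ry2' xl1 xl2 yl3 yl2.
  have bot := circ0 x1 x2 y1 (- r) x12 y1r xl1 xl2 yl1 yl4.
  have lft := circ0 x1 (- r) (- r) r x1r Nrr xl1 xl4 yl4 yl3.
  have rgt := circ0 r x2 (- r) r rx2' Nrr xl3 xl2 yl4 yl3.
  rewrite Nr0 r0 !orbT in top bot lft rgt.
  have {}top := top isT; have {}bot := bot isT.
  have {}lft := lft isT; have {}rgt := rgt isT.
  have split3 h a b : a <= - r -> r <= b -> cont_on h a b ->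
      sint h a b = sint h a (- r) + sint h (- r) r + sint h r b.
    move=> ar rb hc; rewrite (@sint_split _ h a b (- r))//; last exact: le_trans rb.
    by rewrite (@sint_split _ h (- r) b r) ?addrA//; apply: cont_onW hc.
  have Pr := split3 _ _ _ x1r rx2' (Pc _ _ _ yl3 (lexx _) (lexx _)).
  have PNr := split3 _ _ _ x1r rx2' (Pc _ _ _ yl4 (lexx _) (lexx _)).
  have Q1 := split3 _ _ _ y1r ry2' (Qc _ _ _ xl1 (lexx _) (lexx _)).
  have Q2 := split3 _ _ _ y1r ry2' (Qc _ _ _ xl2 (lexx _) (lexx _)).
  have nr : `|r| < d by rewrite gtr0_norm.
  have nNr : `|- r| < d by rewrite normrN.
  have near0 z : - r <= z <= r -> `|z| < d.
    by rewrite -ler_norml => /le_lt_trans; apply.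
  have bP y : y \in [:: y1; y2; r; - r] -> `|y| < d ->
      `|sint (P ^~ y) (- r) r| <= B * (r - - r).
    move=> yi yd; apply: le_norm_sint_cst => //; first exact: Pc.
    by move=> z zr; have [] := PQB z y (near0 _ zr) yd.
  have bQ x : x \in [:: x1; x2; r; - r] -> `|x| < d ->
      `|sint (Q x) (- r) r| <= B * (r - - r).
    move=> xi xd; apply: le_norm_sint_cst => //; first exact: Qc.
    by move=> z zr; have [] := PQB x z xd (near0 _ zr).
  have := bP r yl3 nr; have := bP (- r) yl4 nNr.
  have := bQ r xl3 nr; have := bQ (- r) xl4 nNr.
  rewrite -/T4 in Q1; rewrite -/T2 in Q2.
  move: top bot lft rgt Pr PNr Q1 Q2.
  rewrite -/T1 -/T2 -/T3 -/T4 !ler_norml; clear.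
  move=> h1 h2 h3 h4 h5 h6 h7 h8.
  have -> : T1 + T2 - (T3 + T4) =
      sint (P ^~ (- r)) (- r) r - sint (P ^~ r) (- r) r
      + sint (Q r) (- r) r - sint (Q (- r)) (- r) r by lra.
  move=> {h1 h2 h3 h4 h5 h6 h7 h8} /andP[? ?] /andP[? ?] /andP[? ?] /andP[? ?].
  by apply/andP; split; lra.
apply/eqP; rewrite -subr_eq0 -normr_eq0 eq_le normr_ge0 andbT.
rewrite leNgt; apply/negP => T0; set T := `|_| in T0 key.
pose m := Num.min d (Num.min (Num.min (- x1) x2) (Num.min (- y1) y2)).
have m0 : 0 < m by rewrite !lt_min !oppr_gt0 d0 x10 x20 y10 y20.
pose r := Num.min (m / 2) (T / (16 * (B + 1))).
have B1 : 0 < 16 * (B + 1) by lra.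
have r0 : 0 < r by rewrite lt_min !divr_gt0.
have rm : r < m by rewrite gt_min ltr_pdivrMr// ltr_pMr// ltr1n.
have : T <= 8 * B * r.
  by move: rm; rewrite !lt_min => /and3P[? /andP[? ?] /andP[? ?]]; exact: key.
apply/negP; rewrite -ltNge.
have rT : r * (16 * (B + 1)) <= T by rewrite -ler_pdivlMr// ge_min lexx orbT.
have : 0 <= B * r by rewrite mulr_ge0// ltW.
by lra.
Qed.

End Goursat.

(** * A smoothed step function *)

Section Calculus.
Context {R : realType}.
Notation mu := (@lebesgue_measure R).
Implicit Types (f g : R -> R) (x a b : R).

Lemma dcst (k x : R) : is_derive x 1 (fun=> k) (0 : R).
Proof. exact: is_derive_cst. Qed.

Lemma did x : is_derive x 1 (fun y : R => y) (1 : R).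
Proof. exact: is_derive_id. Qed.

Lemma dadd f g x df dg : is_derive x 1 f df -> is_derive x 1 g dg ->
  is_derive x 1 (fun y => f y + g y) (df + dg).
Proof. by move=> ? ?; exact: is_deriveD. Qed.

Lemma dopp f x df : is_derive x 1 f df -> is_derive x 1 (fun y => - f y) (- df).
Proof. by move=> ?; exact: is_deriveN. Qed.

Lemma dmul f g x df dg : is_derive x 1 f df -> is_derive x 1 g dg ->
  is_derive x 1 (fun y => f y * g y) (df * g x + f x * dg).
Proof.
move=> dfx dgx.
rewrite (_ : df * g x + f x * dg = f x *: dg + g x *: df); first exact: is_deriveM.
by rewrite /GRing.scale/= addrC [df * _]mulrC.
Qed.

Lemma dexpn f x df n : is_derive x 1 f df ->
  is_derive x 1 (fun y => f y ^+ n) (n%:R * f x ^+ n.-1 * df).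
Proof.
move=> fx; rewrite (_ : _ * df = (n%:R * f x ^+ n.-1) *: df)//.
rewrite (_ : (fun y => f y ^+ n) = f ^+ n); first exact: is_deriveX.
by apply/funext => y; rewrite fctE.
Qed.

Lemma dinv f x df : f x != 0 -> is_derive x 1 f df ->
  is_derive x 1 (fun y => (f y)^-1) (- (f x ^+ 2)^-1 * df).
Proof. by move=> fx0 fx; exact: is_deriveV. Qed.

Lemma dcomp (h : R -> R) f x dh df : is_derive (f x) 1 h dh ->
  is_derive x 1 f df -> is_derive x 1 (fun y => h (f y)) (dh * df).
Proof. by move=> hx fx; exact: is_derive1_comp. Qed.

Lemma dexp f x df : is_derive x 1 f df ->
  is_derive x 1 (fun y => expR (f y)) (expR (f x) * df).
Proof. by move=> fx; apply: dcomp. Qed.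

Lemma dsin f x df : is_derive x 1 f df ->
  is_derive x 1 (fun y => sin (f y)) (cos (f x) * df).
Proof. by move=> fx; apply: dcomp. Qed.

Lemma dcos f x df : is_derive x 1 f df ->
  is_derive x 1 (fun y => cos (f y)) (- sin (f x) * df).
Proof. by move=> fx; apply: dcomp. Qed.

Lemma dcong f x df df' : is_derive x 1 f df -> df = df' -> is_derive x 1 f df'.
Proof. by move=> ? <-. Qed.

Lemma is_derive_cont f x df : is_derive x 1 f df -> {for x, continuous f}.
Proof. by move=> [fx _]; apply: differentiable_continuous; exact/derivable1_diffP. Qed.

(** Lets an explicit antiderivative [g] of the bound [g'] stand in for an
    integral of the derivative of [f]. *)
Lemma deriv_compare f g (f' g' : R -> R) a b : a <= b ->
  (forall x, a <= x <= b -> is_derive x 1 f (f' x)) ->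
  (forall x, a <= x <= b -> is_derive x 1 g (g' x)) ->
  (forall x, a <= x <= b -> `|f' x| <= g' x) ->
  `|f b - f a| <= g b - g a.
Proof.
move=> ab df dg fg.
have mono (h h' : R -> R) : (forall x, a <= x <= b -> is_derive x 1 h (h' x)) ->
    (forall x, a <= x <= b -> 0 <= h' x) -> h a <= h b.
  move=> dh h0; rewrite -subr_ge0.
  have [|c|c cab ->] := @MVT_segment _ h h' a b ab.
  - by move=> x; rewrite in_itv/= => /andP[/ltW ax /ltW xb]; apply: dh; rewrite ax.
  - apply: cont_on_within => x xab; exact: is_derive_cont (dh _ xab).
  - by rewrite mulr_ge0 ?subr_ge0// h0.
rewrite ler_norml; apply/andP; split.
  have : g a + f a <= g b + f b; last lra.
  apply: (mono (fun x => g x + f x) (fun x => g' x + f' x)) => x xab.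
    by apply: dadd; [exact: dg|exact: df].
  by move: (fg _ xab); rewrite ler_norml => /andP[]; lra.
have : g a - f a <= g b - f b; last lra.
apply: (mono (fun x => g x - f x) (fun x => g' x - f' x)) => x xab.
  by apply: dadd; [exact: dg|apply: dopp; exact: df].
by move: (fg _ xab); rewrite ler_norml => /andP[]; lra.
Qed.

Lemma sint_FTC f (F : R -> R) a b : a <= b ->
  (forall x, is_derive x 1 F (f x)) -> cont_on f a b ->
  sint f a b = F b - F a.
Proof.
rewrite le_eqVlt => /predU1P[->|ab] dF cf.
  by rewrite /sint set_itv1 Rintegral_set1 subrr.
rewrite /sint /Rintegral (@continuous_FTC2 _ f F a b ab)//.
- exact: cont_on_within.
- have cF x : {for x, continuous F} by exact: is_derive_cont (dF x).
  split.
  + by move=> x _; exact: ex_derive.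
  + exact: cvg_at_right_filter (cF a).
  + exact: cvg_at_left_filter (cF b).
- by move=> x _; rewrite derive1E derive_val.
Qed.

End Calculus.

Ltac deriv1 := first
  [ notypeclasses refine (dcst _ _) | notypeclasses refine (did _)
  | notypeclasses refine (dadd _ _) | notypeclasses refine (dopp _)
  | notypeclasses refine (dexpn _ _) | notypeclasses refine (dexp _)
  | notypeclasses refine (dsin _) | notypeclasses refine (dcos _)
  | notypeclasses refine (dinv _ _) | notypeclasses refine (dmul _ _) ].
(** Differentiates an explicit function, leaving nonzero denominators. *)
Ltac deriv := repeat deriv1.
Ltac contin := move=> ? ?; eapply is_derive_cont; by deriv.

Section StepKernel.
Context {R : realType}.
Notation mu := (@lebesgue_measure R).
Implicit Types (a u v y t rho : R).

(** A polynomial, in order that it extends to complex arguments, with double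
    zeros at 1 and -1, which make its Fourier transform decay. *)
Definition bump y : R := (1 - y ^+ 2) ^+ 2.

Lemma bump_ge0 y : 0 <= bump y.
Proof. exact: sqr_ge0. Qed.

Lemma bump_le1 y : `|y| <= 1 -> bump y <= 1.
Proof.
move=> y1; rewrite /bump expr_le1//.
  by have := sqr_ge0 y; lra.
by rewrite subr_ge0 -real_normK ?num_real// expr_le1.
Qed.

(** The Fourier transform of [bump], rescaled to frequencies below [rho]. *)
Definition kern rho u : R := sint (fun y => bump (y / rho) * cos (y * u)) (- rho) rho.

Definition skern_integrand a rho u y : R :=
  bump (y / rho) *
  (expR (a * u) * (a * cos (y * u) + y * sin (y * u)) / (a ^+ 2 + y ^+ 2)).

(** The antiderivative of [expR (a * u) * kern rho u] that vanishes at minus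
    infinity; it behaves like the step function of height [2 * pi] at 0. *)
Definition skern a rho u : R := sint (skern_integrand a rho u) (- rho) rho.

Lemma cont_skern_integrand a rho u x y : 0 < a -> cont_on (skern_integrand a rho u) x y.
Proof.
move=> a0 z _; have D0 : a ^+ 2 + z ^+ 2 != 0.
  by rewrite gt_eqF// ltr_wpDr ?sqr_ge0// exprn_gt0.
rewrite /skern_integrand /bump; eapply is_derive_cont.
by deriv.
Qed.

Lemma cont_kern_integrand rho u x y :
  cont_on (fun y => bump (y / rho) * cos (y * u)) x y.
Proof. by rewrite /bump; contin. Qed.

Lemma bump_itv rho y : 0 < rho -> - rho <= y <= rho -> `|bump (y / rho)| <= 1.
Proof.
move=> r0 yr; rewrite ger0_norm ?bump_ge0// bump_le1//.
by rewrite normrM normfV (gtr0_norm r0) ler_pdivrMr// mul1r ler_norml.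
Qed.

Lemma kernN rho u : kern rho (- u) = kern rho u.
Proof. by apply: eq_sint => y _; rewrite mulrN cosN. Qed.

Lemma kern_le1 rho u : 0 < rho -> `|kern rho u| <= 2 * rho.
Proof.
move=> r0; apply: (le_trans (@le_norm_sint_cst _ _ 1 _ _ _ _ _)).
- lra.
- exact: cont_kern_integrand.
- move=> y yr; rewrite normrM mulr_ile1 ?normr_ge0 ?bump_itv//.
  by rewrite ler_norml cos_geN1 cos_le1.
- lra.
Qed.

(** [bump] vanishes to second order at the end points, so three integrations
    by parts gain the factor [(rho * u) ^- 3]. *)
Lemma kern_decay rho u : 0 < rho -> 1 <= rho * u ->
  `|kern rho u| <= 112 * (rho / (rho * u) ^+ 3).
Proof.
move=> r0 ru; have u0 : 0 < u by rewrite -(pmulr_rgt0 _ r0); lra.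
have [un0 rn0] : u != 0 /\ rho != 0 by rewrite !gt_eqF.
(* The antiderivative found by integrating by parts until the polynomial is
   used up; the terms of order [u ^- 1] and [u ^- 2] vanish at both ends. *)
pose G y := bump (y / rho) * sin (y * u) / u
  + (4 * y ^+ 3 / rho ^+ 4 - 4 * y / rho ^+ 2) * cos (y * u) / u ^+ 2
  - (12 * y ^+ 2 / rho ^+ 4 - 4 / rho ^+ 2) * sin (y * u) / u ^+ 3
  - 24 * y / rho ^+ 4 * cos (y * u) / u ^+ 4
  + 24 / rho ^+ 4 * sin (y * u) / u ^+ 5.
have GE : kern rho u = G rho - G (- rho).
  apply: sint_FTC; [lra| |exact: cont_kern_integrand].
  move=> y; rewrite /G /bump; eapply dcong; first by deriv.
  by rewrite /=; field; rewrite un0 rn0.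
set r := rho * u in ru *.
have rge n : 0 <= r ^- n.+1 <= 1.
  have rn : 1 <= r ^+ n.+1 by rewrite exprn_ege1.
  by rewrite invr_ge0 invf_le1 ?rn ?andbT//; lra.
have sb := sin_le1 r; have sb' := sin_geN1 r.
have cb := cos_le1 r; have cb' := cos_geN1 r.
have GE2 : kern rho u = rho / r ^+ 3 *
    (- 16 * sin r - 48 * (cos r / r) + 48 * (sin r / r ^+ 2)).
  rewrite GE /G /bump (mulNr rho u) sinN cosN -/r (mulNr rho) divff// /r.
  by field; rewrite rn0 un0.
have rr0 : 0 <= rho / r ^+ 3.
  by apply: divr_ge0; [lra|apply: exprn_ge0; lra].
rewrite GE2 normrM (ger0_norm rr0) [112 * _]mulrC; apply: ler_wpM2l => //.
have nb (z s : R) : -1 <= s -> s <= 1 -> 0 <= z <= 1 -> `|s * z| <= 1.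
  move=> s1 s2 /andP[z0 z1]; rewrite normrM mulr_ile1// ?ler_norml ?s1 ?s2//.
  by rewrite z1 andbT; lra.
have := nb r^-1 (cos r) cb' cb (rge 0%N).
have := nb (r ^- 2) (sin r) sb' sb (rge 1%N).
rewrite !ler_norml => /andP[? ?] /andP[? ?].
by apply/andP; split; lra.
Qed.

Lemma kern_bound : exists2 C : R, 0 < C & forall rho u, 0 < rho ->
  `|kern rho u| <= C * (rho / (1 + rho * `|u|) ^+ 3).
Proof.
exists 896 => [|rho u r0]; first lra.
wlog u0 : u / 0 <= u.
  move=> H; have [/H//|/ltW u0] := leP 0 u.
  by rewrite -kernN -(normrN u); apply: H; rewrite oppr_ge0.
rewrite (ger0_norm u0); set x := rho * u.
have x0 : 0 <= x by rewrite mulr_ge0// ltW.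
have x3 : 0 < (1 + x) ^+ 3 by rewrite exprn_gt0//; lra.
rewrite mulrA ler_pdivlMr//.
have [x1|x1] := leP 1 x.
  have xp : 0 < x ^+ 3 by rewrite exprn_gt0//; lra.
  have := kern_decay r0 x1; rewrite -/x => kd.
  apply: (le_trans (ler_wpM2r (ltW x3) kd)).
  have -> : 112 * (rho / x ^+ 3) * (1 + x) ^+ 3 = 112 * rho * ((1 + x) ^+ 3 / x ^+ 3).
    by rewrite !mulrA -!(mulrAC _ (x ^- 3)).

  have : (1 + x) ^+ 3 / x ^+ 3 <= 8.
    rewrite ler_pdivrMr// -subr_ge0.
    have -> : 8 * x ^+ 3 - (1 + x) ^+ 3 = (x - 1) * (7 * x ^+ 2 + 4 * x + 1) by ring.
    by rewrite mulr_ge0//; [lra|have := sqr_ge0 x; lra].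
  have r112 : 0 < 112 * rho by rewrite mulr_gt0.
  by move=> h; rewrite -(ler_pM2l r112) in h; lra.
have : (1 + x) ^+ 3 <= 8.
  rewrite -subr_ge0.
  have -> : 8 - (1 + x) ^+ 3 = (1 - x) * ((1 + x) ^+ 2 + 2 * (1 + x) + 4) by ring.
  by rewrite mulr_ge0//; [lra|have := sqr_ge0 (1 + x); lra].
move=> h; apply: (le_trans (ler_pM _ _ (kern_le1 u r0) h)) => //; lra.
Qed.

(** Differentiation under the integral sign cancels [a ^+ 2 + y ^+ 2]. *)
Lemma skern_deriv a rho u : 0 < a -> 0 < rho ->
  is_derive u 1 (skern a rho) (expR (a * u) * kern rho u).
Proof.
move=> a0 r0.
have D0 y : a ^+ 2 + y ^+ 2 != 0.
  by rewrite gt_eqF// ltr_wpDr ?sqr_ge0// exprn_gt0.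
have dV v y : is_derive v 1 (fun v => skern_integrand a rho v y)
    (expR (a * v) * (bump (y / rho) * cos (y * v))).
  rewrite /skern_integrand /bump; eapply dcong; first by deriv.
  by rewrite /=; field; rewrite D0 gt_eqF.
have rr : - rho <= rho by lra.
have pE v y : partial1of2 (skern_integrand a rho) v y =
    expR (a * v) * (bump (y / rho) * cos (y * v)).
  by rewrite partial1of2E derive_val.
have uI : u \in `](u - 1), (u + 1)[ by rewrite in_itv/=; apply/andP; split; lra.
have uI' : [set` `](u - 1), (u + 1)[] u := uI.
have mB : measurable [set` `[(- rho), rho]] by [].
have h1 x : [set` `](u - 1), (u + 1)[] x ->
    mu.-integrable `[(- rho), rho] (EFin \o skern_integrand a rho x).
  by move=> _; apply: cont_on_integrable; exact: cont_skern_integrand.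
have h2 x y : [set` `](u - 1), (u + 1)[] x -> [set` `[(- rho), rho]] y ->
    derivable (skern_integrand a rho ^~ y) x 1.
  by move=> _ _; exact: ex_derive.
have h3 y : 0 <= (fun _ : R => expR (a * (u + 1))) y by exact: expR_ge0.
have h4 : mu.-integrable `[(- rho), rho] (EFin \o (fun _ : R => expR (a * (u + 1)))).
  by apply: cont_on_integrable; exact: cont_on_cst.
have h5 x y : [set` `](u - 1), (u + 1)[] x -> [set` `[(- rho), rho]] y ->
    `|partial1of2 (skern_integrand a rho) x y| <= expR (a * (u + 1)).
  rewrite /= !in_itv/= => /andP[_ xu] yr; rewrite pE normrM.
  rewrite -[leRHS]mulr1 ler_pM//.
    by rewrite ger0_norm ?expR_ge0// ler_expR ler_pM2l// ltW.
  rewrite normrM mulr_ile1 ?normr_ge0 ?bump_itv//.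
  by rewrite ler_norml cos_geN1 cos_le1.
have dr := @derivable_under_integral R _ _ mu (skern_integrand a rho) _ mB u _ _ uI' h1 h2
  (fun=> expR (a * (u + 1))) h3 h4 h5.
have dE := @differentiation_under_integral R _ _ mu (skern_integrand a rho) _ mB u _ _ uI' h1 h2
  (fun=> expR (a * (u + 1))) h3 h4 h5.
apply: DeriveDef; first exact: dr.
rewrite -derive1E [LHS]dE /kern -sintZ; last exact: cont_kern_integrand.
by apply: eq_sint => y _; exact: pE.
Qed.
End StepKernel.

Section StepKernelEstimates.
Context {R : realType}.
Implicit Types (a u v y t rho : R).
Variable C : R.
Hypothesis C0 : 0 < C.
Hypothesis kern_C : forall rho u, 0 < rho ->
  `|kern rho u| <= C * (rho / (1 + rho * `|u|) ^+ 3).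

Let sqpow_gt0 rho u : 0 < rho -> 0 <= u -> 0 < 1 + rho * u.
Proof. by move=> r0 u0; rewrite ltr_pwDl// mulr_ge0// ltW. Qed.

(** The exponential factor is what makes [skern] vanish at minus infinity. *)
Lemma skern_bound a rho u : 0 < a -> 0 < rho ->
  `|skern a rho u| <= expR (a * u) * ((a + rho) / a ^+ 2 * (2 * rho)).
Proof.
move=> a0 r0; have a20 : 0 < a ^+ 2 by rewrite exprn_gt0.
apply: (le_trans (@le_norm_sint_cst _ _ (expR (a * u) * ((a + rho) / a ^+ 2)) _ _ _ _ _)).
- lra.
- exact: cont_skern_integrand.
- move=> y yr; rewrite normrM -[leRHS]mul1r ler_pM ?normr_ge0 ?bump_itv//.
  have y2 := sqr_ge0 y.
  rewrite -mulrA normrM ger0_norm ?expR_ge0// ler_pM2l ?expR_gt0//.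
  rewrite normrM normfV (gtr0_norm (x := a ^+ 2 + y ^+ 2)); last lra.
  rewrite ler_pM ?invr_ge0//; [lra| |by rewrite lef_pV2 ?posrE//; lra].
  rewrite (le_trans (ler_normD _ _))// !normrM (gtr0_norm a0) lerD//.
    by rewrite -[leRHS]mulr1 ler_pM2l// ler_norml cos_geN1 cos_le1.
  rewrite -[leRHS]mulr1 ler_pM ?normr_ge0//; first by rewrite ler_norml.
  by rewrite ler_norml sin_geN1 sin_le1.
- by rewrite le_eqVlt; apply/orP; left; apply/eqP; ring.
Qed.

(** Integrate the derivative from minus infinity, where [skern] vanishes by
    [skern_bound]; there [expR (a * v) <= 1]. *)
Lemma skern_left a rho u : 0 < a -> 0 < rho -> u <= 0 ->
  `|skern a rho u| <= C / 2 / (1 + rho * `|u|) ^+ 2.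
Proof.
have Cpos := C0.
move=> a0 r0 u0; rewrite (ler0_norm u0).
pose g v : R := C / 2 * (1 - rho * v) ^- 2.
have pos v : v <= 0 -> 0 < 1 - rho * v.
  by move=> v0; have := sqpow_gt0 r0 (_ : 0 <= - v); rewrite oppr_ge0 mulrN => ->.
have step n : `|skern a rho u - skern a rho (u - n%:R)| <= g u - g (u - n%:R).
  have n0 : (0 : R) <= n%:R by [].
  apply: (@deriv_compare _ _ _ (fun v => expR (a * v) * kern rho v)
    (fun v => C * (rho / (1 - rho * v) ^+ 3))).
  - lra.
  - by move=> v _; exact: skern_deriv.
  - move=> v /andP[_ vu]; have pv := pos _ (le_trans vu u0).
    rewrite /g; eapply dcong; first by deriv; rewrite expf_neq0// gt_eqF.
    by rewrite /=; field; rewrite gt_eqF.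
  - move=> v /andP[_ vu]; have v0 := le_trans vu u0.
    rewrite normrM (ger0_norm (expR_ge0 _)).
    rewrite -[leRHS]mul1r ler_pM ?expR_ge0//; first by rewrite expR_le1 mulr_ge0_le0// ltW.
    have := kern_C v r0; rewrite (ler0_norm v0) mulrN; apply: le_trans.
    exact: lexx.
have gu : g u = C / 2 / (1 + rho * - u) ^+ 2 by rewrite /g mulrN.
rewrite -gu leNgt; apply/negP => lt_gu.
pose K := (a + rho) / a ^+ 2 * (2 * rho).
have K0 : 0 <= K.
  by rewrite /K !mulr_ge0 ?invr_ge0 ?exprn_ge0//; lra.
pose e := `|skern a rho u| - g u.
have e0 : 0 < e by rewrite subr_gt0.
(* As [n] grows, [step n] compares [skern a rho u] with its limit 0. *)
have small n : e <= K * expR (a * u) * (expR (- a)) ^+ n.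
  have := step n; have := @skern_bound a rho (u - n%:R) a0 r0.
  rewrite -/K mulrBr expRD -expRM_natr mulNr.
  have : 0 <= g (u - n%:R).
    have n0 : (0 : R) <= n%:R by [].
    rewrite /g; apply: mulr_ge0; first by apply: divr_ge0 => //; exact: ltW.
    by rewrite invr_ge0 exprn_ge0// ltW// pos//; lra.
  have := lerB_dist (skern a rho u) (skern a rho (u - n%:R)).
  rewrite /e -mulrA [K * _]mulrC; lra.
have : K * expR (a * u) * expR (- a) ^+ n @[n --> \oo] --> K * expR (a * u) * 0.
  apply: cvgM; [exact: cvg_cst|apply: cvg_expr].
  by rewrite ger0_norm ?expR_ge0// expR_lt1 oppr_lt0.
rewrite mulr0 => /cvgrPdist_lt/(_ _ e0)[n _ /(_ n (leqnn n))] /=.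
rewrite sub0r normrN => /(le_lt_trans (ler_norm _)).
by apply/negP; rewrite -leNgt.
Qed.

(** Integrate the derivative from [u] to [t], where [expR (a * v) <= expR 1]. *)
Lemma skern_right a rho u t : 0 < a -> 0 < rho -> 0 <= u -> u <= t -> a * t <= 1 ->
  `|skern a rho t - skern a rho u| <= C / 2 * expR 1 / (1 + rho * u) ^+ 2.
Proof.
have Cpos := C0.
move=> a0 r0 u0 ut at1.
pose g v : R := - (C / 2 * expR 1 * (1 + rho * v) ^- 2).
have : `|skern a rho t - skern a rho u| <= g t - g u.
  apply: (@deriv_compare _ _ _ (fun v => expR (a * v) * kern rho v)
    (fun v => expR 1 * (C * (rho / (1 + rho * v) ^+ 3)))) => [//|||].
  - by move=> v _; exact: skern_deriv.
  - move=> v /andP[uv _]; have pv := sqpow_gt0 r0 (le_trans u0 uv).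
    rewrite /g; eapply dcong; first by deriv; rewrite expf_neq0// gt_eqF.
    by rewrite /=; field; rewrite gt_eqF.
  - move=> v /andP[uv vt]; have v0 := le_trans u0 uv.
    rewrite normrM (ger0_norm (expR_ge0 _)) ler_pM ?expR_ge0//.
      by rewrite ler_expR (le_trans _ at1)// ler_pM2l.
    by have := kern_C v r0; rewrite (ger0_norm v0).
move=> /le_trans; apply; rewrite /g opprK gerDr oppr_le0.
have e0 := expR_ge0 (1 : R).
have s0 : 0 < 1 + rho * t by apply: sqpow_gt0 => //; exact: le_trans u0 ut.
apply: mulr_ge0; first by apply: mulr_ge0 => //; lra.
by rewrite invr_ge0 exprn_ge0// ltW.
Qed.

(** For [u = 0] the integrand is nonnegative, and on [0 <= y <= a] the bump is at
    least [9 / 16] and the Poisson factor at least [1 / (2 * a)]. *)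
Lemma skern0_ge a rho : 0 < a -> 2 * a <= rho -> 9 / 32 <= skern a rho 0.
Proof.
have Cpos := C0.
move=> a0 ar; have r0 : 0 < rho by lra.
have cI x y := @cont_skern_integrand R a rho 0 x y a0.
have IE y : skern_integrand a rho 0 y = bump (y / rho) * (a / (a ^+ 2 + y ^+ 2)).
  by rewrite /skern_integrand !mulr0 expR0 cos0 sin0 mulr0 addr0 mulr1 mul1r.
have I0 y : 0 <= skern_integrand a rho 0 y.
  by rewrite IE mulr_ge0 ?bump_ge0// divr_ge0// ?addr_ge0 ?sqr_ge0// ltW.
have s0 x y : x <= y -> 0 <= sint (skern_integrand a rho 0) x y.
  by move=> xy; apply: Rintegral_ge0.
rewrite /skern (@sint_split _ _ _ _ 0)//; [|lra..].
rewrite (@sint_split _ _ 0 rho a)//; [|lra..].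
have l1 := s0 (- rho) 0; have l2 := s0 a rho.
have l3 : 9 / 32 / a * (a - 0) <= sint (skern_integrand a rho 0) 0 a.
  rewrite -sint_cst; last lra.
  apply: le_sint => //; first exact: cont_on_cst.
  move=> y /andP[y0 ya]; rewrite IE.
  have -> : 9 / 32 / a = 9 / 16 * (a / (a ^+ 2 + a ^+ 2)) by field; rewrite !gt_eqF ?addr_gt0 ?exprn_gt0.
  have y2 : 0 <= y ^+ 2 by exact: sqr_ge0.
  have a2 : 0 < a ^+ 2 by rewrite exprn_gt0.
  have ya2 : y ^+ 2 <= a ^+ 2 by rewrite ler_sqr ?nnegrE//; lra.
  rewrite ler_pM//.
  - by rewrite divr_ge0//; lra.
  - have yr : 0 <= y / rho <= 1 / 2.
      by rewrite divr_ge0 ?ler_pdivrMr//=; lra.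
    have yr2 : (y / rho) ^+ 2 <= 1 / 4.
      have -> : 1 / 4 = (1 / 2) ^+ 2 :> R by field.
      by case/andP : yr => ? ?; rewrite ler_sqr ?nnegrE//; lra.
    rewrite /bump; have -> : 9 / 16 = (3 / 4) ^+ 2 :> R by field.
    by rewrite ler_sqr ?nnegrE//; lra.
  - by rewrite ler_pM2l// lef_pV2 ?posrE; lra.
move: l3; rewrite subr0 divfK ?gt_eqF//; lra.
Qed.

(** As [kern] is even, the derivative of [skern a rho v + skern a rho (- v)] is
    [(expR (a * v) - expR (- (a * v))) * kern rho v]; its first factor is small
    for small [v] and its second one for the other [v]. So the sum stays close
    to its value at 0, and [skern a rho (- t)] is small. *)
Lemma skern_lb a rho t : 0 < t -> a * t = 1 ->
  2 + 4 * (2 * C * expR 1 + C / 2) <= rho * t -> 1 / 4 <= skern a rho t.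
Proof.
have Cpos := C0.
move=> t0 at1 L; have a0 : 0 < a by rewrite -(pmulr_lgt0 _ t0) at1.
have e0 := expR_gt0 (1 : R).
have Ce0 : 0 < C * expR 1 by exact: mulr_gt0.
have rt0 : 0 < rho * t by apply: lt_le_trans L; lra.
have r0 : 0 < rho by rewrite -(pmulr_lgt0 _ t0).
pose S v := skern a rho v + skern a rho (- v).
have dS v : is_derive v 1 S ((expR (a * v) - expR (- (a * v))) * kern rho v).
  have d1 := skern_deriv v a0 r0.
  have d2 := dcomp (skern_deriv (- v) a0 r0) (dopp (did v)).
  apply: dcong (dadd d1 d2) _; by rewrite kernN (mulrN a); ring.
pose g v : R := - (2 * C * expR 1 * (a / rho) * (1 + rho * v)^-1).
have : `|S t - S 0| <= g t - g 0.
  apply: (@deriv_compare _ _ _ _ (fun v => 2 * C * expR 1 * a * (1 + rho * v) ^- 2)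
    _ _ _ (fun v _ => dS v)) => [|v|v]; first exact: ltW.
    move=> /andP[v0 _]; have pv := sqpow_gt0 r0 v0.
    rewrite /g; eapply dcong; first by deriv; rewrite gt_eqF.
    by rewrite /=; field; rewrite !gt_eqF.
  move=> /andP[v0 vt]; rewrite normrM.
  have av1 : a * v <= 1 by rewrite -at1 ler_pM2l.
  have av0 : 0 <= a * v by rewrite mulr_ge0// ltW.
  have pv := sqpow_gt0 r0 v0.
  have h1 : `|expR (a * v) - expR (- (a * v))| <= 2 * expR 1 * (a * v).
    have e2 : expR (- (a * v)) = expR (a * v) * expR (- 2 * (a * v)).
      by rewrite -expRD; congr expR; ring.
    have := expR_ge1Dx (- 2 * (a * v)) => e3.
    have e4 : expR (- (2 * (a * v))) <= 1 by rewrite expR_le1 oppr_le0; lra.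
    have e5 : expR (a * v) <= expR 1 by rewrite ler_expR.
    have e6 := expR_gt0 (a * v).
    rewrite e2 ger0_norm; last first.
      by rewrite subr_ge0 -[leRHS]mulr1 ler_pM2l// mulNr.
    apply: (@le_trans _ _ (expR (a * v) * (2 * (a * v)))).
      have -> : expR (a * v) - expR (a * v) * expR (- 2 * (a * v)) =
        expR (a * v) * (1 - expR (- 2 * (a * v))) by ring.
      by rewrite ler_pM2l//; lra.
    have -> : 2 * expR 1 * (a * v) = expR 1 * (2 * (a * v)) by ring.
    by rewrite ler_wpM2r//; lra.
  have h2 := kern_C v r0; rewrite (ger0_norm v0) in h2.
  apply: (le_trans (ler_pM _ _ h1 h2)) => //.
  have -> : 2 * expR 1 * (a * v) * (C * (rho / (1 + rho * v) ^+ 3)) =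
    2 * C * expR 1 * a * (1 + rho * v) ^- 2 * (rho * v / (1 + rho * v)).
    by field; rewrite gt_eqF.
  rewrite -[leRHS]mulr1 ler_wpM2l//.
    by rewrite !mulr_ge0 ?expR_ge0 ?invr_ge0 ?exprn_ge0// ltW.
  by rewrite ler_pdivrMr//; lra.
have r2a : 2 * a <= rho.
  by rewrite -(ler_pM2r t0) -mulrA at1 mulr1; lra.
have arE : a / rho = (rho * t)^-1.
  by apply: (mulIf (lt0r_neq0 rt0)); rewrite mulVf ?lt0r_neq0// mulrA divfK ?lt0r_neq0// at1.
have rt1 : 1 <= rho * t by lra.
have h2 : 2 * C * expR 1 * (a / rho) + C / 2 * (a / rho) <= 1 / 4.
  rewrite -mulrDl arE ler_pdivrMr//; lra.
have h3 : `|skern a rho (- t)| <= C / 2 * (a / rho).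
  have Nt0 : - t <= 0 by lra.
  have := skern_left a0 r0 Nt0; rewrite normrN (gtr0_norm t0).
  move=> /le_trans; apply; rewrite arE ler_pM2l ?divr_gt0// lef_pV2 ?posrE ?exprn_gt0//; last lra.
  by rewrite expr2 -[leLHS]mul1r ler_pM//; lra.
have h4 := skern0_ge a0 r2a.
have h5 : 0 <= 2 * C * expR 1 * (a / rho) * (1 + rho * t)^-1.
  by rewrite !mulr_ge0 ?invr_ge0 ?expR_ge0//; lra.
rewrite /g /S oppr0 mulr0 addr0 invr1 mulr1 opprK ler_norml => /andP[h1 _].
by move: h3; rewrite ler_norml => /andP[_ h3]; lra.
Qed.

End StepKernelEstimates.

(** * The Bochner integral *)

Section LowerIntegral.
Import HBNNSimple.
Local Open Scope ereal_scope.
Context d (T : measurableType d) (R : realType) (mu : {measure set T -> \bar R}).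
Implicit Types (D E : set T) (f g : T -> \bar R).

(** For a nonnegative function that is not measurable, the integral is a
    supremum over simple functions below it; monotonicity and the
    indifference to null sets hold for that lower integral as well. *)
Lemma le_lower_integral D f g : (forall x, D x -> 0 <= f x) ->
  (forall x, D x -> f x <= g x) ->
  \int[mu]_(x in D) f x <= \int[mu]_(x in D) g x.
Proof.
move=> f0 fg; rewrite !ge0_integralE//; last first.
  by move=> x Dx; exact: le_trans (f0 _ Dx) (fg _ Dx).
apply: ge_ereal_sup => _ [h /= hf <-]; apply: ereal_sup_ubound; exists h => //= x.
apply: le_trans (hf x) _; rewrite /patch; case: ifPn => //.
by rewrite inE; exact: fg.
Qed.

Lemma lower_integral_null D E f : measurable D -> measurable E -> E `<=` D ->
  mu (D `\` E) = 0 -> (forall x, D x -> 0 <= f x) ->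
  \int[mu]_(x in D) f x = \int[mu]_(x in E) f x.
Proof.
move=> mD mE ED DE0 f0; apply/eqP; rewrite eq_le; apply/andP; split; last first.
  rewrite (integral_mkcond E) (integral_mkcond D); apply: le_lower_integral => x _.
    by rewrite /patch; case: ifPn => // /set_mem /ED /f0.
  rewrite /patch; case: ifPn => [/set_mem xE|_]; first by rewrite mem_set//; exact: ED.
  by case: ifPn => // /set_mem /f0.
rewrite [leLHS]ge0_integralE//; apply: ge_ereal_sup => _ [h /= hf <-].
rewrite -integralT_nnsfun.
have h0 x : ~ D x -> h x = 0%R.
  move=> nDx; apply/eqP; rewrite eq_le fun_ge0 andbT -lee_fin.
  by rewrite (le_trans (hf x))// /patch memNset.
have mh (A : set T) : measurable_fun A (EFin \o h).
  by apply/measurable_EFinP; apply: measurable_funTS.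
rewrite (@ge0_ae_eq_integral _ _ _ mu setT (EFin \o h)
  (patch (fun=> 0%E) E (EFin \o h))) //; first last.
- exists (D `\` E); split => //; first exact: measurableD.
  move=> x /not_implyP[_ hx]; split.
    apply: contrapT => nDx; apply: hx.
    by rewrite /patch memNset /= ?h0// => /ED.
  by move=> Ex; apply: hx; rewrite /patch mem_set.
- by move=> x _; rewrite /patch; case: ifPn => // _; rewrite lee_fin.
- by move=> x _; rewrite lee_fin.
- by apply/(measurable_restrictT _ _).1 => //; exact: mh.
rewrite -(integral_mkcond E (EFin \o h)); apply: le_lower_integral => x Ex; first by rewrite lee_fin.
by apply: le_trans (hf x) _; rewrite /patch mem_set//; exact: ED.
Qed.

End LowerIntegral.

Section FiniteLevels.
Context d (T : measurableType d) (E : set T).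
Hypothesis mE : measurable E.

(** What pointwise operations preserve among the properties of [simple_on]. *)
Definition finite_levels (Y : Type) (s : T -> Y) :=
  finite_set (range s) /\ forall y, measurable (E `&` s @^-1` [set y]).

Lemma finite_levels_preimage Y (s : T -> Y) (B : set Y) : finite_levels s ->
  measurable (E `&` s @^-1` B).
Proof.
move=> [fs ms].
have -> : E `&` s @^-1` B = \bigcup_(y in range s `&` B) (E `&` s @^-1` [set y]).
  apply/seteqP; split=> [t [Et Bst]|t [y [_ By] [Et /= sty]]].
    by exists (s t) => //; split=> //; exists t.
  by split=> //=; rewrite sty.
apply: fin_bigcup_measurable => //.
by apply: sub_finite_set fs; exact: subIsetl.
Qed.

Lemma finite_levels_comp2 Y Z W (s : T -> Y) (r : T -> Z) (h : Y -> Z -> W) :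
  finite_levels s -> finite_levels r -> finite_levels (fun t => h (s t) (r t)).
Proof.
move=> fs fr; split.
  apply: (@sub_finite_set _ _ [set h y z | y in range s & z in range r]).
    by move=> _ [t _ <-]; exists (s t); [by exists t|exists (r t) => //; exists t].
  by apply: finite_image2; [case: fs|case: fr].
move=> w.
have -> : E `&` (fun t => h (s t) (r t)) @^-1` [set w] =
    \bigcup_(z in range r) ((E `&` s @^-1` [set y | h y z = w]) `&` (E `&` r @^-1` [set z])).
  apply/seteqP; split=> [t [Et /= hw]|t [z _ [[Et /= hw] [_ /= rz]]]].
    by exists (r t); [exists t|].
  by split=> //=; rewrite rz.
apply: fin_bigcup_measurable => [|z _]; first by case: fr.
by apply: measurableI; [exact: finite_levels_preimage|case: fr].
Qed.

(** Makes [rnorm (f t - s t)] measurable for simple [s]: only one value of the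
    second argument matters on each level set. *)
Lemma finite_levels_measurable (R : realType) Y (s : T -> Y) (G : T -> Y -> R) :
  finite_levels s -> (forall y, measurable_fun E (fun t => G t y)) ->
  measurable_fun E (fun t => G t (s t)).
Proof.
move=> [fs ms] mG _ B mB.
have -> : E `&` (fun t => G t (s t)) @^-1` B = \bigcup_(y in range s)
    ((E `&` s @^-1` [set y]) `&` (E `&` (fun t => G t y) @^-1` B)).
  apply/seteqP; split=> [t [Et /= BG]|t [y _ [[Et /= sy] [_ /= BG]]]].
    by exists (s t); [exists t|].
  by split=> //=; rewrite sy.
apply: fin_bigcup_measurable => // y _; apply: measurableI => //.
exact: mG.
Qed.

End FiniteLevels.

Section Bochner.
Context d (T : measurableType d) (R : realType) (X : normedModType R[i]).
Variables (mu : {measure set T -> \bar R}) (D : set T).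
Hypothesis mD : measurable D.
Implicit Types (E : set T) (f : T -> X) (l : X -> R).

(** Strong measurability with its exceptional null set cut away. *)
Definition approximable E (s : nat -> T -> X) f := [/\ measurable E, E `<=` D,
  mu (D `\` E) = 0%E, forall n, simple_on mu D (s n) &
  forall t, E t -> s n t @[n --> \oo] --> f t].

Lemma strongly_measurable_approximable f : strongly_measurable mu D f ->
  exists E s, approximable E s f.
Proof.
move=> [s [ss [N [mN N0 sN]]]]; exists (D `\` N), s; split => //.
- exact: measurableD.
- apply: subset_measure0 N0 => //; first by apply: measurableD => //; exact: measurableD.
  by move=> t [Dt /not_andP[//|/contrapT]].
- move=> t [Dt Nt]; apply: contrapT => nst; apply: Nt; apply: sN => /=.
  by move=> /(_ Dt).
Qed.

Lemma simple_on_levels E (s : T -> X) : measurable E -> E `<=` D -> simple_on mu D s ->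
  finite_levels E s.
Proof.
move=> mE ED [fs ms]; split=> // x.
rewrite (_ : E `&` _ = E `&` (D `&` s @^-1` [set x])); last first.
  by rewrite setIA (setIidl ED).
by apply: measurableI => //; exact: (proj1 (ms x)).
Qed.

Lemma lipschitz_cvg (xi : X -> R) (C : R) (u : nat -> X) x :
  (forall x y, `|xi x - xi y| <= C * rnorm (x - y)) ->
  u n @[n --> \oo] --> x -> xi (u n) @[n --> \oo] --> xi x.
Proof.
move=> xiL /cvg_rnormP ux; apply/cvgrPdist_le => e e0.
have C0 : 0 < `|C| + 1 by rewrite ltr_wpDl.
move/cvgrPdist_le : ux => /(_ (e / (`|C| + 1))); rewrite divr_gt0// => /(_ isT).
apply: filterS => n; rewrite sub0r normrN ger0_norm ?rnorm_ge0// ler_pdivlMr//.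
apply: le_trans; apply: le_trans (xiL _ _) _.
rewrite mulrC ler_wpM2l ?rnorm_ge0//.
by rewrite (le_trans (ler_norm _))// lerDl.
Qed.

Lemma approximable_measurable E s f (xi : X -> R) (C : R) : approximable E s f ->
  (forall x y, `|xi x - xi y| <= C * rnorm (x - y)) ->
  measurable_fun E (fun t => xi (f t)).
Proof.
move=> [mE ED _ ss sf] xiL.
apply: (@measurable_fun_cvg _ _ _ _ (fun n t => xi (s n t))).
  move=> n; apply: (finite_levels_measurable (G := fun=> xi) mE (simple_on_levels mE ED (ss n))).
  by move=> y; exact: measurable_cst.
by move=> t Et; apply: lipschitz_cvg xiL _; exact: sf.
Qed.

Lemma rnorm_lipschitz (a x y : X) : `|rnorm (x - a) - rnorm (y - a)| <= 1 * rnorm (x - y) :> R.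
Proof.
have h1 := rnormD (x - y) (y - a); have h2 := rnormD (y - x) (x - a).
rewrite !addrA !subrK -[y - x]opprB rnormN in h1 h2.
by rewrite mul1r ler_norml; apply/andP; split; lra.
Qed.

Lemma real_linear_lipschitz l C : real_linear l -> bounded_by C l ->
  forall x y, `|l x - l y| <= C * rnorm (x - y).
Proof. by move=> ll lC x y; rewrite -real_linearB. Qed.

Lemma approximable_dist_measurable E s f (r : T -> X) : approximable E s f ->
  simple_on mu D r -> measurable_fun E (fun t => rnorm (f t - r t)).
Proof.
move=> sf rr; have [mE ED _ _ _] := sf.
apply: (finite_levels_measurable (G := fun t x => rnorm (f t - x)) mE).
  exact: simple_on_levels.
move=> x; exact: (@approximable_measurable _ _ _ (fun y => rnorm (y - x)) 1 sf
  (rnorm_lipschitz x)).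
Qed.

Lemma approximable_norm_measurable E s f : approximable E s f ->
  measurable_fun E (fun t => rnorm (f t)).
Proof.
move=> sf; under eq_fun do rewrite -[f _]subr0.
exact: (@approximable_measurable _ _ _ (fun y => rnorm (y - 0)) 1 sf
  (rnorm_lipschitz 0)).
Qed.

Lemma simple_integral_linear E (s : T -> X) l C : measurable E -> E `<=` D ->
  mu (D `\` E) = 0%E -> simple_on mu D s -> real_linear l -> bounded_by C l ->
  mu.-integrable E (EFin \o (l \o s)) /\
  l (simple_integral mu D s) = \int[mu]_(t in E) l (s t).
Proof.
move=> mE ED DE0 [fs ms] ll lC.
pose A x := D `&` s @^-1` [set x].
have mA x : measurable (A x) by case: (ms x).
have muAE x : mu (A x `&` E) = mu (A x).
  rewrite -[in RHS](setUIDK (A x) E) measureU//; first last.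
  - by apply/seteqP; split=> // t [[_ Et] [_ nEt]].
  - exact: measurableD.
  - exact: measurableI.
  rewrite [X in (_ + X)%E](_ : _ = 0%E) ?adde0//.
  apply: subset_measure0 DE0; [exact: measurableD|exact: measurableD|].
  by apply: setSD; exact: subIsetl.
pose r := finmap.enum_fset (fset_set (range s)).
have ur : uniq r by exact: finmap.fset_uniq.
have rP x : (x \in r) = (x \in range s) by exact: in_fset_set.
have lsE t : E t -> l (s t) = \sum_(x <- r) l x * \1_(A x) t.
  move=> Et; rewrite (bigD1_seq (s t))//=; last first.
    by rewrite rP inE; exists t.
  rewrite indicE mem_set ?mulr1; last by split=> //; exact: ED.
  rewrite big1 ?addr0// => x xst; rewrite indicE memNset ?mulr0//.
  by move=> [_ /= stx]; rewrite stx eqxx in xst.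
have iA x : mu.-integrable E (EFin \o (fun t => l x * \1_(A x) t)).
  (* The level set of 0 may have infinite measure; [l 0 = 0] disposes of it. *)
  have [->|x0] := eqVneq x 0.
    rewrite (_ : _ \o _ = cst 0%E); first exact: integrable0.
    by apply/funext => t /=; rewrite real_linear0// mul0r.
  rewrite (_ : _ \o _ = (fun t => (l x)%:E * (\1_(A x) t)%:E)%E)//.
  apply: integrableZl => //; apply/integrableP; split.
    by apply/measurable_EFinP; exact: measurable_indic.
  rewrite (eq_integral (fun t => (\1_(A x) t)%:E)).
    by rewrite integral_indic// muAE; apply: (proj2 (ms x)).
  by move=> t _; rewrite gee0_abs// lee_fin.
have intA x : (\int[mu]_(t in E) (l x * \1_(A x) t)%:E)%E = (l x * fine (mu (A x)))%:E.
  have [->|x0] := eqVneq x 0.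
    under eq_integral do rewrite real_linear0// mul0r.
    by rewrite integral0 real_linear0// mul0r.
  have fA : (mu (A x) \is a fin_num).
    by rewrite ge0_fin_numE//; apply: (proj2 (ms x)).
  under eq_integral do rewrite EFinM.
  rewrite integralZl//; first by rewrite integral_indic// muAE EFinM fineK.
  apply/integrableP; split.
    by apply/measurable_EFinP; exact: measurable_indic.
  rewrite (eq_integral (fun t => (\1_(A x) t)%:E)).
    by rewrite integral_indic// muAE; apply: (proj2 (ms x)).
  by move=> t _; rewrite gee0_abs// lee_fin.
split.
  have := @integrable_sum _ _ _ mu E mE X r xpredT
    (fun x t => (l x * \1_(A x) t)%:E) (fun x _ => iA x).
  apply: eq_integrable => // t; rewrite inE => Et.
  by rewrite /= lsE// sumEFin.
rewrite /Rintegral (eq_integral (fun t =>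
    \sum_(x <- r) (l x * \1_(A x) t)%:E)%E); last first.
  by move=> t; rewrite inE => Et; rewrite lsE// sumEFin.
rewrite integral_sum//.
under eq_bigr do rewrite intA.
rewrite sumEFin/= /simple_integral -(@fsbig_widen _ _ _ _ (range s))//; last first.
  move=> x [_ /= nx]; rewrite (_ : D `&` _ = set0) ?measure0 ?scale0r//.
  by apply/seteqP; split=> // t [_ /= stx]; apply: nx; exists t.
rewrite fsbig_finite//= real_linear_sum//; apply: eq_bigr => x _.
by rewrite (proj2 ll) mulrC.
Qed.

(** The estimate is uniform in [l], so that scalar integrals control the
    convergence of vector-valued ones. *)
Lemma simple_integral_near E u f (s : T -> X) l C : approximable E u f ->
  mu.-integrable E (EFin \o (fun t => rnorm (f t))) -> 0 <= C ->
  simple_on mu D s -> real_linear l -> bounded_by C l ->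
  (`|l (simple_integral mu D s) - \int[mu]_(t in E) l (f t)|%:E <=
   C%:E * \int[mu]_(t in E) (rnorm (f t - s t))%:E)%E.
Proof.
move=> uf inf C0 ss ll lC; have [mE ED DE0 _ _] := uf.
have [ils ->] := simple_integral_linear mE ED DE0 ss ll lC.
have mlf : measurable_fun E (fun t => l (f t)).
  exact: (approximable_measurable uf (real_linear_lipschitz ll lC)).
have ilf : mu.-integrable E (EFin \o (l \o f)).
  apply: (@le_integrable _ _ _ mu E mE _ (EFin \o (fun t => C * rnorm (f t)))).
  - exact/measurable_EFinP.
  - by move=> t Et; rewrite /= lee_fin (ger0_norm (mulr_ge0 C0 (rnorm_ge0 _))) lC.
  - by rewrite (_ : _ \o _ = (fun t => C%:E * (rnorm (f t))%:E)%E)//; apply: integrableZl.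
rewrite -RintegralB//.
have idf : mu.-integrable E (EFin \o (fun t => l (s t) - l (f t))).
  rewrite (_ : _ \o _ = (fun t => (l (s t))%:E - (l (f t))%:E)%E)//.
  exact: integrableB.
apply: (@le_trans _ _ (\int[mu]_(t in E) (`|l (s t) - l (f t)|)%:E)%E).
  rewrite EFin_normr_Rintegral//; apply: le_trans (le_abse_integral _ _ _) _ => //.
  by case/integrableP : idf.
have mdist : measurable_fun E (fun t => (rnorm (f t - s t))%:E).
  by apply/measurable_EFinP; exact: approximable_dist_measurable uf ss.
rewrite -ge0_integralZl//; last by move=> t _; rewrite lee_fin rnorm_ge0.
apply: le_lower_integral => t Et; rewrite ?lee_fin//.
by rewrite -real_linearB// -rnormN opprB lC.
Qed.

Lemma is_bochner_linear E u f x l C : approximable E u f ->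
  mu.-integrable E (EFin \o (fun t => rnorm (f t))) -> 0 <= C ->
  is_bochner mu D f x -> real_linear l -> bounded_by C l ->
  l x = \int[mu]_(t in E) l (f t).
Proof.
move=> uf inf C0 [s [[ss _] sf sx]] ll lC; have [mE ED DE0 _ _] := uf.
have lx : l (simple_integral mu D (s n)) @[n --> \oo] --> l x.
  by apply: lipschitz_cvg sx; exact: real_linear_lipschitz.
suff lI : l (simple_integral mu D (s n)) @[n --> \oo] --> \int[mu]_(t in E) l (f t).
  by apply: (cvg_unique _ lx lI); exact: norm_hausdorff.
have rn0 n t : D t -> (0 <= (rnorm (f t - s n t))%:E)%E.
  by move=> _; rewrite lee_fin rnorm_ge0.
move: sf; under eq_fun do rewrite (lower_integral_null mD mE ED DE0 (@rn0 _)).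
move=> /fine_cvgP[fin /cvgrPdist_lt cvg0]; apply/cvgrPdist_le => e e0.
have Ce : 0 < e / (C + 1) by rewrite divr_gt0// ltr_wpDl.
near=> n; rewrite distrC -lee_fin.
apply: le_trans (simple_integral_near uf inf C0 (ss n) ll lC) _.
have finn : (\int[mu]_(t in E) (rnorm (f t - s n t))%:E)%E \is a fin_num by near: n.
rewrite -(fineK finn) -EFinM lee_fin.
have : `|0 - fine (\int[mu]_(t in E) (rnorm (f t - s n t))%:E)%E| < e / (C + 1).
  by near: n; exact: cvg0.
rewrite sub0r normrN ger0_norm; last first.
  by apply: fine_ge0; apply: integral_ge0 => t _; rewrite lee_fin rnorm_ge0.
rewrite ltr_pdivlMr ?ltr_wpDl// => /ltW; apply: le_trans.
rewrite mulrDr mulr1 mulrC lerDl.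
by apply: fine_ge0; apply: integral_ge0 => t _; rewrite lee_fin rnorm_ge0.
Unshelve. all: by end_near. Qed.

End Bochner.

Section BochnerExistence.
Context d (T : measurableType d) (R : realType) (X : completeNormedModType R[i]).
Variables (mu : {measure set T -> \bar R}) (D : set T).
Hypothesis mD : measurable D.
Implicit Types (E : set T) (f : T -> X) (l : X -> R).

(** The support condition keeps the level sets measurable, as [rnorm (f t)] is
    measurable only on [E]. *)
Definition truncate E (s f : T -> X) (t : T) : X :=
  if (t \in E) && (rnorm (s t) <= 2 * rnorm (f t)) then s t else 0.

Lemma truncate_simple E u f n : approximable mu D E u f ->
  simple_on mu D (truncate E (u n) f).
Proof.
move=> uf; have [mE ED DE0 su cu] := uf.
have [fu mu_] := su n; set s := truncate E (u n) f.
have lev x : x != 0 -> D `&` s @^-1` [set x] =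
    (E `&` u n @^-1` [set x]) `&` (E `&` (fun t => rnorm (f t)) @^-1` `[rnorm x / 2, +oo[).
  move=> x0; apply/seteqP; split=> [t [Dt]|t [[Et /= utx] [_ /=]]].
    rewrite /s /truncate/=; case: ifPn => [/andP[/set_mem Et le2] utx|_ /esym/eqP].
      split; split=> //=; rewrite in_itv/= andbT ler_pdivrMr// mulrC -utx//.
    by rewrite (negbTE x0).
  rewrite in_itv/= andbT ler_pdivrMr// mulrC => le2; split; first exact: ED.
  by rewrite /s /truncate/= mem_set//= utx le2.
have frs : finite_set (range s).
  apply: (@sub_finite_set _ _ (range (u n) `|` [set 0])).
    move=> _ [t _ <-]; rewrite /s /truncate; case: ifP => _; last by right.
    by left; exists t.
  by rewrite finite_setU; split=> //; exact: finite_set1.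
have mn0 x : x != 0 -> measurable (D `&` s @^-1` [set x]).
  move=> x0; rewrite lev//; apply: measurableI.
    by apply: (proj2 (simple_on_levels mE ED (su n))).
  by apply: (approximable_norm_measurable uf).
split=> // x; split; last first.
  move=> x0; apply: le_lt_trans (proj2 (mu_ x) x0).
  apply: le_measure; rewrite ?inE//; [exact: mn0|exact: (proj1 (mu_ x))|].
  by rewrite lev// => t [[Et ?] _]; split=> //; exact: ED.
have [->|x0] := eqVneq x 0; last exact: mn0.
rewrite (_ : D `&` _ = D `\` \bigcup_(y in range s `&` [set y | y != 0])
    (D `&` s @^-1` [set y])).
  apply: measurableD => //; apply: fin_bigcup_measurable.
    by apply: sub_finite_set frs; exact: subIsetl.
  by move=> y [_ /= y0]; exact: mn0.
apply/seteqP; split=> [t [Dt /= st0]|t [Dt nt]].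
  by split=> // -[y [_ /= y0] [_ /= sty]]; rewrite -sty st0 eqxx in y0.
split=> //=; apply: contrapT => st0; apply: nt; exists (s t) => //.
by split; [exists t|apply/eqP].
Qed.

Lemma truncate_cvg E u f t : approximable mu D E u f -> E t ->
  truncate E (u n) f t @[n --> \oo] --> f t.
Proof.
move=> [_ _ _ _ cu] Et; have ut := cu _ Et.
have [f0|f0] := eqVneq (f t) 0.
  rewrite (_ : (fun n => _) = fun=> f t); first exact: cvg_cst.
  apply/funext => n; rewrite /truncate f0 rnorm0 mulr0.
  by case: ifP => // /andP[_ un]; apply/eqP; rewrite -rnorm_eq0 eq_le un rnorm_ge0.
have fp : 0 < rnorm (f t) by rewrite lt_neqAle rnorm_ge0 eq_sym rnorm_eq0 f0.
apply: cvg_trans ut; apply: near_eq_cvg.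
have /cvg_rnormP/cvgrPdist_lt/(_ _ fp) := cu _ Et.
apply: filterS => n; rewrite sub0r normrN ger0_norm ?rnorm_ge0// => h.
rewrite /truncate mem_set//= ifT//.
by have := rnormB (f t) (f t - u n t); rewrite opprB addrC subrK; lra.
Qed.

Lemma truncate_dist E (s f : T -> X) t :
  rnorm (f t - truncate E s f t) <= 3 * rnorm (f t).
Proof.
have f0 := rnorm_ge0 (f t).
rewrite /truncate; case: ifP => [/andP[_ h]|_]; last by rewrite subr0; lra.
by have := rnormB (f t) (s t); lra.
Qed.

(** Cutting the approximating simple functions off where they exceed twice the
    norm of the limit makes dominated convergence applicable; the integrals of
    the simple functions then form a Cauchy sequence because every norming
    functional sees them converge at the same rate. *)
Lemma bochner_exists E u f : approximable mu D E u f ->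
  mu.-integrable E (EFin \o (fun t => rnorm (f t))) ->
  exists x, is_bochner mu D f x.
Proof.
move=> uf inf; have [mE ED DE0 su cu] := uf.
pose s n := truncate E (u n) f.
have ss n : simple_on mu D (s n) by exact: truncate_simple uf.
pose e n := (\int[mu]_(t in E) (rnorm (f t - s n t))%:E)%E.
have md n : measurable_fun E (fun t => (rnorm (f t - s n t))%:E).
  by apply/measurable_EFinP; exact: approximable_dist_measurable uf (ss n).
have e_ge0 n : (0 <= e n)%E.
  by apply: integral_ge0 => t _; rewrite lee_fin rnorm_ge0.
have e0 : e n @[n --> \oo] --> 0%E.
  suff : e n @[n --> \oo] --> (\int[mu]_(t in E) cst 0%E t)%E by rewrite integral0.
  apply: (@dominated_cvg _ _ _ mu E mE (fun n t => (rnorm (f t - s n t))%:E)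
    (cst 0%E) (fun t => 3%:E * (rnorm (f t))%:E)%E) => //.
  - move=> t Et; apply: cvg_EFin; first exact: nearW.
    by have /cvg_rnormP := truncate_cvg uf Et.
  - exact: integrableZl.
  - move=> n t Et; rewrite /= -EFinM lee_fin ger0_norm ?rnorm_ge0//.
    exact: truncate_dist.
have /fine_cvgP[fe /cvgrPdist_lt ce] := e0.
have SI : cvgn (fun n => simple_integral mu D (s n)).
  apply/cauchy_cvgP/cauchy_exP => r r0.
  have rE : r = (complex.Re r)%:C by rewrite RRe_real// gtr0_real.
  have {}r0 : 0 < complex.Re r by rewrite -ltcR -rE.
  have r20 : 0 < complex.Re r / 2 by rewrite divr_gt0.
  have : \forall n \near \oo, (e n < (complex.Re r / 2)%:E)%E.
    near=> n; have fn : e n \is a fin_num by near: n.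
    rewrite -(fineK fn) lte_fin -[ltLHS]ger0_norm ?fine_ge0// -normrN -sub0r.
    by near: n; exact: ce.
  move=> [N _ eN].
  have near_I n : (N <= n)%N -> forall l, real_linear l -> bounded_by 1 l ->
      `|l (simple_integral mu D (s n)) - \int[mu]_(t in E) l (f t)| < complex.Re r / 2.
    move=> Nn l ll lC; rewrite -lte_fin.
    apply: le_lt_trans (simple_integral_near mD uf inf ler01 (ss n) ll lC) _.
    by rewrite mul1e; exact: eN.
  exists (simple_integral mu D (s N)), N => // n Nn /=.
  rewrite -ball_normE /ball_/= -rnormE rE ltcR.
  have [l [ll lC <-]] := hahn_banach_norming
    (simple_integral mu D (s N) - simple_integral mu D (s n)).
  rewrite real_linearB//.
  have := near_I _ Nn _ ll lC; have := near_I _ (leqnn N) _ ll lC.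
  by rewrite !ltr_norml => /andP[? ?] /andP[? ?]; lra.
exists (limn (fun n => simple_integral mu D (s n))), s; split => //.
- split=> //; exists (D `\` E); split => //; first exact: measurableD.
  move=> t nt; apply: contrapT => /not_andP h; apply: nt => Dt.
  by case: h => // /contrapT Et; exact: truncate_cvg uf Et.
- rewrite (_ : (fun n => _) = e)//; apply/funext => n; apply: lower_integral_null => //.
  by move=> t _; rewrite lee_fin rnorm_ge0.
Unshelve. all: by end_near. Qed.

Lemma bochner_linear E u f l C : approximable mu D E u f ->
  mu.-integrable E (EFin \o (fun t => rnorm (f t))) -> 0 <= C ->
  real_linear l -> bounded_by C l ->
  l (bochner mu D f) = \int[mu]_(t in E) l (f t).
Proof.
move=> uf inf C0 ll lC; have [x fx] := bochner_exists uf inf.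
rewrite /bochner; case: xgetP => [y _ fy|/(_ x)//].
exact: is_bochner_linear uf inf C0 fy ll lC.
Qed.

End BochnerExistence.

(** * Step functions on a grid *)

Section Grid.
Context (R : realType).
Notation mu := (@lebesgue_measure R).

Notation borelR := (g_sigma_algebraType R.-ocitv.-measurable).
Notation levels := (@finite_levels _ borelR Rplus).

Lemma measurable_Rplus : @measurable _ borelR Rplus.
Proof. exact: measurable_itv. Qed.

(** Sampling through an index shows that only finitely many values occur, on
    intervals, whatever the type of the values; [None] stands for large times. *)
Definition grid_index (n : nat) (t : R) : option nat :=
  if t \in `[0, n.+1%:R[ then Some (Num.truncn (t * n.+1%:R)) else None.

Definition grid_point (n : nat) (t : R) : R := (Num.truncn (t * n.+1%:R))%:R / n.+1%:R.

Definition grid_fun (V : nmodType) (h : R -> V) (n : nat) (t : R) : V :=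
  if grid_index n t is Some k then h (k%:R / n.+1%:R) else 0.

Lemma grid_funE (V : nmodType) (h : R -> V) n t :
  grid_fun h n t = if t \in `[0, n.+1%:R[ then h (grid_point n t) else 0.
Proof. by rewrite /grid_fun /grid_index; case: ifP. Qed.

Lemma grid_index_levels n : levels (grid_index n).
Proof.
have n0 : (0 : R) < n.+1%:R by rewrite ltr0n.
split.
  apply: (@sub_finite_set _ _ ([set None] `|` [set Some k | k in `I_(n.+1 * n.+1)])).
    move=> _ [t _ <-]; rewrite /grid_index; case: ifP => [|_]; last by left.
    rewrite in_itv/= => /andP[t0 tn]; right; exists (Num.truncn (t * n.+1%:R)) => //=.
    have /truncn_itv/andP[h1 _] : 0 <= t * n.+1%:R by rewrite mulr_ge0.
    rewrite -(ltr_nat R) (le_lt_trans h1)//.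
    by rewrite natrM ltr_pM2r.
  rewrite finite_setU; split; first exact: finite_set1.
  by apply: finite_image; exact: finite_II.
move=> [k|].
  rewrite (_ : _ `&` _ = `[(0 : R), n.+1%:R[ `&` `[k%:R / n.+1%:R, k.+1%:R / n.+1%:R[).
    exact: measurableI.
  apply/seteqP; split=> t /=; rewrite /grid_index RplusE.
    move=> [t0 +]; case: ifP => // tn [tk]; split=> //.
    rewrite in_itv/= ler_pdivrMr// ltr_pdivlMr// -tk.
    by apply: truncn_itv; rewrite mulr_ge0.
  move=> [tn]; rewrite tn; move: tn; rewrite !in_itv/= => /andP[t0 _].
  rewrite ler_pdivrMr// ltr_pdivlMr// => tk; split=> //; congr Some.
  exact: truncn_def.
rewrite (_ : _ `&` _ = [set` `[(n.+1%:R : R), +oo[]); first exact: measurable_itv.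
apply/seteqP; split=> t /=; rewrite /grid_index RplusE !in_itv/= andbT.
  by move=> [t0]; case: ifPn => //; rewrite t0/= -leNgt.
move=> nt; have t0 : 0 <= t by exact: le_trans nt.
by split=> //; rewrite t0/= ltNge nt.
Qed.

Lemma grid_point_ge0 n (t : R) : 0 <= grid_point n t.
Proof. by rewrite /grid_point divr_ge0. Qed.

Lemma grid_point_cvg (t : R) : 0 <= t -> grid_point n t @[n --> \oo] --> t.
Proof.
move=> t0; apply: (@squeeze_cvgr _ _ _ _ (fun n => t - n.+1%:R^-1) (fun=> t)).
- apply: nearW => n; rewrite /grid_point.
  have n0 : (0 : R) < n.+1%:R by rewrite ltr0n.
  have /truncn_itv/andP[h1 h2] : 0 <= t * n.+1%:R by rewrite mulr_ge0.
  rewrite ler_pdivlMr// ler_pdivrMr// h1 andbT mulrBl mulVf ?gt_eqF//.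
  by move: h2; rewrite -natr1; lra.
- rewrite -[X in _ --> X]subr0; apply: cvgB; first exact: cvg_cst.
  exact: cvg_harmonic.
- exact: cvg_cst.
Qed.

(** Grid points are nonnegative, so nothing is asked at negative times. *)
Definition seq_continuous (V : topologicalType) (h : R -> V) :=
  forall (u : nat -> R) t, (forall n, 0 <= u n) -> u n @[n --> \oo] --> t ->
    h (u n) @[n --> \oo] --> h t.

Lemma grid_fun_cvg (K : numDomainType) (V : normedModType K) (h : R -> V) t :
  seq_continuous h -> 0 <= t -> grid_fun h n t @[n --> \oo] --> h t.
Proof.
move=> hc t0.
have := hc _ t (fun n => grid_point_ge0 n t) (grid_point_cvg t0).
apply: cvg_trans; apply: near_eq_cvg; near=> n.
rewrite grid_funE ifT// in_itv/= t0/=.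
apply: (@lt_le_trans _ _ (n%:R)); last by rewrite ler_nat.
by near: n; exact: nbhs_infty_gtr.
Unshelve. all: by end_near. Qed.

Lemma grid_fun_levels (V : nmodType) (h : R -> V) n :
  levels (grid_fun h n).
Proof.
have fl := grid_index_levels n.
exact: (finite_levels_comp2
  (fun o _ => if o is Some k then h (k%:R / n.+1%:R) else 0) fl fl).
Qed.

Section Vector.
Context (X : normedModType R[i]).
Implicit Types (f : R -> X).

Lemma finite_levels_simple n (s : R -> X) : levels s ->
  (forall t, t \notin `[0, n.+1%:R[ -> s t = 0) -> simple_on mu Rplus s.
Proof.
move=> [fs ms] s0; split=> // x; split; [exact: ms|move=> x0].
apply: (@le_lt_trans _ _ (mu `[0, n.+1%:R[)).
  apply: le_measure; [by apply/mem_set; exact: (ms x)|by apply/mem_set; exact: measurable_itv|].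
  move=> t [_ stx]; apply: contrapT => /negP tn.
  by move: x0; rewrite -[x]stx s0// eqxx.
by rewrite /= lebesgue_measure_itv/= lte_fin ltr0n/= -EFinB ltry.
Qed.

Lemma strongly_measurable_seq_continuous f : seq_continuous f ->
  strongly_measurable mu Rplus f.
Proof.
move=> fc; exists (grid_fun f); split.
  move=> n; apply: (@finite_levels_simple n); first exact: grid_fun_levels.
  by move=> t tn; rewrite grid_funE (negbTE tn).
by apply: aeW => t; rewrite RplusE; exact: grid_fun_cvg.
Qed.

Lemma approximable_scale E u f (m : R -> R[i]) : approximable mu Rplus E u f ->
  seq_continuous (m : R -> R[i]^o) ->
  approximable mu Rplus E (fun n t => grid_fun m n t *: u n t) (fun t => m t *: f t).
Proof.
move=> [mE ED DE0 su cu] mc; split=> //.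
  move=> n; apply: (@finite_levels_simple n).
    have fu := simple_on_levels measurable_Rplus (fun _ h => h) (su n).
    exact: (finite_levels_comp2 (fun c (x : X) => c *: x) (grid_fun_levels m n) fu).
  by move=> t tn; rewrite grid_funE (negbTE tn) scale0r.
move=> t Et; apply: (@cvgZ _ _ _ _ _ (fun n => grid_fun m n t : R[i]^o)); last exact: cu.
by apply: (@grid_fun_cvg R[i] R[i]^o) => //; rewrite -RplusE; exact: ED.
Qed.

Lemma approximable_restrict D E u f : measurable D -> D `<=` Rplus ->
  approximable mu Rplus E u f -> approximable mu D (E `&` D) u f.
Proof.
move=> mD DR [mE ED DE0 su cu]; split.
- exact: measurableI.
- exact: subIsetr.
- apply: subset_measure0 DE0 => //.
  + by apply: measurableD => //; exact: measurableI.
  + by apply: measurableD => //; exact: measurable_Rplus.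
  + by move=> t [Dt nt]; split; [exact: DR|move=> Et; apply: nt].
- move=> n; have [fs ms] := su n; split=> // x.
  have -> : D `&` u n @^-1` [set x] = D `&` (Rplus `&` u n @^-1` [set x]).
    by rewrite setIA (setIidl DR).
  have mx := proj1 (ms x).
  split; first exact: measurableI.
  move=> /(proj2 (ms x)); apply: le_lt_trans; apply: le_measure.
  + by apply/mem_set; exact: measurableI.
  + exact/mem_set.
  + exact: subIsetr.
- by move=> t [Et _]; exact: cu.
Qed.

End Vector.

Lemma normc_cexp (a b : R) : normc (cexp (a +i* b)) = expR a.
Proof.
by rewrite /= !exprMn -mulrDr cos2Dsin2 mulr1 sqrtr_sqr ger0_norm ?expR_ge0.
Qed.

Lemma cexp_laplace (a y t : R) :
  cexp (- ((a +i* y) * t%:C)) = (expR (- (a * t)) * cos (y * t)) +i* (- (expR (- (a * t)) * sin (y * t))).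
Proof.
by rewrite /= !mulr0 subr0 add0r cosN sinN mulrN.
Qed.

End Grid.

(** * A Schur test for kernels of variable width *)

Section CauchyKernel.
Context {R : realType}.
Notation mu := (@lebesgue_measure R).
Implicit Types (r s t u x : R).

(** The Poisson kernel of the half plane, of width [r^-1] and total mass [pi]. *)
Definition ck r u : R := r / (1 + (r * u) ^+ 2).

Let den_gt0 r u : 0 < 1 + (r * u) ^+ 2.
Proof. by rewrite ltr_pwDl// sqr_ge0. Qed.

Lemma ck_ge0 r u : 0 <= r -> 0 <= ck r u.
Proof. by move=> r0; rewrite divr_ge0// ltW. Qed.

Lemma ckN r u : ck r (- u) = ck r u.
Proof. by rewrite /ck mulrN sqrrN. Qed.

Lemma continuous_ck r s : continuous (fun x => ck r (x - s)).
Proof.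
move=> x; rewrite /ck; eapply is_derive_cont; deriv.
by rewrite gt_eqF.
Qed.

Lemma ck_int r s : 0 < r -> (\int[mu]_(x in Rplus) (ck r (x - s))%:E <= pi%:E)%E.
Proof.
move=> r0.
have dF x : is_derive x 1 (fun x => atan (r * (x - s))) (ck r (x - s)).
  have d2 : is_derive x 1 (fun x => r * (x - s)) r.
    by eapply dcong; [by deriv|rewrite /=; ring].
  have h := @dcomp R atan (fun x => r * (x - s)) x _ _ (is_derive1_atan _) d2.
  by eapply dcong; [exact: h|]; rewrite /ck mulrC.
have cF : continuous (fun x => atan (r * (x - s))).
  by move=> x; exact: is_derive_cont (dF x).
rewrite /Rplus (@ge0_continuous_FTC2y _ _ (fun x => atan (r * (x - s))) 0 (pi / 2)).
- have := atan_gtNpi2 (r * (0 - s)); rewrite -EFinB lee_fin; lra.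
- by move=> x _; apply: ck_ge0; exact: ltW.
- by apply: continuous_subspaceT => x; exact: continuous_ck.
- have h : r * (x - s) @[x --> +oo] --> +oo by apply: gt0_cvgMry => //; exact: cvg_addrr.
  exact: (cvg_comp _ _ h (@cvgy_atan R)).
- by move=> x _; exact: ex_derive.
- exact: cvg_at_right_filter (cF 0).
- by move=> x _; rewrite derive1E derive_val.
Qed.

Lemma measurable_ck (D : set R) : measurable_fun D (ck 1).
Proof.
apply: measurable_funTS; apply: continuous_measurable_fun => x.
by have := @continuous_ck 1 0 x; rewrite (_ : (fun x => _) = ck 1)//;
  apply/funext => y; rewrite subr0.
Qed.

End CauchyKernel.

Section Schur.
Context {R : realType}.
Notation mu := (@lebesgue_measure R).
Notation borelR := (g_sigma_algebraType R.-ocitv.-measurable).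
Implicit Types (s t u x : R).
Variables (w : R -> R) (L : R).
Hypothesis w1 : forall t, 1 <= w t.
Hypothesis w_nd : {homo w : s t / s <= t}.
Hypothesis L1 : 1 <= L.
Hypothesis wL : forall s t, 0 <= s -> 0 <= t -> `|t - s| <= 1 -> w t <= L * w s.

Let w0 t : 0 < w t.
Proof. exact: lt_le_trans (w1 t). Qed.

(** Near the diagonal the width may be frozen, because [w] varies slowly; away
    from it the width may be replaced by 1 at the cost of a factor 2. *)
Lemma ck_swap s t : 0 <= s -> 0 <= t ->
  ck (w t) (t - s) <= L ^+ 3 * ck (w s) (t - s) + 2 * ck 1 (t - s).
Proof.
move=> s0 t0; set u := t - s.
have k1 : 0 <= ck 1 u by exact: ck_ge0.
have ks : 0 <= ck (w s) u by apply: ck_ge0; exact: ltW.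
have L0 := L1; have L3 : 0 < L ^+ 3 by rewrite exprn_gt0//; lra.
have den r : 0 < 1 + (r * u) ^+ 2 by rewrite ltr_pwDl// sqr_ge0.
have [u1|u1] := leP `|u| 1.
  have h1 : w t <= L * w s by exact: wL.
  have h2 : w s <= L * w t by apply: wL => //; rewrite distrC.
  apply: (@le_trans _ _ (L ^+ 3 * ck (w s) u)); last by rewrite lerDl mulr_ge0.
  rewrite /ck ler_pdivrMr// mulrA mulrAC ler_pdivlMr//.
  have wt := w0 t; have ws := w0 s.
  have h3 : 1 + (w s * u) ^+ 2 <= L ^+ 2 * (1 + (w t * u) ^+ 2).
    rewrite (mulrDr (L ^+ 2)) mulr1 !exprMn mulrA -exprMn.
    have : (1 : R) <= L ^+ 2 by rewrite exprn_ege1.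
    have : w s ^+ 2 * u ^+ 2 <= (L * w t) ^+ 2 * u ^+ 2.
      rewrite ler_wpM2r ?sqr_ge0// ler_sqr// ?nnegrE ?mulr_ge0 ?ltW//.
      exact: lt_le_trans L1.
    lra.
  apply: (le_trans (ler_pM (ltW wt) (ltW (den _)) h1 h3)).
  by rewrite le_eqVlt; apply/orP; left; apply/eqP; ring.
apply: (@le_trans _ _ (2 * ck 1 u)); last by rewrite lerDr mulr_ge0// ltW.
have u2 : 1 <= u ^+ 2 by rewrite -real_normK ?num_real// exprn_ege1// ltW.
have d1 : 0 < 1 + u ^+ 2 by lra.
have -> : 2 * ck 1 u = 2 / (1 + u ^+ 2) by rewrite /ck !mul1r.
rewrite /ck ler_pdivrMr// mulrAC ler_pdivlMr//.
have wt := w1 t; rewrite exprMn.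
have : w t <= w t ^+ 2 by rewrite expr2 ler_peMl// ltW.
have : 0 <= (w t ^+ 2 - w t) * u ^+ 2.
  by rewrite mulr_ge0 ?sqr_ge0// subr_ge0 expr2 ler_peMl// ltW.
have : 0 <= w t * (u ^+ 2 - 1) by rewrite mulr_ge0//; [exact: ltW|lra].
lra.
Qed.

Lemma measurable_ck_pair : measurable_fun setT (fun z : R * R => ck (w z.1) (z.1 - z.2)).
Proof.
have mw : measurable_fun setT (w \o (@fst R R)).
  apply: measurableT_comp; last exact: measurable_fst.
  exact: nondecreasing_measurable.
have mu' : measurable_fun setT (fun z : R * R => z.1 - z.2).
  by apply: measurable_funB; [exact: measurable_fst|exact: measurable_snd].
rewrite (_ : (fun z => _) = (fun z : R * R => w z.1 * ck 1 (w z.1 * (z.1 - z.2)))).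
  have mg : measurable_fun setT (fun z : R * R => w z.1 * (z.1 - z.2)).
    exact: measurable_funM.
  by apply: measurable_funM => //; exact: (measurableT_comp (@measurable_ck R setT) mg).
by apply/funext => z; rewrite /ck !mul1r.
Qed.

Lemma measurable_ckr (D : set R) t : measurable_fun D (fun s => ck (w t) (t - s)).
Proof.
apply: measurable_funTS; apply: continuous_measurable_fun => s.
rewrite (_ : (fun s => _) = (fun s => ck (w t) (s - t))); first exact: continuous_ck.
by apply/funext => s'; rewrite -ckN opprB.
Qed.

Lemma ck_int_s t : (\int[mu]_(s in Rplus) (ck (w t) (t - s))%:E <= pi%:E)%E.
Proof.
under eq_integral do rewrite -ckN opprB.
exact: ck_int.
Qed.

Lemma measurable_ckl (D : set R) s : measurable_fun D (fun t => ck (w t) (t - s)).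
Proof.
apply: measurable_funTS.
exact: (measurableT_comp measurable_ck_pair (measurable_pair2 s)).
Qed.

Lemma ck_int_t s : 0 <= s ->
  (\int[mu]_(t in Rplus) (ck (w t) (t - s))%:E <= ((L ^+ 3 + 2) * pi)%:E)%E.
Proof.
move=> s0; have L30 : 0 <= L ^+ 3 by rewrite exprn_ge0// (le_trans _ L1).
have mR := @measurable_Rplus R.
apply: (@le_trans _ _ (\int[mu]_(t in Rplus)
    ((L ^+ 3)%:E * (ck (w s) (t - s))%:E + 2%:E * (ck 1 (t - s))%:E))%E).
  apply: le_lower_integral => t; rewrite RplusE => t0.
    by rewrite lee_fin ck_ge0// ltW.
  by rewrite -!EFinM -EFinD lee_fin ck_swap.
have mc r : @measurable_fun _ _ borelR _ Rplus (fun t => (ck r (t - s))%:E).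
  by apply/measurable_EFinP; apply: measurable_funTS; apply: continuous_measurable_fun; exact: continuous_ck.
have c0 r : 0 <= r -> forall t, (0 <= (ck r (t - s))%:E)%E.
  by move=> r0 t; rewrite lee_fin ck_ge0.
rewrite ge0_integralD//; first last.
- by apply: measurable_funeM; exact: mc.
- by move=> t _; rewrite mule_ge0// ?lee_fin ?ck_ge0.
- by apply: measurable_funeM; exact: mc.
- by move=> t _; rewrite mule_ge0// ?lee_fin ?ck_ge0// ltW.
rewrite !ge0_integralZl//; try (by move=> t _; apply: c0; rewrite ?ltW).
have -> : ((L ^+ 3 + 2) * pi)%:E = ((L ^+ 3)%:E * pi%:E + 2%:E * pi%:E)%E.
  by rewrite -!EFinM -EFinD mulrDl.
by apply: leeD; apply: lee_wpmul2l; rewrite ?lee_fin//; exact: ck_int.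
Qed.

Lemma measurable_schur (psi : R -> R) : (forall s, 0 <= psi s) ->
  measurable_fun setT psi -> @measurable_fun _ _ borelR _ Rplus
    (fun t => \int[mu]_(s in Rplus) (psi s * ck (w t) (t - s))%:E)%E.
Proof.
move=> psi0 mpsi; have mR := @measurable_Rplus R; apply: measurable_funTS.
pose G (z : borelR * borelR) : \bar R :=
  (\1_Rplus z.2 * (psi z.2 * ck (w z.1) (z.1 - z.2)))%:E.
have G0 z : (0 <= G z)%E.
  rewrite lee_fin; apply: mulr_ge0; first by rewrite indicE ler0n.
  by apply: mulr_ge0 => //; apply: ck_ge0; exact: ltW.
have mG : measurable_fun setT G.
  apply/measurable_EFinP; apply: measurable_funM; last apply: measurable_funM.
  - exact: (measurableT_comp (@measurable_indic _ borelR R setT Rplus mR) measurable_snd).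
  - exact: (measurableT_comp mpsi measurable_snd).
  - exact: measurable_ck_pair.
rewrite (_ : (fun t => _) = fubini_F mu G).
  exact: measurable_fun_fubini_tonelli_F.
apply/funext => t; rewrite /fubini_F [LHS]integral_mkcond; apply: eq_integral => s _.
by rewrite /patch /G /= indicE; case: ifPn => _; rewrite ?mul1r// mul0r.
Qed.

(** Tonelli's theorem turns the bound on the integral over [t] into a bound of
    the integral operator on [L^1]. *)
Lemma schur_L1 (psi : R -> R) : (forall s, 0 <= psi s) -> measurable_fun setT psi ->
  (\int[mu]_(t in Rplus) \int[mu]_(s in Rplus) (psi s * ck (w t) (t - s))%:E
   <= ((L ^+ 3 + 2) * pi)%:E * \int[mu]_(s in Rplus) (psi s)%:E)%E.
Proof.
move=> psi0 mpsi; have mR := @measurable_Rplus R.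
pose G (z : borelR * borelR) : \bar R :=
  (\1_Rplus z.1 * \1_Rplus z.2 * (psi z.2 * ck (w z.1) (z.1 - z.2)))%:E.
have G0 z : (0 <= G z)%E.
  rewrite lee_fin; apply: mulr_ge0; first by rewrite mulr_ge0// indicE ler0n.
  by apply: mulr_ge0 => //; apply: ck_ge0; exact: ltW.
have mG : measurable_fun setT G.
  apply/measurable_EFinP; apply: measurable_funM; apply: measurable_funM.
  - exact: (measurableT_comp (@measurable_indic _ borelR R setT Rplus mR) measurable_fst).
  - exact: (measurableT_comp (@measurable_indic _ borelR R setT Rplus mR) measurable_snd).
  - exact: (measurableT_comp mpsi measurable_snd).
  - exact: measurable_ck_pair.
have GE t s : G (t, s) = (\1_Rplus t * \1_Rplus s * (psi s * ck (w t) (t - s)))%:E by [].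
have -> : (\int[mu]_(t in Rplus) \int[mu]_(s in Rplus) (psi s * ck (w t) (t - s))%:E
    = \int[mu]_t \int[mu]_s G (t, s))%E.
  rewrite integral_mkcond; apply: eq_integral => t _; rewrite /patch.
  case: ifPn => tR.
    rewrite integral_mkcond; apply: eq_integral => s _; rewrite /patch GE !indicE tR mul1r.
    by case: ifPn => _; rewrite ?mul1r// mul0r.
  rewrite -[LHS](integral0 mu setT); apply: eq_integral => s _.
  by rewrite GE !indicE (negbTE tR) !mul0r.
rewrite fubini_tonelli//.
have -> : (\int[mu]_(s in Rplus) (psi s)%:E = \int[mu]_s (\1_Rplus s * psi s)%:E)%E.
  rewrite integral_mkcond; apply: eq_integral => s _; rewrite /patch indicE.
  by case: ifPn => _; rewrite ?mul1r// mul0r.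
have pi0 := @pi_ge0 R.
have L3 : 0 <= (L ^+ 3 + 2) * pi.
  by rewrite mulr_ge0// addr_ge0// exprn_ge0// (le_trans _ L1).
rewrite -ge0_integralZl//; first last.
- by move=> s _; rewrite lee_fin mulr_ge0// indicE ler0n.
- apply/measurable_EFinP; apply: measurable_funM; last exact: mpsi.
  exact: (@measurable_indic _ borelR R setT Rplus mR).
apply: le_lower_integral => s _; first by apply: integral_ge0.
have [sR|sR] := boolP (s \in Rplus); last first.
  under eq_integral do rewrite GE !indicE (negbTE sR) mulr0 mul0r.
  by rewrite integral0 indicE (negbTE sR) mul0r mule0.
have s0 : 0 <= s by rewrite -RplusE; exact/set_mem.
have -> : (\int[mu]_t G (t, s) = \int[mu]_(t in Rplus) ((psi s)%:E * (ck (w t) (t - s))%:E))%E.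
  rewrite [RHS]integral_mkcond; apply: eq_integral => t _; rewrite GE !indicE sR mulr1 /patch.
  by case: ifPn => _; rewrite ?mul1r// mul0r.
rewrite ge0_integralZl ?lee_fin//; first last.
- by move=> t _; rewrite lee_fin ck_ge0// ltW.
- by apply/measurable_EFinP; exact: measurable_ckl.
by rewrite indicE sR mul1r muleC lee_wpmul2r ?lee_fin//; exact: ck_int_t.
Qed.

(** The splitting [phi <= lam + lam `^ (1 - r) * phi `^ r], with [lam] chosen
    to balance both terms, replaces Hoelder's inequality. *)
Lemma schur_power (phi : R -> R) (r x t C : R) : (forall s, 0 <= phi s) ->
  measurable_fun setT phi -> 1 <= r -> 0 <= x -> 0 <= t -> 0 < C ->
  (x%:E <= C%:E * (((1 + t) ^- 2)%:E +
     \int[mu]_(s in Rplus) (phi s * ck (w t) (t - s))%:E))%E ->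
  ((x `^ r)%:E <= ((C * (2 + pi)) `^ r)%:E * (((1 + t) ^- 2)%:E +
     \int[mu]_(s in Rplus) (phi s `^ r * ck (w t) (t - s))%:E))%E.
Proof.
move=> phi0 mphi r1 x0 t0 C0 xle.
have mR := @measurable_Rplus R; have r0 : 0 < r by exact: lt_le_trans r1.
have q0 s : 0 <= ck (w t) (t - s) by apply: ck_ge0; exact: ltW.
have p0 s : 0 <= phi s `^ r * ck (w t) (t - s) by rewrite mulr_ge0// powR_ge0.
have pi0 := @pi_gt0 R.
set S := (\int[mu]_(s in Rplus) (phi s `^ r * ck (w t) (t - s))%:E)%E.
have S0 : (0 <= S)%E by apply: integral_ge0 => s _; rewrite lee_fin.
pose T := (1 + t) ^- 2; have t1 : 0 < (1 + t) ^+ 2 by rewrite exprn_gt0//; lra.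
have T0 : 0 < T by rewrite invr_gt0.
have T1 : T <= 1 by rewrite invf_le1// exprn_ege1//; lra.
have D0 : 0 < (C * (2 + pi)) `^ r by rewrite powR_gt0// mulr_gt0//; lra.
have [->|Sy] := eqVneq S +oo%E.
  by rewrite addey// gt0_muley ?leey// lte_fin.
have fS : S \is a fin_num by rewrite ge0_fin_numE// lt_neqAle Sy leey.
pose s0 := fine S; have s00 : 0 <= s0 by exact: fine_ge0.
have ST : 0 < s0 + T by lra.
pose lam := (s0 + T) `^ r^-1.
have lam0 : 0 < lam by exact: powR_gt0.
have lamr : lam `^ r = s0 + T.
  by rewrite -powRrM mulVf ?powRr1 ?gt_eqF// ltW.
have Tlam : T <= lam.
  have r1' : r^-1 <= 1 by rewrite invf_le1.
  apply: (@le_trans _ _ (T `^ r^-1)); first by rewrite ger1_powR// T0 T1.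
  by apply: ge0_ler_powR; rewrite ?nnegrE ?invr_ge0 ?lerDr ?addr_ge0// ltW.
have phi_le s : phi s <= lam + lam `^ (1 - r) * phi s `^ r.
  have h0 : 0 <= lam `^ (1 - r) * phi s `^ r by rewrite mulr_ge0 ?powR_ge0.
  have [|lt_lam] := leP (phi s) lam; first lra.
  suff : phi s <= lam `^ (1 - r) * phi s `^ r by lra.
  rewrite -(mulr_powRB1 (phi0 s) r0) mulrCA -[leLHS]mulr1 ler_wpM2l//.
  have -> : 1 - r = - (r - 1) by ring.
  rewrite powRN ler_pdivlMl ?powR_gt0// mulr1.
  by apply: ge0_ler_powR; rewrite ?nnegrE ?subr_ge0// ltW.
have mphir : measurable_fun setT (fun s => phi s `^ r).
  exact: (measurableT_comp (measurable_powR r) mphi).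
have mck : @measurable_fun _ _ borelR _ Rplus (fun s => (ck (w t) (t - s))%:E).
  by apply/measurable_EFinP; exact: measurable_ckr.
have mpck : @measurable_fun _ _ borelR _ Rplus (fun s => (phi s `^ r * ck (w t) (t - s))%:E).
  apply/measurable_EFinP; apply: measurable_funM; last exact: measurable_ckr.
  exact: (measurable_funTS mphir).
have : (\int[mu]_(s in Rplus) (phi s * ck (w t) (t - s))%:E <= (lam * (pi + 1))%:E)%E.
  apply: (@le_trans _ _ (\int[mu]_(s in Rplus) (lam%:E * (ck (w t) (t - s))%:E
      + (lam `^ (1 - r))%:E * (phi s `^ r * ck (w t) (t - s))%:E))%E).
    apply: le_lower_integral => s _; first by rewrite lee_fin mulr_ge0.
    by rewrite -!EFinM -EFinD lee_fin [lam `^ _ * (_ * _)]mulrA -mulrDl ler_wpM2r.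
  rewrite ge0_integralD//; first last.
  - by apply: measurable_funeM; exact: mpck.
  - by move=> s _; rewrite mule_ge0// lee_fin// powR_ge0.
  - by apply: measurable_funeM; exact: mck.
  - by move=> s _; rewrite mule_ge0// lee_fin ?q0// ltW.
  rewrite ge0_integralZl//; first last.
  - by rewrite lee_fin ltW.
  - by move=> s _; rewrite lee_fin.
  rewrite ge0_integralZl//; first last.
  - by rewrite lee_fin powR_ge0.
  - by move=> s _; rewrite lee_fin.
  rewrite -/S -(fineK fS) -/s0.
  have -> : (lam * (pi + 1))%:E = (lam%:E * pi%:E + lam%:E)%E.
    by rewrite -EFinM -EFinD mulrDr mulr1.
  apply: leeD.
    by apply: lee_wpmul2l; [rewrite lee_fin ltW|exact: ck_int_s].
  rewrite -EFinM lee_fin.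
  have -> : 1 - r = - (r - 1) by ring.
  rewrite powRN ler_pdivrMl ?powR_gt0// mulrC mulr_powRB1 ?ltW// lamr; lra.
move=> int_le.
have {}xle : x <= C * (2 + pi) * lam.
  rewrite -lee_fin; apply: (le_trans xle).
  apply: (@le_trans _ _ (C%:E * (T%:E + (lam * (pi + 1))%:E))%E).
    by apply: lee_wpmul2l; [rewrite lee_fin ltW|rewrite leeD2l].
  rewrite -EFinD -EFinM lee_fin -mulrA ler_pM2l//; lra.
rewrite -/T -/S -(fineK fS) -/s0 -EFinD -EFinM lee_fin [T + _]addrC -lamr.
have Cp0 : 0 <= C * (2 + pi) by rewrite mulr_ge0//; lra.
have lam0' : 0 <= lam by exact: ltW.
rewrite -powRM//; apply: ge0_ler_powR; rewrite ?nnegrE//; first exact: ltW.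
by rewrite mulr_ge0.
Qed.

End Schur.

(** * The weight *)

Section Weight.
Context {R : realType}.
Variable M : R -> R.
Hypothesis M_cont : {within Rplus, continuous M}.
Hypothesis M_nd : {in Rplus &, {homo M : s t / s <= t}}.
Hypothesis M_ge2 : forall s, 0 <= s -> 2 <= M s.
Implicit Types (s t v : R).

Let M_le s t : 0 <= s -> s <= t -> M s <= M t.
Proof.
move=> s0 st; apply: M_nd => //; rewrite inE RplusE//; exact: le_trans st.
Qed.

Let ln1_ge0 s : 0 <= s -> 0 <= ln (1 + s).
Proof. by move=> s0; rewrite ln_ge0// lerDl. Qed.

Let ln1_le s t : 0 <= s -> s <= t -> ln (1 + s) <= ln (1 + t).
Proof. by move=> s0 st; rewrite ler_ln ?posrE ?lerD2l// ltr_pwDl// (le_trans s0). Qed.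

(** Both factors of [Mlog] are nondecreasing and the first is at least 2; the
    second contains [ln (1 + s)]. *)
Lemma Mlog_growth s t : 0 <= s -> s <= t ->
  2 * (ln (1 + t) - ln (1 + s)) <= Mlog M t - Mlog M s.
Proof.
move=> s0 st; have t0 := le_trans s0 st.
have Ms := M_ge2 s0; have Mst := M_le s0 st.
have l1 := ln1_ge0 (le_trans (ler0n _ 2) Ms).
have l2 : ln (1 + M s) <= ln (1 + M t) by apply: ln1_le => //; lra.
have l3 := ln1_le s0 st; have l4 := ln1_ge0 s0.
rewrite /Mlog.
have h1 : 0 <= (M t - M s) * (ln (1 + M t) + ln (1 + t)) by rewrite mulr_ge0//; lra.
have h2 : 0 <= M s * (ln (1 + M t) - ln (1 + M s)) by rewrite mulr_ge0//; lra.
have h3 : 0 <= (M s - 2) * (ln (1 + t) - ln (1 + s)) by rewrite mulr_ge0//; lra.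
lra.
Qed.

Lemma Mlog_lt s t : 0 <= s -> s < t -> Mlog M s < Mlog M t.
Proof.
move=> s0 st; have := Mlog_growth s0 (ltW st).
have : ln (1 + s) < ln (1 + t).
  by rewrite ltr_ln ?posrE; lra.
lra.
Qed.

Lemma Mlog_cont s : 0 < s -> {for s, continuous (Mlog M)}.
Proof.
move=> s0.
have sub : `]0, +oo[ `<=` @Rplus R.
  by move=> x /=; rewrite in_itv/= andbT RplusE; exact: ltW.
have := continuous_subspaceW sub M_cont.
rewrite continuous_open_subspace; last exact: interval_open.
move=> /(_ s); rewrite inE/= in_itv/= andbT => /(_ s0) cM.
have cln (g : R -> R) : {for s, continuous g} -> 0 <= g s ->
    {for s, continuous (fun s => ln (1 + g s))}.
  move=> cg g0; have c1 : (1 + g x) @[x --> s] --> 1 + g s.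
    by apply: cvgD => //; exact: cvg_cst.
  have g1 : 0 < 1 + g s by rewrite ltr_pwDl.
  have h := cvg_comp (fun x => 1 + g x) (@ln R) c1 (continuous_ln g1). exact: h.
have M0 : 0 <= M s by apply: le_trans (M_ge2 (ltW s0)).
apply: cvgM => //; apply: cvgD; first exact: cln.
by apply: (cln id) => //; exact: ltW.
Qed.

Lemma Mlog_onto v : Mlog M 1 <= v -> exists2 s, 1 <= s & Mlog M s = v.
Proof.
move=> v1.
have M1 : 0 <= Mlog M 1.
  have m2 : 2 <= M 1 by exact: M_ge2.
  by rewrite mulr_ge0 ?addr_ge0 ?ln1_ge0//; lra.
pose b := expR v.
have b1 : 1 <= b by rewrite -expR0 ler_expR; exact: le_trans v1.
have vb : v <= Mlog M b.
  have Mb : 2 <= M b by apply: M_ge2; exact: le_trans b1.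
  have l1 : 0 <= ln (1 + M b) by apply: ln1_ge0; lra.
  have l2 : v <= ln (1 + b).
    rewrite -[leLHS]expRK ler_ln ?posrE ?expR_gt0//; rewrite -/b; lra.
  rewrite /Mlog.
  have h1 : 0 <= (M b - 1) * (ln (1 + M b) + ln (1 + b)).
    by rewrite mulr_ge0//; [lra|rewrite addr_ge0// (le_trans _ l2)// (le_trans M1)].
  lra.
have cb : {within `[1, b], continuous (Mlog M)}.
  by apply: cont_on_within => x /andP[x1 _]; apply: Mlog_cont; exact: lt_le_trans x1.
have [|s] := @IVT R (Mlog M) 1 b v b1 cb.
  have -> : Num.min (Mlog M 1) (Mlog M b) = Mlog M 1 by apply/min_idPl; exact: le_trans vb.
  have -> : Num.max (Mlog M 1) (Mlog M b) = Mlog M b by apply/max_idPr; exact: le_trans vb.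
  by rewrite v1 vb.
by rewrite in_itv/= => /andP[s1 _] <-; exists s.
Qed.

Lemma Mlog_invK s : 0 <= s -> Mlog_inv M (Mlog M s) = s.
Proof.
move=> s0; apply: pinvKV; last by rewrite inE RplusE.
move=> x y; rewrite !inE !RplusE => x0 y0 xy.
have [xy'|xy'|//] := ltgtP x y.
  by have := Mlog_lt x0 xy'; rewrite xy ltxx.
by have := Mlog_lt y0 xy'; rewrite xy ltxx.
Qed.

Lemma weight_spec v : Mlog M 1 <= v -> 1 <= weight M v /\ Mlog M (weight M v) = v.
Proof.
move=> v1; rewrite /weight; case: ifPn => [vle|_].
  by split=> //; apply/eqP; rewrite eq_le v1 vle.
have [s s1 <-] := Mlog_onto v1.
by rewrite Mlog_invK// (le_trans _ s1).
Qed.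

Lemma weight_small v : v <= Mlog M 1 -> weight M v = 1.
Proof. by rewrite /weight => ->. Qed.

Lemma weight_ge1 v : 1 <= weight M v.
Proof.
have [/weight_small ->//|/ltW /weight_spec[]//] := leP v (Mlog M 1).
Qed.

Lemma weight_nd : {homo weight M : s t / s <= t}.
Proof.
move=> v1 v2 v12.
have [h1|/ltW h1] := leP v1 (Mlog M 1); first by rewrite weight_small// weight_ge1.
have [s1 E1] := weight_spec h1; have [s2 E2] := weight_spec (le_trans h1 v12).
rewrite leNgt; apply/negP => lt12.
by have := Mlog_lt (le_trans ler01 s2) lt12; rewrite E1 E2 ltNge v12.
Qed.

Lemma weight_lip v1 v2 : v1 <= v2 ->
  ln (1 + weight M v2) - ln (1 + weight M v1) <= (v2 - v1) / 2.
Proof.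
move=> v12.
have [h1|/ltW h1] := leP v1 (Mlog M 1); last first.
  have [s1 E1] := weight_spec h1; have [s2 E2] := weight_spec (le_trans h1 v12).
  have := Mlog_growth (le_trans ler01 s1) (weight_nd v12); rewrite E1 E2; lra.
have [h2|/ltW h2] := leP v2 (Mlog M 1); first by rewrite !weight_small//; lra.
have [s2 E2] := weight_spec h2; rewrite (weight_small h1).
by have := Mlog_growth ler01 s2; rewrite E2; lra.
Qed.

Lemma weight_slow v1 v2 : v1 <= v2 ->
  weight M v2 <= expR ((v2 - v1) / 2) * (2 * weight M v1).
Proof.
move=> v12; have w1 := weight_ge1 v1; have w2 := weight_ge1 v2.
have h : 1 + weight M v2 <= expR ((v2 - v1) / 2) * (1 + weight M v1).
  rewrite -ler_ln ?posrE ?mulr_gt0 ?expR_gt0//; try lra.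
  rewrite lnM ?posrE ?expR_gt0 ?expRK//; last lra.
  by have := weight_lip v12; lra.
have e0 := expR_gt0 ((v2 - v1) / 2).
have : expR ((v2 - v1) / 2) * (1 + weight M v1) <= expR ((v2 - v1) / 2) * (2 * weight M v1).
  by rewrite ler_pM2l//; lra.
lra.
Qed.

(** Follows from [weight_lip], without continuity of the inverse function. *)
Lemma weight_cont : continuous (weight M).
Proof.
have lip u v : `|ln (1 + weight M u) - ln (1 + weight M v)| <= `|u - v| / 2.
  wlog uv : u v / v <= u.
    move=> H; have [/H//|/ltW/H] := leP v u.
    by rewrite distrC [`|v - u|]distrC.
  rewrite (ger0_norm (x := u - v)) ?subr_ge0// ger0_norm; first exact: weight_lip.
  by rewrite subr_ge0 ln1_le// ?weight_nd// (le_trans _ (weight_ge1 v)).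
have -> : weight M = fun v => expR (ln (1 + weight M v)) - 1.
  apply/funext => v; rewrite lnK ?posrE; first by rewrite addrC addKr.
  by have := weight_ge1 v; lra.
move=> v; apply: cvgB; last exact: cvg_cst.
suff c1 : {for v, continuous (fun v => ln (1 + weight M v))}.
  by apply: (cvg_comp (fun v => ln (1 + weight M v)) expR); [exact: c1|exact: continuous_expR].
apply/continuous_atP => e e0; exists (2 * e); first by rewrite mulr_gt0.
by move=> u uv; apply: le_trans (lip u v) _; rewrite ler_pdivrMr// mulrC ltW.
Qed.

End Weight.

(** * Complex differentiability *)

Section ComplexDerivative.
Context {R : realType}.
Implicit Types (z h : R[i]) (e d : R).

Lemma normc_ge0 z : 0 <= normc z.
Proof. by case: z => a b; exact: sqrtr_ge0. Qed.

Lemma rnorm_normc z : rnorm (z : R[i]^o) = normc z.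
Proof. by apply: complexI; rewrite rnormE normc_def; case: z. Qed.

Lemma normc_le_abs (a b : R) : normc (a +i* b) <= `|a| + `|b|.
Proof.
rewrite /= -[leRHS]ger0_norm ?addr_ge0// -sqrtr_sqr ler_sqrt ?sqr_ge0//.
rewrite sqrrD !real_normK ?num_real//.
have : 0 <= `|a| * `|b| by rewrite mulr_ge0.
by rewrite -mulr_natl; lra.
Qed.

Lemma abs_le_normc (a b : R) : (`|a| <= normc (a +i* b)) * (`|b| <= normc (a +i* b)).
Proof.
by split; rewrite /= -sqrtr_sqr ler_sqrt ?addr_ge0 ?sqr_ge0// ?lerDl ?lerDr sqr_ge0.
Qed.

Section Vector.
Context {X : normedModType R[i]}.
Implicit Types (G v : R[i] -> X).

(** The complex derivative in terms of real norms, the form that [cdiff_closed]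
    splits into two real increments. *)
Definition cdiff_at G z := exists D : X, forall e, 0 < e ->
  exists2 d, 0 < d & forall h, normc h < d ->
    rnorm (G (z + h) - G z - h *: D) <= e * normc h.

Lemma derivable_cdiff G z : derivable (G : R[i]^o -> X) z 1 -> cdiff_at G z.
Proof.
move=> /cvg_ex[/= D cD]; exists D => e e0.
have ec0 : 0 < e%:C by rewrite ltcR.
move/cvgrPdist_le : cD => /(_ _ ec0) /nbhs_normP[d d0 hd].
have dE : d = (complex.Re d)%:C by rewrite RRe_real// gtr0_real.
exists (complex.Re d) => [|h hd']; first by rewrite -ltcR -dE.
have [->|h0] := eqVneq h 0.
  by rewrite addr0 subrr scale0r subr0 rnorm0 normc0 mulr0.
have : `|D - h^-1 *: (G (h *: 1 + z) - G z)| <= e%:C.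
  apply: hd => //=; rewrite sub0r normrN -[`|h|](rnormE (h : R[i]^o)) rnorm_normc dE.
  by rewrite ltcR.
rewrite -rnormE lecR => hD.
have -> : G (z + h) - G z - h *: D = - (h *: (D - h^-1 *: (G (h *: 1 + z) - G z))).
  rewrite scalerBr scalerA divff// scale1r opprB addrC.
  by rewrite [h *: 1]mulr1 [h + z]addrC addrC.
by rewrite rnormN rnormZ mulrC ler_wpM2r ?normc_ge0.
Qed.

Lemma cdiff_bound G z : cdiff_at G z -> exists K d, [/\ 0 <= K, 0 < d &
  forall h, normc h < d -> rnorm (G (z + h) - G z) <= K * normc h].
Proof.
move=> [D /(_ 1 ltr01)[d d0 hd]]; exists (1 + rnorm D), d; split=> //.
  by rewrite addr_ge0 ?rnorm_ge0.
move=> h /hd hh; rewrite -[_ - _](subrK (h *: D)) (le_trans (rnormD _ _))//.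
by rewrite rnormZ mulrDl (mulrC (rnorm D)) lerD2r.
Qed.

Lemma cdiff_cst (x : X) z : cdiff_at (fun=> x) z.
Proof.
exists 0 => e e0; exists 1 => // h _.
by rewrite subrr scaler0 subr0 rnorm0 mulr_ge0 ?normc_ge0// ltW.
Qed.

Lemma cdiffD G v z : cdiff_at G z -> cdiff_at v z -> cdiff_at (fun z => G z + v z) z.
Proof.
move=> [D hG] [D' hv]; exists (D + D') => e e0.
have e2 : 0 < e / 2 by rewrite divr_gt0.
have [d d0 {}hG] := hG _ e2; have [d' d'0 {}hv] := hv _ e2.
exists (Num.min d d'); first by rewrite lt_min d0.
move=> h; rewrite lt_min => /andP[/hG h1 /hv h2].
have -> : G (z + h) + v (z + h) - (G z + v z) - h *: (D + D') =
    (G (z + h) - G z - h *: D) + (v (z + h) - v z - h *: D').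
  by rewrite scalerDr opprD (addrACA (G (z + h))) opprD (addrACA (G (z + h) - G z)).
by rewrite (le_trans (rnormD _ _))//; lra.
Qed.

Lemma cdiffN G z : cdiff_at G z -> cdiff_at (fun z => - G z) z.
Proof.
move=> [D hG]; exists (- D) => e /hG[d d0 {}hG]; exists d => // h /hG.
by rewrite -rnormN scalerN !opprD !opprK.
Qed.

End Vector.

Notation sdiff_at c z := (@cdiff_at R[i]^o c z).

Lemma cdiffZ {X : normedModType R[i]} (c : R[i] -> R[i]) (v : R[i] -> X) z :
  sdiff_at c z -> cdiff_at v z -> cdiff_at (fun z => c z *: v z) z.
Proof.
move=> cc [Dv hv]; have [Kc [dc [Kc0 dc0 hc']]] := cdiff_bound cc.
move: cc => [Dc hc]; exists (c z *: Dv + Dc *: v z) => e e0.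
pose A := normc (c z) + Kc + 1.
have A0 : 0 < A by rewrite /A; have := normc_ge0 (c z); lra.
have nv := rnorm_ge0 (v z); have nD := rnorm_ge0 Dv.
have e1 : 0 < e / (2 * A) by rewrite divr_gt0// mulr_gt0.
have e2 : 0 < e / (4 * (rnorm (v z) + 1)) by rewrite divr_gt0// mulr_gt0//; lra.
have B0 : 0 < 4 * (Kc * rnorm Dv + 1).
  by rewrite mulr_gt0// ltr_wpDl// mulr_ge0.
have e3 : 0 < e / (4 * (Kc * rnorm Dv + 1)) by rewrite divr_gt0.
have [d1 d10 {}hv] := hv _ e1; have [d2 d20 {}hc] := hc _ e2.
exists (Num.min (Num.min d1 d2) (Num.min (Num.min dc 1) (e / (4 * (Kc * rnorm Dv + 1))))).
  by rewrite !lt_min d10 d20 dc0 ltr01 e3.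
move=> h; rewrite !lt_min => /andP[/andP[/hv hv1 /hc hc1] /andP[/andP[/hc' hc2 h1] h3]].
rewrite !rnorm_normc in hc1 hc2; have h0 := normc_ge0 h.
have -> : c (z + h) *: v (z + h) - c z *: v z - h *: (c z *: Dv + Dc *: v z) =
    c (z + h) *: (v (z + h) - v z - h *: Dv) + ((c (z + h) - c z) * h) *: Dv
    + (c (z + h) - c z - h * Dc) *: v z.
  rewrite !scalerBr !scalerBl mulrBl scalerBl scalerDr !scalerA [h * c z]mulrC.
  have E (a b d e' f g : X) : a - f - (e' + g) = (a - b - d) + (d - e') + (b - f - g).
    rewrite subrKA (addrAC a (- b)) -(addrA b) subrKA opprD.
    by rewrite (addrACA a (- f)).
  exact: E.
have chA : normc (c (z + h)) <= A.
  rewrite -[c (z + h)](subrK (c z)) (le_trans (le_normcD _ _))// /A.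
  have : Kc * normc h <= Kc * 1 by rewrite ler_wpM2l// ltW.
  lra.
have t1 : rnorm (c (z + h) *: (v (z + h) - v z - h *: Dv)) <= e / 2 * normc h.
  rewrite rnormZ; apply: (@le_trans _ _ (A * (e / (2 * A) * normc h))).
    by rewrite ler_pM ?normc_ge0 ?rnorm_ge0.
  by rewrite le_eqVlt; apply/orP; left; apply/eqP; field; rewrite gt_eqF.
have t2 : rnorm (((c (z + h) - c z) * h) *: Dv) <= e / 4 * normc h.
  rewrite rnormZ normcM.
  apply: (@le_trans _ _ (Kc * normc h * normc h * rnorm Dv)).
    by rewrite ler_wpM2r// ler_wpM2r.
  rewrite mulrAC ler_wpM2r// mulrAC mulrC.
  move: h3; rewrite ltr_pdivlMr// => h3.
  have : 0 <= Kc * rnorm Dv by rewrite mulr_ge0.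
  lra.
have t3 : rnorm ((c (z + h) - c z - h * Dc) *: v z) <= e / 4 * normc h.
  rewrite rnormZ; apply: (@le_trans _ _ (e / (4 * (rnorm (v z) + 1)) * normc h * (rnorm (v z) + 1))).
    by rewrite ler_pM ?normc_ge0//; lra.
  by rewrite le_eqVlt; apply/orP; left; apply/eqP; field; rewrite gt_eqF//; lra.
rewrite (le_trans (rnormD _ _))//; have := rnormD (c (z + h) *: (v (z + h) - v z - h *: Dv)) (((c (z + h) - c z) * h) *: Dv).
lra.
Qed.

Lemma cdiff_id z : sdiff_at id z.
Proof.
exists 1 => e e0; exists 1 => // h _.
have -> : h *: (1 : R[i]^o) = h by exact: mulr1.
have -> : id (z + h) - id z - h = 0 by rewrite /=; ring.
by rewrite rnorm0 mulr_ge0 ?normc_ge0// ltW.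
Qed.

Lemma cdiffM (c v : R[i] -> R[i]) z : sdiff_at c z -> sdiff_at v z ->
  sdiff_at (fun z => c z * v z) z.
Proof. exact: (@cdiffZ R[i]^o). Qed.

Lemma cdiffV z : z != 0 -> sdiff_at (fun z => z^-1) z.
Proof.
move=> z0; exists (- z ^- 2) => e e0.
have nz : 0 < normc z.
  rewrite lt_neqAle normc_ge0 andbT eq_sym; apply/eqP => /eq0_normc z00.
  by rewrite z00 eqxx in z0.
have n3 : 0 < normc z ^+ 3 by rewrite exprn_gt0.
exists (Num.min (normc z / 2) (e * (normc z ^+ 3 / 2))).
  by rewrite lt_min divr_gt0//= mulr_gt0// divr_gt0.
move=> h; rewrite lt_min => /andP[h1 h2].
have zh : normc z / 2 < normc (z + h).
  have := le_normcD (z + h) (- h); rewrite addrK -[normc (- h)]/(normc (- (h : Rcomplex R))) normcN; lra.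
have zh0 : z + h != 0.
  by apply/eqP => E; move: zh; rewrite E normc0; lra.
have -> : (z + h)^-1 - z^-1 - h *: (- z ^- 2 : R[i]^o) = h * (h * (z ^- 2 * (z + h)^-1)).
  by rewrite /GRing.scale/=; field; rewrite zh0.
rewrite rnorm_normc normcM mulrC ler_wpM2r ?normc_ge0// !normcM !normcV expr2 normcM.
have nh := normc_ge0 h.
rewrite -[leRHS]mulr1 -expr2.
have z2 : 0 < normc z ^+ 2 by rewrite exprn_gt0.
have zh' : 0 < normc (z + h) by lra.
rewrite mulr1 mulrA ler_pdivrMr// ler_pdivrMr//.
apply: (le_trans (ltW h2)); rewrite -mulrA ler_pM2l// [normc z ^+ 3]exprSr.
have : normc z ^+ 2 * (normc z / 2) <= normc z ^+ 2 * normc (z + h) by rewrite ler_pM2l// ltW.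
lra.
Qed.

End ComplexDerivative.


Section ComplexExponential.
Context {R : realType}.
Implicit Types (x y a b t : R) (z h w : R[i]).

Lemma mean_value_bound (f f' : R -> R) (K a : R) :
  (forall x, is_derive x 1 f (f' x)) ->
  (forall x, `|x| <= `|a| -> `|f' x| <= K) -> `|f a - f 0| <= K * `|a|.
Proof.
move=> df fK.
have dK x : is_derive x 1 (fun x => K * x) K.
  by eapply dcong; [by deriv|rewrite /=; ring].
have [a0|/ltW a0] := leP 0 a.
  rewrite (ger0_norm a0).
  have := @deriv_compare _ f (fun x => K * x) f' (fun=> K) 0 a a0 (fun x _ => df x) (fun x _ => dK x).
  rewrite mulr0 subr0; apply => x /andP[x0 xa].
  by apply: fK; rewrite !ger0_norm.
rewrite (ler0_norm a0) distrC mulrN.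
have := @deriv_compare _ f (fun x => K * x) f' (fun=> K) a 0 a0 (fun x _ => df x) (fun x _ => dK x).
rewrite mulr0 sub0r; apply => x /andP[ax x0].
by apply: fK; rewrite !ler0_norm// lerN2.
Qed.

Lemma sin_abs_le b : `|sin b| <= `|b|.
Proof.
have := @mean_value_bound sin cos 1 b (fun x => is_derive_sin x).
rewrite sin0 subr0 mul1r; apply => x _.
by rewrite ler_norml cos_geN1 cos_le1.
Qed.

Lemma cos_near1 b : `|cos b - 1| <= `|b| ^+ 2.
Proof.
have := @mean_value_bound cos (fun x => - sin x) `|b| b (fun x => is_derive_cos x).
rewrite cos0 -expr2; apply => x xb.
by rewrite normrN (le_trans (sin_abs_le _)).
Qed.

Lemma sin_near b : `|b| <= 1 -> `|sin b - b| <= `|b| ^+ 2.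
Proof.
move=> b1.
have ds x : is_derive x 1 (fun x => sin x - x) (cos x - 1).
  by eapply dcong; [by deriv|rewrite /=; ring].
have := @mean_value_bound _ _ `|b| b ds.
rewrite sin0 !subr0 -expr2; apply => x xb.
apply: le_trans (cos_near1 x) _; rewrite expr2 -[leRHS]mulr1 ler_pM//.
exact: le_trans b1.
Qed.

Lemma expR_near1 a : `|a| <= 1 -> `|expR a - 1| <= expR 1 * `|a|.
Proof.
move=> a1.
have := @mean_value_bound expR expR (expR 1) a (fun x => is_derive_expR x).
rewrite expR0; apply => x xa.
by rewrite ger0_norm ?expR_ge0// ler_expR (le_trans (ler_norm _))// (le_trans xa).
Qed.

Lemma expR_near a : `|a| <= 1 -> `|expR a - 1 - a| <= expR 1 * `|a| ^+ 2.
Proof.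
move=> a1.
have ds x : is_derive x 1 (fun x => expR x - 1 - x) (expR x - 1).
  by eapply dcong; [by deriv|rewrite /=; ring].
have := @mean_value_bound _ _ (expR 1 * `|a|) a ds.
rewrite expR0 subrr !subr0 -mulrA -expr2; apply => x xa.
by rewrite (le_trans (expR_near1 (le_trans xa a1)))// ler_pM2l ?expR_gt0.
Qed.

Lemma cexpD z w : cexp (z + w) = cexp z * cexp w.
Proof.
case: z w => [a b] [c d]; rewrite /= expRD cosD sinD.
by apply/eqP; rewrite eq_complex/=; apply/andP; split; apply/eqP; ring.
Qed.

Lemma cexp_near1 h : normc h <= 1 ->
  normc (cexp h - 1 - h) <= 4 * expR 1 * normc h ^+ 2.
Proof.
case: h => a b h1; set n := normc _ in h1 *.
have [an bn] := abs_le_normc a b; rewrite -/n in an bn.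
have e1 : 1 <= expR (1 : R) by rewrite -expR0 ler_expR.
have e0 := expR_gt0 (1 : R).
have [a1 b1] : `|a| <= 1 /\ `|b| <= 1 by split; [exact: le_trans an h1|exact: le_trans bn h1].
have -> : cexp (a +i* b) - 1 - (a +i* b) =
    (expR a * (cos b - 1) + (expR a - 1 - a)) +i* ((expR a - 1) * sin b + (sin b - b)).
  by apply/eqP; rewrite eq_complex/=; apply/andP; split; apply/eqP; ring.
have n2 : 0 <= n ^+ 2 by exact: sqr_ge0.
have [a2 b2] : `|a| ^+ 2 <= n ^+ 2 /\ `|b| ^+ 2 <= n ^+ 2.
  by split; rewrite ler_sqr// nnegrE normc_ge0.
have ab : `|a| * `|b| <= n ^+ 2 by rewrite expr2 ler_pM.
apply: (le_trans (normc_le_abs _ _)).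
have t1 : `|expR a * (cos b - 1)| <= expR 1 * n ^+ 2.
  rewrite normrM ler_pM ?normr_ge0//; last exact: le_trans (cos_near1 b) b2.
  by rewrite ger0_norm ?expR_ge0// ler_expR (le_trans (ler_norm _)).
have t2 : `|expR a - 1 - a| <= expR 1 * n ^+ 2.
  by apply: le_trans (expR_near a1) _; rewrite ler_pM2l.
have t3 : `|(expR a - 1) * sin b| <= expR 1 * n ^+ 2.
  rewrite normrM; apply: (@le_trans _ _ (expR 1 * `|a| * `|b|)).
    by rewrite ler_pM ?normr_ge0 ?expR_near1 ?sin_abs_le.
  by rewrite -mulrA ler_pM2l.
have t4 : `|sin b - b| <= expR 1 * n ^+ 2.
  apply: le_trans (sin_near b1) _; apply: (le_trans b2).
  by rewrite -[leLHS]mul1r ler_wpM2r.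
have := ler_normD (expR a * (cos b - 1)) (expR a - 1 - a).
have := ler_normD ((expR a - 1) * sin b) (sin b - b).
lra.
Qed.

Lemma cdiff_cexp t z : @cdiff_at R R[i]^o (fun z => cexp (t%:C * z)) z.
Proof.
exists (cexp (t%:C * z) * t%:C) => e e0.
set A := normc (cexp (t%:C * z)).
have A0 : 0 <= A by exact: normc_ge0.
have E0 := expR_gt0 (1 : R).
pose B := A * (4 * expR 1) * t ^+ 2 + 1.
have B0 : 0 < B.
  by rewrite ltr_wpDl// mulr_ge0 ?sqr_ge0// mulr_ge0//; lra.
have T0 : 0 < `|t| + 1 by rewrite ltr_wpDl.
exists (Num.min (`|t| + 1)^-1 (e / B)).
  by rewrite lt_min invr_gt0 T0 divr_gt0.
move=> h; rewrite lt_min => /andP[h1 h2]; have h0 := normc_ge0 h.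
have th : normc (t%:C * h) = `|t| * normc h by rewrite normcM normc_real.
have th1 : normc (t%:C * h) <= 1.
  rewrite th; apply: (@le_trans _ _ ((`|t| + 1) * normc h)).
    by rewrite ler_wpM2r// lerDl.
  by rewrite -ler_pdivlMl// mulr1 ltW.
have -> : cexp (t%:C * (z + h)) - cexp (t%:C * z) - h *: (cexp (t%:C * z) * t%:C : R[i]^o) =
    cexp (t%:C * z) * (cexp (t%:C * h) - 1 - t%:C * h).
  by rewrite mulrDr cexpD /GRing.scale/=; ring.
rewrite rnorm_normc normcM -/A.
apply: (@le_trans _ _ (A * (4 * expR 1 * normc (t%:C * h) ^+ 2))).
  by rewrite ler_wpM2l// cexp_near1.
rewrite th exprMn real_normK ?num_real//.
have -> : A * (4 * expR 1 * (t ^+ 2 * normc h ^+ 2)) =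
  A * (4 * expR 1) * t ^+ 2 * normc h * normc h by ring.
rewrite ler_wpM2r//.
move: h2; rewrite ltr_pdivlMr// mulrC /B => h2.
have : (A * (4 * expR 1) * t ^+ 2 + 1) * normc h = A * (4 * expR 1) * t ^+ 2 * normc h + normc h by ring.
lra.
Qed.

(** A complex differentiable function, seen through a real functional, yields
    the coefficients of a closed form. *)
Lemma cdiff_closed (X : normedModType R[i]) (G : R[i] -> X) (l : X -> R) (C x y : R) :
  real_linear l -> bounded_by C l -> 0 <= C -> cdiff_at G (x +i* y) ->
  closed_at (fun x y => l (- 'i *: G (x +i* y))) (fun x y => l (G (x +i* y))) x y.
Proof.
move=> ll lC C0 [D hD]; exists (l (- 'i *: D)), (l D), (l ('i *: D)) => e e0.
have C1 : 0 < C + 1 by rewrite ltr_wpDl.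
have [d d0 {}hD] := hD _ (divr_gt0 e0 C1).
exists (d / 2); first by rewrite divr_gt0.
move=> x' y' xd yd; pose h := (x' - x) +i* (y' - y).
have hz : (x +i* y) + h = x' +i* y'.
  by apply/eqP; rewrite eq_complex/=; apply/andP; split; apply/eqP; ring.
have hle : normc h <= `|x' - x| + `|y' - y| by exact: normc_le_abs.
have hd : normc h < d by lra.
have := hD h hd; rewrite hz => hr.
have bnd : C * rnorm (G (x' +i* y') - G (x +i* y) - h *: D) <= e * (`|x' - x| + `|y' - y|).
  have : e / (C + 1) * normc h <= e / (C + 1) * (`|x' - x| + `|y' - y|).
    by rewrite ler_pM2l// divr_gt0.
  move=> /(le_trans hr) h2.
  apply: (@le_trans _ _ ((C + 1) * (e / (C + 1) * (`|x' - x| + `|y' - y|)))).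
    by rewrite ler_pM ?rnorm_ge0// lerDl.
  by rewrite le_eqVlt; apply/orP; left; apply/eqP; field; rewrite gt_eqF.
split; apply: le_trans bnd.
  have -> : l (- 'i *: G (x' +i* y')) - l (- 'i *: G (x +i* y)) - l (- 'i *: D) * (x' - x)
      - l D * (y' - y) = l (- 'i *: (G (x' +i* y') - G (x +i* y) - h *: D)).
    rewrite !scalerBr !(real_linearB _ _ ll) scalerA.
    have -> : - 'i * h = (y' - y) +i* (- (x' - x)).
      by apply/eqP; rewrite eq_complex/=; apply/andP; split; apply/eqP; ring.
    by rewrite (real_linear_complex (y' - y) (- (x' - x)) D ll) !scaleNr !(real_linearN _ ll); ring.
  apply: le_trans (lC _) _; rewrite rnormZ -[X in normc X]/(- ('i : Rcomplex R)) normcN.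
  by rewrite /= expr0n expr1n add0r sqrtr1 mul1r.
have -> : l (G (x' +i* y')) - l (G (x +i* y)) - l D * (x' - x) - l ('i *: D) * (y' - y) =
    l (G (x' +i* y') - G (x +i* y) - h *: D).
  by rewrite !(real_linearB _ _ ll) (real_linear_complex (x' - x) (y' - y) D ll); ring.
exact: lC.
Qed.

End ComplexExponential.

(** * Shifting the contour *)

Section Contour.
Context {R : realType} {X : normedModType R[i]}.
Implicit Types (z : R[i]) (x y : R).

(** [cutoff] extends [bump], placed on the line of real part [a], to a
    polynomial in [z]. *)
Definition cutoff (a rho : R) z : R[i] :=
  let w := (z - a%:C) * rho^-1%:C in (1 + w * w) * (1 + w * w).

Definition contour_weight (t a rho : R) z : R[i] :=
  cexp (t%:C * z) * cutoff a rho z * z^-1.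

Definition contour_fun (F : R[i] -> X) (t a rho : R) z : X :=
  contour_weight t a rho z *: (F 0 - F z).

Lemma cdiff_cutoff a rho z : @cdiff_at R R[i]^o (cutoff a rho) z.
Proof.
have cw : @cdiff_at R R[i]^o (fun z => (z - a%:C) * rho^-1%:C) z.
  apply: cdiffM; last exact: cdiff_cst.
  by apply: cdiffD; [exact: cdiff_id|exact: cdiff_cst].
have c1 : @cdiff_at R R[i]^o (fun z => 1 + (z - a%:C) * rho^-1%:C * ((z - a%:C) * rho^-1%:C)) z.
  by apply: cdiffD; [exact: cdiff_cst|exact: cdiffM].
exact: cdiffM.
Qed.

Lemma cdiff_contour F t a rho z : z != 0 -> cdiff_at F z ->
  cdiff_at (contour_fun F t a rho) z.
Proof.
move=> z0 cF; apply: (@cdiffZ _ _ (contour_weight t a rho) (fun z => F 0 - F z)).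
  apply: cdiffM; last exact: cdiffV.
  by apply: cdiffM; [exact: cdiff_cexp|exact: cdiff_cutoff].
by apply: cdiffD; [exact: cdiff_cst|exact: cdiffN].
Qed.

(** [F 0 - F z] vanishes at 0 and compensates the pole of the weight. *)
Lemma contour_bounded0 F t a rho : cdiff_at F 0 -> exists B d, [/\ 0 < d, 0 <= B &
  forall z, normc z < d -> rnorm (contour_fun F t a rho z) <= B].
Proof.
move=> /cdiff_bound[K [d [K0 d0 hK]]].
pose s z := cexp (t%:C * z) * cutoff a rho z.
have cs : @cdiff_at R R[i]^o s 0.
  by apply: cdiffM; [exact: cdiff_cexp|exact: cdiff_cutoff].
have [K' [d' [K'0 d'0 hK']]] := cdiff_bound cs.
exists ((normc (s 0) + K') * K), (Num.min 1 (Num.min d d')); split.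
- by rewrite !lt_min ltr01 d0.
- by rewrite mulr_ge0// addr_ge0 ?normc_ge0.
move=> z; rewrite !lt_min => /and3P[z1 zd zd'].
rewrite /contour_fun /contour_weight rnormZ normcM normcV.
have nz := normc_ge0 z.
have [->|z0] := eqVneq z 0.
  by rewrite normc0 invr0 mulr0 mul0r mulr_ge0// addr_ge0 ?normc_ge0.
have nz0 : 0 < normc z.
  rewrite lt_neqAle nz andbT eq_sym; apply/eqP => /eq0_normc z00.
  by rewrite z00 eqxx in z0.
have hF : rnorm (F 0 - F z) <= K * normc z.
  by have := hK _ zd; rewrite add0r -rnormN opprB.
have hs : normc (s z) <= normc (s 0) + K'.
  have := hK' _ zd'; rewrite add0r rnorm_normc => h.
  rewrite -[s z](subrK (s 0)) (le_trans (le_normcD _ _))// addrC lerD2l.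
  by apply: le_trans h _; rewrite -[leRHS]mulr1 ler_wpM2l// ltW.
rewrite -mulrA; apply: ler_pM; rewrite ?normc_ge0// ?mulr_ge0 ?invr_ge0 ?rnorm_ge0//.
by rewrite mulrC ler_pdivrMr.
Qed.

Lemma normc_cutoff (x y a rho B : R) : 0 < rho ->
  `|1 + ((x - a) / rho) ^+ 2 - (y / rho) ^+ 2| + 2 * (`|(x - a) / rho| * `|y / rho|) <= B ->
  normc (cutoff a rho (x +i* y)) <= B ^+ 2.
Proof.
move=> r0 hB; rewrite /cutoff normcM expr2.
pose w := (x +i* y - a%:C) * rho^-1%:C; rewrite -/w.
suff h : normc (1 + w * w) <= B by rewrite ler_pM ?normc_ge0.
have -> : 1 + w * w = (1 + ((x - a) / rho) ^+ 2 - (y / rho) ^+ 2)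
    +i* (2 * ((x - a) / rho * (y / rho))).
  by rewrite /w; apply/eqP; rewrite eq_complex/=; apply/andP; split; apply/eqP; ring.
apply: (le_trans (normc_le_abs _ _)).
by rewrite [`|2 * _|]normrM [`|_ * (y / rho)|]normrM (ger0_norm (x := 2)).
Qed.

Section Estimates.
Variables (F : R[i] -> X) (l : X -> R) (t a rho d m : R).
Hypothesis ll : real_linear l.
Hypothesis l1 : bounded_by 1 l.
Hypothesis t0 : 0 < t.
Hypothesis at1 : a * t = 1.
Hypothesis d0 : 0 < d.
Hypothesis ad1 : a + d <= 1.
Hypothesis rho1 : 1 <= rho.
Hypothesis m0 : 0 <= m.
Hypothesis hF : forall x y, - d <= x <= a -> - rho <= y <= rho ->
  cdiff_at F (x +i* y) /\ rnorm (F (x +i* y)) <= m.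

Let a0 : 0 < a.
Proof. by rewrite -(pmulr_lgt0 _ t0) at1. Qed.

Let F0m : rnorm (F 0) <= m.
Proof.
have [| |//] := hF (x := 0) (y := 0).
- by apply/andP; split; [rewrite oppr_le0 ltW|exact: ltW].
- by have r1 := rho1; apply/andP; split; lra.
Qed.

Let diff_le x y : - d <= x <= a -> - rho <= y <= rho ->
  rnorm (F 0 - F (x +i* y)) <= 2 * m.
Proof.
move=> xi yi; have [_ h] := hF xi yi.
by apply: le_trans (rnormB _ _) _; have := F0m; lra.
Qed.

Let normc_expz x y : normc (cexp (t%:C * (x +i* y))) = expR (t * x).
Proof. by rewrite -(normc_cexp _ (t * y)); congr (normc (cexp _)); simpc. Qed.

Let invz_re x y : x != 0 -> normc (x +i* y)^-1 <= `|x|^-1.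
Proof.
move=> x0; have x0' : 0 < `|x| by rewrite normr_gt0.
have [h _] := abs_le_normc x y.
by rewrite normcV lef_pV2// posrE//; exact: lt_le_trans h.
Qed.

Let invz_im x y : y != 0 -> normc (x +i* y)^-1 <= `|y|^-1.
Proof.
move=> y0; have y0' : 0 < `|y| by rewrite normr_gt0.
have [_ h] := abs_le_normc x y.
by rewrite normcV lef_pV2// posrE//; exact: lt_le_trans h.
Qed.

(** On the horizontal sides the double zero of [cutoff] at the right end
    supplies the decay in [t]. *)
Lemma horizontal_bound x y : - d <= x <= a -> `|y| = rho ->
  rnorm (contour_fun F t a rho (x +i* y)) <=
  144 * expR 1 * m / (rho ^+ 3 * t ^+ 2) * expR (t / 2 * (x - a)).
Proof.
move=> /andP[dx xa] yr.
have [r1 tt dd mm aa] : [/\ 1 <= rho, 0 < t, 0 < d, 0 <= m & 0 < a].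
  by split; [exact: rho1|exact: t0|exact: d0|exact: m0|exact: a0].
have r0 : 0 < rho by lra.
have yi : - rho <= y <= rho by rewrite -ler_norml yr.
have xi : - d <= x <= a by rewrite dx xa.
pose u := a - x; have u0 : 0 <= u by rewrite /u; lra.
have u1 : u <= 1 by have := ad1; rewrite /u; lra.
have y0 : y != 0 by rewrite -normr_gt0 yr.
have hc : normc (cutoff a rho (x +i* y)) <= (3 * (u / rho)) ^+ 2.
  apply: normc_cutoff => //.
  have -> : (y / rho) ^+ 2 = 1.
    by rewrite expr_div_n -[y ^+ 2]real_normK ?num_real// yr divff// gt_eqF// exprn_gt0.
  rewrite [`|y / rho|]normrM normfV (gtr0_norm r0) yr divff ?gt_eqF// mulr1.
  have -> : `|(x - a) / rho| = u / rho.
    by rewrite normrM normfV (gtr0_norm r0) -normrN opprB (ger0_norm u0).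
  have -> : (x - a) / rho = - (u / rho) by rewrite /u -mulNr opprB.
  rewrite sqrrN addrAC subrr add0r ger0_norm ?sqr_ge0//.
  have ur0 : 0 <= u / rho by rewrite divr_ge0// ltW.
  have ur1 : u / rho <= 1 by rewrite ler_pdivrMr// mul1r; lra.
  have : (u / rho) ^+ 2 <= u / rho by rewrite expr2 -[leRHS]mul1r ler_wpM2r.
  lra.
have he : (t * u) ^+ 2 * expR (t * x) <= 8 * expR 1 * expR (t / 2 * (x - a)).
  have -> : expR (t * x) = expR 1 * expR (t / 2 * (x - a)) * expR (- (t / 2 * u)).
    have -> : t * x = a * t + t / 2 * (x - a) + - (t / 2 * u) by rewrite /u; field.
    by rewrite !expRD at1.
  have q : (t / 2 * u) ^+ 2 / 2 <= expR (t / 2 * u).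
    have h0 : 0 <= t / 2 * u by rewrite mulr_ge0// divr_ge0// ltW.
    by have := @expR_ge1Dxn R _ 1 h0; rewrite -[(2`!)%N]/2%N; lra.
  rewrite expRN; have E := expR_gt0 (t / 2 * u).
  rewrite mulrA ler_pdivrMr//.
  have EE : 0 < expR 1 * expR (t / 2 * (x - a)) by rewrite mulr_gt0// expR_gt0.
  have -> : 8 * expR 1 * expR (t / 2 * (x - a)) * expR (t / 2 * u) =
    8 * expR (t / 2 * u) * (expR 1 * expR (t / 2 * (x - a))) by ring.
  rewrite ler_pM2r//.
  have -> : (t * u) ^+ 2 = 8 * ((t / 2 * u) ^+ 2 / 2) by field.
  by rewrite ler_pM2l.
rewrite /contour_fun /contour_weight rnormZ (normcM (_ * cutoff a rho _)) (normcM (cexp _))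
  normc_expz.
have hi := invz_im x y0; rewrite yr in hi.
have hd := diff_le xi yi.
apply: (@le_trans _ _ (expR (t * x) * (3 * (u / rho)) ^+ 2 * rho^-1 * (2 * m))).
  have e0 := expR_ge0 (t * x).
  apply: ler_pM hd; [|exact: rnorm_ge0|].
    by apply: mulr_ge0; [apply: mulr_ge0 => //; exact: normc_ge0|exact: normc_ge0].
  by apply: ler_pM hi; [apply: mulr_ge0 => //; exact: normc_ge0|exact: normc_ge0|exact: ler_wpM2l].
have -> : expR (t * x) * (3 * (u / rho)) ^+ 2 * rho^-1 * (2 * m) =
    18 * m / (rho ^+ 3 * t ^+ 2) * ((t * u) ^+ 2 * expR (t * x)).
  by field; rewrite !gt_eqF.
have -> : 144 * expR 1 * m / (rho ^+ 3 * t ^+ 2) * expR (t / 2 * (x - a)) =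
    18 * m / (rho ^+ 3 * t ^+ 2) * (8 * expR 1 * expR (t / 2 * (x - a))).
  by field; rewrite !gt_eqF.
rewrite ler_wpM2l// divr_ge0 ?mulr_ge0 ?exprn_ge0// ltW//.
Qed.

(** On the left side there is only the exponential to rely on. *)
Lemma vertical_bound y : - rho <= y <= rho ->
  rnorm (contour_fun F t a rho (- d +i* y)) <= 32 * m * expR (- (t * d)) / d.
Proof.
move=> yi.
have [r1 tt dd mm aa] : [/\ 1 <= rho, 0 < t, 0 < d, 0 <= m & 0 < a].
  by split; [exact: rho1|exact: t0|exact: d0|exact: m0|exact: a0].
have r0 : 0 < rho by lra.
have xi : - d <= - d <= a by apply/andP; split; lra.
have dn0 : - d != 0 by rewrite oppr_eq0 gt_eqF.
have hc : normc (cutoff a rho (- d +i* y)) <= 4 ^+ 2.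
  apply: normc_cutoff => //.
  have yr1 : `|y / rho| <= 1.
    by rewrite normrM normfV (gtr0_norm r0) ler_pdivrMr// mul1r ler_norml.
  have xr1 : `|(- d - a) / rho| <= 1.
    rewrite normrM normfV (gtr0_norm r0) ler_pdivrMr// mul1r ler_norml.
    by have := ad1; move=> ?; apply/andP; split; lra.
  have h1 : `|(- d - a) / rho| * `|y / rho| <= 1 by rewrite mulr_ile1.
  have [p0 p1] : 0 <= ((- d - a) / rho) ^+ 2 /\ ((- d - a) / rho) ^+ 2 <= 1.
    by rewrite sqr_ge0 -real_normK ?num_real// expr_le1.
  have [q0 q1] : 0 <= (y / rho) ^+ 2 /\ (y / rho) ^+ 2 <= 1.
    by rewrite sqr_ge0 -real_normK ?num_real// expr_le1.
  have h2 : `|1 + ((- d - a) / rho) ^+ 2 - (y / rho) ^+ 2| <= 2.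
    by rewrite ler_norml; apply/andP; split; lra.
  lra.
rewrite /contour_fun /contour_weight rnormZ (normcM (_ * cutoff a rho _)) (normcM (cexp _))
  normc_expz mulrN.
have hi := invz_re y dn0; rewrite normrN (gtr0_norm dd) in hi.
have hd := diff_le xi yi.
apply: (@le_trans _ _ (expR (- (t * d)) * 4 ^+ 2 * d^-1 * (2 * m))).
  have e0 := expR_ge0 (- (t * d)).
  apply: ler_pM hd; [|exact: rnorm_ge0|].
    by apply: mulr_ge0; [apply: mulr_ge0 => //; exact: normc_ge0|exact: normc_ge0].
  by apply: ler_pM hi; [apply: mulr_ge0 => //; exact: normc_ge0|exact: normc_ge0|exact: ler_wpM2l].
by rewrite le_eqVlt; apply/orP; left; apply/eqP; field; rewrite gt_eqF.
Qed.

(** The right side of the rectangle is exchanged for the other three. *)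
Lemma contour_bound :
  `|sint (fun y => l (contour_fun F t a rho (a +i* y))) (- rho) rho| <=
  4 / t * (144 * expR 1 * m / (rho ^+ 3 * t ^+ 2)) +
  64 * rho * m * expR (- (t * d)) / d.
Proof.
have [r1 tt dd mm aa] : [/\ 1 <= rho, 0 < t, 0 < d, 0 <= m & 0 < a].
  by split; [exact: rho1|exact: t0|exact: d0|exact: m0|exact: a0].
pose P x y := l (- 'i *: contour_fun F t a rho (x +i* y)).
pose Q x y := l (contour_fun F t a rho (x +i* y)).
have closed x y : - d <= x <= a -> - rho <= y <= rho -> (x != 0) || (y != 0) ->
    closed_at P Q x y.
  move=> xi yi xy0; apply: (cdiff_closed ll l1 ler01); apply: cdiff_contour.
    by rewrite eq_complex/= negb_and.
  by have [] := hF xi yi.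
have PQle x y : (`|P x y| <= rnorm (contour_fun F t a rho (x +i* y))) *
    (`|Q x y| <= rnorm (contour_fun F t a rho (x +i* y))).
  split; apply: le_trans (l1 _) _; rewrite mul1r//.
  rewrite rnormZ -[X in normc X]/(- ('i : Rcomplex R)) normcN.
  by rewrite /= expr0n expr1n add0r sqrtr1 mul1r.
have [] := hF (x := 0) (y := 0); [by apply/andP; split; lra..|].
move=> /(contour_bounded0 t a rho)[B [e [e0 B0 hB]]] _.
have PQB x y : `|x| < e / 2 -> `|y| < e / 2 -> `|P x y| <= B /\ `|Q x y| <= B.
  move=> xe ye; have he : normc (x +i* y) < e.
    by apply: le_lt_trans (normc_le_abs _ _) _; lra.
  have := hB _ he => h; have [h1 h2] := PQle x y.
  by split; [exact: le_trans h1 h|exact: le_trans h2 h].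
have := @goursat_punctured R P Q (- d) a (- rho) rho B (e / 2).
have [nd nr e2 r0] : [/\ - d < 0, - rho < 0, 0 < e / 2 & 0 < rho] by split; lra.
move=> /(_ nd aa nr r0 e2 closed PQB) E.
have rn0 : rho != 0 by rewrite gt_eqF.
have da : - d <= a by lra.
have rr : - rho <= rho by lra.
have cP y : - rho <= y <= rho -> y != 0 -> cont_on (P ^~ y) (- d) a.
  by move=> yi y0 x xi; apply: (@closed_at_contl _ P Q); apply: closed; rewrite ?y0 ?orbT.
have cQ : cont_on (Q (- d)) (- rho) rho.
  move=> y yi; apply: (@closed_at_contr _ P Q); apply: closed => //.
    by rewrite lexx da.
  by rewrite oppr_eq0 gt_eqF.
set K := 144 * expR 1 * m / (rho ^+ 3 * t ^+ 2).
have K0 : 0 <= K.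
  have [r3 t2] : 0 < rho ^+ 3 /\ 0 < t ^+ 2 by rewrite !exprn_gt0.
  rewrite /K; apply: divr_ge0; last by rewrite mulr_ge0 ?ltW.
  by apply: mulr_ge0 => //; rewrite mulr_ge0 ?expR_ge0.
have hP y : - rho <= y <= rho -> `|y| = rho -> `|sint (P ^~ y) (- d) a| <= 2 / t * K.
  move=> yi yr; have y0 : y != 0 by rewrite -normr_gt0 yr.
  pose k x := K * expR (t / 2 * (x - a)).
  have dk x : is_derive x 1 (fun x => 2 / t * K * expR (t / 2 * (x - a))) (k x).
    by eapply dcong; [by deriv|rewrite /k /=; field; rewrite gt_eqF].
  have ck : cont_on k (- d) a by rewrite /k; contin.
  apply: (le_trans (@le_norm_sint _ _ k _ _ da (cP _ yi y0) ck _)).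
    move=> x xi; apply: le_trans (PQle x y).1 _; exact: horizontal_bound.
  rewrite (sint_FTC da dk ck) subrr mulr0 expR0 mulr1 gerBl.
  by apply: mulr_ge0; [apply: mulr_ge0 => //; rewrite divr_ge0// ltW|exact: expR_ge0].
have h1 : `|sint (P ^~ rho) (- d) a| <= 2 / t * K.
  by apply: hP; [rewrite rr lexx|rewrite gtr0_norm].
have h2 : `|sint (P ^~ (- rho)) (- d) a| <= 2 / t * K.
  by apply: hP; [rewrite rr lexx|rewrite normrN gtr0_norm].
have h3 : `|sint (Q (- d)) (- rho) rho| <= 32 * m * expR (- (t * d)) / d * (rho - - rho).
  apply: le_norm_sint_cst => // y yi.
  apply: le_trans (PQle _ _).2 _; exact: vertical_bound.
have -> : sint (Q a) (- rho) rho =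
  sint (P ^~ rho) (- d) a + sint (Q (- d)) (- rho) rho - sint (P ^~ (- rho)) (- d) a.
  by rewrite -E addrAC subrr add0r.
apply: le_trans (ler_normB _ _) _; apply: le_trans (lerD (ler_normD _ _) (lexx _)) _.
apply: le_trans (lerD (lerD h1 h3) h2) _.
by rewrite le_eqVlt; apply/orP; left; apply/eqP; field; rewrite !gt_eqF.
Qed.

End Estimates.
End Contour.

(** * The Laplace transform seen by a functional *)

Section LaplaceRepresentation.
Context {R : realType} {X : completeNormedModType R[i]}.
Notation mu := (@lebesgue_measure R).
Notation borelR := (g_sigma_algebraType R.-ocitv.-measurable).
Implicit Types (a y t s rho : R).

Lemma seq_continuous_complex (p q : R -> R) : continuous p -> continuous q ->
  seq_continuous (fun t => (p t +i* q t : R[i]^o)).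
Proof.
move=> cp cq v t _ vt; apply/(@cvg_rnormP R R[i]^o).
have cpv : p (v n) @[n --> \oo] --> p t by apply: cvg_comp vt (cp t).
have cqv : q (v n) @[n --> \oo] --> q t by apply: cvg_comp vt (cq t).
apply: (@squeeze_cvgr _ _ _ _ (fun=> 0)
  (fun n => `|p t - p (v n)| + `|q t - q (v n)|)).
- apply: nearW => n; rewrite rnorm_ge0 rnorm_normc.
  exact: (normc_le_abs (p t - p (v n)) (q t - q (v n))).
- exact: cvg_cst.
- rewrite -[X in _ --> X]addr0 -(normr0 R); apply: cvgD; apply: cvg_norm.
    by rewrite -[X in _ --> X](subrr (p t)); apply: cvgB => //; exact: cvg_cst.
  by rewrite -[X in _ --> X](subrr (q t)); apply: cvgB => //; exact: cvg_cst.
Qed.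

Section Functional.
Variables (f : R -> X) (E : set R) (u : nat -> R -> X).
Hypothesis uf : approximable mu Rplus E u f.
Hypothesis f_exp : forall a, 0 < a ->
  mu.-integrable E (EFin \o (fun s => expR (- (a * s)) * rnorm (f s))).
Hypothesis f_loc : forall t, mu.-integrable (E `&` `[0, t]) (EFin \o (fun s => rnorm (f s))).
Variables (l : X -> R) (C : R).
Hypothesis ll : real_linear l.
Hypothesis lC : bounded_by C l.
Hypothesis C0 : 0 <= C.

Lemma laplace_linear (a y : R) : 0 < a ->
  l (laplace f (a +i* y)) =
  \int[mu]_(s in E) l (cexp (- ((a +i* y) * s%:C)) *: f s).
Proof.
move=> a0; pose m s := cexp (- ((a +i* y) * s%:C)).
have mc : seq_continuous (m : R -> R[i]^o).
  rewrite (_ : m = fun s => (expR (- (a * s)) * cos (y * s))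
     +i* (- (expR (- (a * s)) * sin (y * s)))).
    by apply: seq_continuous_complex => s; eapply is_derive_cont; deriv.
  by apply/funext => s; rewrite /m cexp_laplace.
have um := approximable_scale uf mc.
apply: (bochner_linear (@measurable_Rplus R) um _ C0 ll lC).
have := f_exp a0; apply: eq_integrable; first by case: uf.
move=> s _; rewrite /comp rnormZ /m.
rewrite (_ : - ((a +i* y) * s%:C) = (- (a * s)) +i* (- (y * s))) ?normc_cexp//.
by simpc.
Qed.

Lemma primitive_linear t :
  l (primitive f t) = \int[mu]_(s in E `&` `[0, t]) l (f s).
Proof.
have mt : @measurable _ borelR `[0, t] by exact: measurable_itv.
have sub : `[0, t] `<=` @Rplus R.
  by move=> s /=; rewrite in_itv/= RplusE => /andP[].
exact: (bochner_linear mt (approximable_restrict mt sub uf) (f_loc t) C0 ll lC).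
Qed.

End Functional.

(** The imaginary part of the quantity of which [skern_integrand] is the real
    part, see [contour_weight_line]; being odd in [y] it integrates to 0. *)
Definition skern_im a rho v y : R :=
  bump (y / rho) *
  (expR (a * v) * (a * sin (y * v) - y * cos (y * v)) / (a ^+ 2 + y ^+ 2)).

Lemma cont_skern_im a rho v x y : 0 < a -> cont_on (skern_im a rho v) x y.
Proof.
move=> a0 z _; have D0 : a ^+ 2 + z ^+ 2 != 0.
  by rewrite gt_eqF// ltr_wpDr ?sqr_ge0// exprn_gt0.
by rewrite /skern_im /bump; eapply is_derive_cont; deriv.
Qed.

Lemma sint_skern_im a rho v : 0 < a -> 0 < rho -> sint (skern_im a rho v) (- rho) rho = 0.
Proof.
move=> a0 r0; have cI x y := @cont_skern_im a rho v x y a0.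
have odd y : skern_im a rho v (- y) = - skern_im a rho v y.
  by rewrite /skern_im /bump !mulNr sinN cosN !sqrrN; ring.
rewrite (@sint_split _ _ _ _ 0) ?oppr_le0 ?(ltW r0)//.
suff -> : sint (skern_im a rho v) (- rho) 0 = sint (fun y => - skern_im a rho v y) 0 rho.
  have cN : cont_on (fun y => - skern_im a rho v y) 0 rho.
    by move=> x xi; apply: cvgN; exact: (cI 0 rho).
  rewrite -(sintD cN (cI 0 rho)).
  rewrite (@eq_sint _ _ (fun=> 0)); first by rewrite sint_cst ?mul0r// ltW.
  by move=> y _; rewrite addNr.
have r0' : 0 <= rho by exact: ltW.
rewrite /sint /Rintegral; congr fine.
have := @integration_by_substitution_oppr R (skern_im a rho v) 0 rho r0'.
rewrite oppr0 => ->; last by apply: cont_on_within.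
by apply: eq_integral => y _; rewrite /= odd.
Qed.

Lemma contour_weight_line t a rho y s : 0 < a ->
  contour_weight t a rho (a +i* y) * cexp (- ((a +i* y) * s%:C)) =
  skern_integrand a rho (t - s) y +i* skern_im a rho (t - s) y.
Proof.
move=> a0; have D0 : a ^+ 2 + y ^+ 2 != 0.
  by rewrite gt_eqF// ltr_wpDr ?sqr_ge0// exprn_gt0.
have cE : cutoff a rho (a +i* y) = (bump (y / rho))%:C.
  rewrite /cutoff /bump.
  have -> : (a +i* y - a%:C) * rho^-1%:C = 0 +i* (y / rho).
    by apply/eqP; rewrite eq_complex/=; apply/andP; split; apply/eqP; ring.
  by apply/eqP; rewrite eq_complex/=; apply/andP; split; apply/eqP; ring.
rewrite /contour_weight cE mulrC !mulrA -cexpD.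
have -> : - ((a +i* y) * s%:C) + t%:C * (a +i* y) = (a * (t - s)) +i* (y * (t - s)).
  by apply/eqP; rewrite eq_complex/=; apply/andP; split; apply/eqP; ring.
have -> : (a +i* y)^-1 = (a / (a ^+ 2 + y ^+ 2)) +i* (- y / (a ^+ 2 + y ^+ 2)).
  by rewrite /GRing.inv/= mulNr.
rewrite /skern_integrand /skern_im.
by apply/eqP; rewrite eq_complex/=; apply/andP; split; apply/eqP; field.
Qed.

End LaplaceRepresentation.

(** * Exchanging the two integrations *)

Section Fubini.
Context {R : realType}.
Notation mu := (@lebesgue_measure R).
Notation borelR := (g_sigma_algebraType R.-ocitv.-measurable).

Lemma sint_fubini (G : R -> R -> R) (b : R -> R) (E : set R) x1 x2 : x1 <= x2 ->
  @measurable _ borelR E ->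
  @measurable_fun _ _ (borelR * borelR)%type borelR (`[x1, x2] `*` E) (fun z => G z.1 z.2) ->
  (forall y s, x1 <= y <= x2 -> E s -> `|G y s| <= b s) ->
  mu.-integrable E (EFin \o b) ->
  sint (fun y => \int[mu]_(s in E) G y s) x1 x2 =
  \int[mu]_(s in E) sint (G ^~ s) x1 x2.
Proof.
move=> x12 mE mG Gb ib.
have mI : @measurable _ borelR `[x1, x2] by exact: measurable_itv.
have mIE : @measurable _ (borelR * borelR)%type (`[x1, x2] `*` E) by exact: measurableX.
pose f := (fun z : borelR * borelR => (G z.1 z.2)%:E) \_ (`[x1, x2] `*` E).
have mf : measurable_fun setT f.
  by apply/(measurable_restrictT _ _).1 => //; exact/measurable_EFinP.
have fE y s : y \in `[x1, x2] -> E s -> f (y, s) = (G y s)%:E.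
  by move=> yI Es; rewrite /f patchE mem_set.
have f0 y s : y \notin `[x1, x2] \/ ~ E s -> f (y, s) = 0%E.
  by move=> h; rewrite /f patchE memNset//= => -[yI Es]; case: h => // /negP.
have intE y : y \in `[x1, x2] ->
    (\int[mu]_s f (y, s) = \int[mu]_(s in E) (G y s)%:E)%E.
  move=> yI; rewrite [RHS]integral_mkcond; apply: eq_integral => s _.
  rewrite /patch; case: ifPn => [/set_mem Es|/negP nE]; first exact: fE.
  by apply: f0; right; move=> Es; apply: nE; exact: mem_set.
have fb y s : (`|f (y, s)| <= if s \in E then (b s)%:E else 0)%E.
  case: ifPn => [/set_mem Es|/negP nE]; last first.
    by rewrite f0 ?abse0//; right=> Es; apply: nE; exact: mem_set.
  have [yI|yI] := boolP (y \in `[x1, x2]); first by rewrite fE// lee_fin Gb// -in_itv.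
  rewrite f0 ?abse0; last by left.
  by rewrite lee_fin (le_trans _ (Gb x1 s _ Es))// lexx.
have mf1 y : measurable_fun setT (fun s => f (y, s)) by exact: measurable_fun_pair2.
have mf2 s : measurable_fun setT (fun y => f (y, s)) by exact: measurable_fun_pair1.
have f0I y s : y \notin `[x1, x2] -> f (y, s) = 0%E by move=> yI; apply: f0; left.
have absE y : (\int[mu]_s `|f (y, s)| <= \int[mu]_(s in E) (b s)%:E)%E.
  rewrite [leRHS]integral_mkcond; apply: le_lower_integral => s _; first exact: abse_ge0.
  by rewrite /patch; exact: fb.
have bfin : (\int[mu]_(s in E) (b s)%:E \is a fin_num)%E by exact: integrable_fin_num ib.
have fin1 y : (\int[mu]_s f (y, s) \is a fin_num)%E.
  apply: integrable_fin_num => //; apply/integrableP; split; first exact: mf1.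
  apply: le_lt_trans (absE y) _; rewrite -ge0_fin_numE//.
  by apply: le_trans (absE y); apply: integral_ge0 => s _; exact: abse_ge0.
have fin2 s : (\int[mu]_y f (y, s) \is a fin_num)%E.
  apply: integrable_fin_num => //; apply/integrableP; split; first exact: mf2.
  apply: (@le_lt_trans _ _ (\int[mu]_(y in `[x1, x2]) cst (if s \in E then (b s)%:E else 0%E) y)%E).
    rewrite [leRHS]integral_mkcond; apply: le_lower_integral => y _; first exact: abse_ge0.
    rewrite /patch; case: ifPn => [_|/negP yI]; first exact: fb.
    by rewrite f0I ?abse0//; apply/negP => h; apply: yI; exact: mem_set.
  rewrite integral_cst//= lebesgue_measure_itv/=.
  by case: ifP => _; case: ifP => _; rewrite ?mule0 ?mul0e ?ltry// -EFinB -EFinM ltry.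
have intI s : s \in E ->
    (\int[mu]_y f (y, s) = \int[mu]_(y in `[x1, x2]) (G y s)%:E)%E.
  move=> /set_mem Es; rewrite [RHS]integral_mkcond; apply: eq_integral => y _.
  rewrite patchE; case: ifPn => [/set_mem yI|/negP nE]; first exact: fE.
  by apply: f0I; apply/negP => yI; apply: nE; exact: mem_set.
have intf : (mu \x mu)%E.-integrable setT f.
  apply/integrable12ltyP => //.
  apply: (@le_lt_trans _ _ (\int[mu]_(y in `[x1, x2]) cst (\int[mu]_(s in E) (b s)%:E) y)%E).
    rewrite [leRHS]integral_mkcond; apply: le_lower_integral => y _.
      by apply: integral_ge0 => s _; exact: abse_ge0.
    rewrite /patch; case: ifPn => [_|/negP yI]; first exact: absE.
    rewrite integral0_eq// => s _; rewrite f0I ?abse0//.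
    by apply/negP => h; apply: yI; exact: mem_set.
  rewrite integral_cst//= lebesgue_measure_itv/= -(fineK bfin).
  by case: ifP => _; rewrite ?mule0 ?ltry// -EFinB -EFinM ltry.
rewrite /sint /Rintegral; congr fine.
transitivity (\int[mu]_y \int[mu]_s f (y, s))%E.
  rewrite [LHS]integral_mkcond; apply: eq_integral => y _.
  rewrite patchE; case: ifPn => [/set_mem yI|/negP nE].
    by rewrite -intE// fineK.
  rewrite integral0_eq// => s _; apply: f0I; apply/negP => yI; apply: nE; exact: mem_set.
rewrite Fubini// [RHS]integral_mkcond; apply: eq_integral => s _.
rewrite patchE; case: ifPn => [Es|/negP nE]; first by rewrite -intI// fineK.
rewrite integral0_eq// => y _; apply: f0; right=> Es; apply: nE; exact: mem_set.
Qed.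
End Fubini.

(** * The primitive as a smoothed contour integral *)

Section Representation.
Context {R : realType} {X : completeNormedModType R[i]}.
Notation mu := (@lebesgue_measure R).
Notation borelR := (g_sigma_algebraType R.-ocitv.-measurable).
Implicit Types (a y t s rho : R).

Lemma normc_contour_weight t a rho y s : 0 < a -> - rho <= y <= rho -> 0 < rho ->
  normc (contour_weight t a rho (a +i* y) * cexp (- ((a +i* y) * s%:C))) <=
  expR (a * t) / a * expR (- (a * s)).
Proof.
move=> a0 yi r0; rewrite normcM.
have -> : - ((a +i* y) * s%:C) = - (a * s) +i* (- (y * s)) by simpc.
rewrite normc_cexp ler_wpM2r ?expR_ge0// /contour_weight.
have -> : t%:C * (a +i* y) = (a * t) +i* (y * t).
  by apply/eqP; rewrite eq_complex/=; apply/andP; split; apply/eqP; ring.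
rewrite (normcM (_ * cutoff _ _ _)) (normcM (cexp _)) normc_cexp.
have hc : normc (cutoff a rho (a +i* y)) <= 1.
  rewrite -(expr1n _ 2); apply: normc_cutoff => //.
  rewrite subrr mul0r normr0 mul0r mulr0 addr0 expr0n/= addr0.
  have yr1 : `|y / rho| <= 1.
    by rewrite normrM normfV (gtr0_norm r0) ler_pdivrMr// mul1r ler_norml.
  have [p0 p1] : 0 <= (y / rho) ^+ 2 /\ (y / rho) ^+ 2 <= 1.
    by rewrite sqr_ge0 -real_normK ?num_real// expr_le1.
  by rewrite ger0_norm; lra.
have hv : normc (a +i* y)^-1 <= a^-1.
  have [h _] := abs_le_normc a y; rewrite (gtr0_norm a0) in h.
  by rewrite normcV lef_pV2// posrE//; exact: lt_le_trans h.
have e0 := expR_ge0 (a * t).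
apply: ler_pM hv; [|exact: normc_ge0|].
  by rewrite mulr_ge0// normc_ge0.
by rewrite -[leRHS]mulr1 ler_wpM2l.
Qed.

Lemma measurable_contour_kernel t rho a : 0 < a ->
  @measurable_fun _ _ (borelR * borelR)%type borelR setT
    (fun z => skern_integrand a rho (t - z.2) z.1) /\
  @measurable_fun _ _ (borelR * borelR)%type borelR setT
    (fun z => skern_im a rho (t - z.2) z.1).
Proof.
move=> a0.
have mC (h : R -> R) (g : borelR * borelR -> R) : continuous h ->
    measurable_fun setT g -> measurable_fun setT (fun z => h (g z)).
  by move=> ch mg; exact: measurableT_comp (continuous_measurable_fun ch) mg.
have my : @measurable_fun _ _ (borelR * borelR)%type borelR setT (fun z => z.1).
  exact: measurable_fst.
have mv : @measurable_fun _ _ (borelR * borelR)%type borelR setT (fun z => t - z.2).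
  by apply: measurable_funB; [exact: measurable_cst|exact: measurable_snd].
have myv := measurable_funM my mv.
have mh : @measurable_fun _ _ (borelR * borelR)%type borelR setT
    (fun z => bump (z.1 / rho) / (a ^+ 2 + z.1 ^+ 2)).
  apply: (mC (fun y => bump (y / rho) / (a ^+ 2 + y ^+ 2)) _ _ my) => y.
  have D0 : a ^+ 2 + y ^+ 2 != 0 by rewrite gt_eqF// ltr_wpDr ?sqr_ge0// exprn_gt0.
  by rewrite /bump; eapply is_derive_cont; deriv.
have me : @measurable_fun _ _ (borelR * borelR)%type borelR setT
    (fun z => expR (a * (t - z.2))).
  by apply: (mC (fun v => expR (a * v)) _ _ mv) => v; eapply is_derive_cont; deriv.
have mc := mC cos _ (@continuous_cos R) myv.
have ms := mC sin _ (@continuous_sin R) myv.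
have mcst : @measurable_fun _ _ (borelR * borelR)%type borelR setT (fun=> a).
  exact: measurable_cst.
split.
  rewrite (_ : (fun z => _) = (fun z => bump (z.1 / rho) / (a ^+ 2 + z.1 ^+ 2) *
    (expR (a * (t - z.2)) * (a * cos (z.1 * (t - z.2)) + z.1 * sin (z.1 * (t - z.2)))))).
    apply: measurable_funM mh _; apply: measurable_funM me _.
    by apply: measurable_funD; [exact: measurable_funM mcst mc|exact: measurable_funM my ms].
  by apply/funext => z; rewrite /skern_integrand; ring.
rewrite (_ : (fun z => _) = (fun z => bump (z.1 / rho) / (a ^+ 2 + z.1 ^+ 2) *
  (expR (a * (t - z.2)) * (a * sin (z.1 * (t - z.2)) - z.1 * cos (z.1 * (t - z.2)))))).
  apply: measurable_funM mh _; apply: measurable_funM me _.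
  by apply: measurable_funB; [exact: measurable_funM mcst ms|exact: measurable_funM my mc].
by apply/funext => z; rewrite /skern_im; ring.
Qed.

Section Functional.
Variables (f : R -> X) (E : set R) (u : nat -> R -> X).
Hypothesis uf : approximable mu Rplus E u f.
Hypothesis f_exp : forall a, 0 < a ->
  mu.-integrable E (EFin \o (fun s => expR (- (a * s)) * rnorm (f s))).
Hypothesis f_loc : forall t, mu.-integrable (E `&` `[0, t]) (EFin \o (fun s => rnorm (f s))).
Variable l : X -> R.
Hypothesis ll : real_linear l.
Hypothesis l1 : bounded_by 1 l.

Let mE : @measurable _ borelR E.
Proof. by case: uf. Qed.

Lemma measurable_functional c : @measurable_fun _ _ borelR _ E (fun s => l (c *: f s)).
Proof.
exact: (approximable_measurable uf (real_linear_lipschitz (real_linear_scale c ll)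
  (bounded_by_scale c l1))).
Qed.

Lemma measurable_functional1 : @measurable_fun _ _ borelR _ E (fun s => l (f s)).
Proof. by under eq_fun do rewrite -[f _]scale1r; exact: measurable_functional. Qed.

Lemma sint_contour_cst x t a rho : 0 < a -> 0 < rho ->
  sint (fun y => l (contour_weight t a rho (a +i* y) *: x)) (- rho) rho =
  skern a rho t * l x /\
  cont_on (fun y => l (contour_weight t a rho (a +i* y) *: x)) (- rho) rho.
Proof.
move=> a0 r0.
have E0 y : l (contour_weight t a rho (a +i* y) *: x) =
    l x * skern_integrand a rho t y + l ('i *: x) * skern_im a rho t y.
  rewrite mulrC [l ('i *: x) * _]mulrC -real_linear_complex//.
  rewrite -[in RHS](subr0 t) -contour_weight_line//.
  rewrite cexp_laplace !mulr0 oppr0 expR0 cos0 sin0 mulr1 mulr0 oppr0.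
  by rewrite (mulr1 (contour_weight _ _ _ _)).
have cA := @cont_skern_integrand R a rho t (- rho) rho a0.
have cB := @cont_skern_im R a rho t (- rho) rho a0.
have cA' : cont_on (fun y => l x * skern_integrand a rho t y) (- rho) rho.
  by apply: cont_onM => //; exact: cont_on_cst.
have cB' : cont_on (fun y => l ('i *: x) * skern_im a rho t y) (- rho) rho.
  by apply: cont_onM => //; exact: cont_on_cst.
split; last by under eq_fun do rewrite E0; exact: cont_onD.
under eq_sint do rewrite E0.
rewrite (sintD cA' cB') (sintZ _ cA) (sintZ _ cB) sint_skern_im// mulr0 addr0.
by rewrite mulrC.
Qed.

Lemma sint_contour_laplace t a rho : 0 < a -> 0 < rho ->
  sint (fun y => l (contour_weight t a rho (a +i* y) *: laplace f (a +i* y))) (- rho) rho =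
  \int[mu]_(s in E) (l (f s) * skern a rho (t - s)).
Proof.
move=> a0 r0.
pose G y s := l ((contour_weight t a rho (a +i* y) * cexp (- ((a +i* y) * s%:C))) *: f s).
have GE y s : G y s = l (f s) * skern_integrand a rho (t - s) y
    + l ('i *: f s) * skern_im a rho (t - s) y.
  by rewrite /G contour_weight_line// real_linear_complex// mulrC [X in _ + X]mulrC.
transitivity (sint (fun y => \int[mu]_(s in E) G y s) (- rho) rho).
  apply: eq_sint => y _.
  set c := contour_weight t a rho (a +i* y).
  have C0 : 0 <= 1 * normc c by rewrite mul1r normc_ge0.
  rewrite (laplace_linear uf f_exp (real_linear_scale c ll) (bounded_by_scale c l1) C0)//.
  by apply: eq_Rintegral => s _; rewrite scalerA.
rewrite (@sint_fubini _ _
  (fun s => expR (a * t) / a * (expR (- (a * s)) * rnorm (f s))))//; first last.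
- rewrite (_ : _ \o _ = (fun s => (expR (a * t) / a)%:E *
    (expR (- (a * s)) * rnorm (f s))%:E)%E)//.
  by apply: integrableZl => //; exact: f_exp.
- move=> y s yi _; apply: (le_trans (l1 _)); rewrite mul1r rnormZ mulrA.
  by rewrite ler_wpM2r ?rnorm_ge0// normc_contour_weight.
- rewrite (_ : (fun z => _) = (fun z => l (f z.2) * skern_integrand a rho (t - z.2) z.1
      + l ('i *: f z.2) * skern_im a rho (t - z.2) z.1)); last first.
    by apply/funext => z; exact: GE.
  have m2 (h : R -> R) : @measurable_fun _ _ borelR borelR E h ->
      @measurable_fun _ _ (borelR * borelR)%type borelR (`[- rho, rho] `*` E) (fun z => h z.2).
    move=> mh; apply: (measurable_comp mE _ mh).
      by move=> _ [z [_ Ez] <-].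
    by apply: measurable_funTS; exact: measurable_snd.
  have [mA mB] := measurable_contour_kernel t rho a0.
  apply: measurable_funD; apply: measurable_funM.
  + apply: (m2 (fun s => l (f s))); exact: measurable_functional1.
  + exact: measurable_funTS.
  + apply: (m2 (fun s => l ('i *: f s))); exact: measurable_functional.
  + exact: measurable_funTS.
- lra.
apply: eq_Rintegral => s _.
have cA := @cont_skern_integrand R a rho (t - s) (- rho) rho a0.
have cB := @cont_skern_im R a rho (t - s) (- rho) rho a0.
have cA' : cont_on (fun y => l (f s) * skern_integrand a rho (t - s) y) (- rho) rho.
  by apply: cont_onM => //; exact: cont_on_cst.
have cB' : cont_on (fun y => l ('i *: f s) * skern_im a rho (t - s) y) (- rho) rho.
  by apply: cont_onM => //; exact: cont_on_cst.
under eq_sint do rewrite GE.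
by rewrite (sintD cA' cB') (sintZ _ cA) (sintZ _ cB) sint_skern_im// mulr0 addr0.
Qed.

Variable F : R[i] -> X.

(** Inserting the Laplace integral for [F] and exchanging the integrals leaves
    for each [s] the inner integral [skern a rho (t - s)]. *)
Lemma contour_identity t a rho : 0 < a -> 0 < rho ->
  (forall y, - rho <= y <= rho -> cdiff_at F (a +i* y)) ->
  (forall y, F (a +i* y) = laplace f (a +i* y)) ->
  sint (fun y => l (contour_fun F t a rho (a +i* y))) (- rho) rho =
  skern a rho t * l (F 0) - \int[mu]_(s in E) (l (f s) * skern a rho (t - s)).
Proof.
move=> a0 r0 dF Ff; have [<- c0] := sint_contour_cst (F 0) t a0 r0.
have cJ : cont_on (fun y => l (contour_fun F t a rho (a +i* y))) (- rho) rho.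
  move=> y yi; apply: (@closed_at_contr _ (fun x y => l (- 'i *: contour_fun F t a rho (x +i* y)))
    (fun x y => l (contour_fun F t a rho (x +i* y)))).
  apply: (cdiff_closed ll l1 ler01); apply: cdiff_contour; last exact: dF.
  by rewrite eq_complex/= negb_and gt_eqF.
rewrite -sint_contour_laplace//.
rewrite (_ : sint (fun y => l (_ *: laplace f _)) _ _ =
  sint (fun y => l (contour_weight t a rho (a +i* y) *: F 0)) (- rho) rho -
  sint (fun y => l (contour_fun F t a rho (a +i* y))) (- rho) rho); first ring.
rewrite -(sintB c0 cJ); apply: eq_sint => y _.
rewrite -real_linearB// /contour_fun -scalerBr -Ff; congr (l (_ *: _)).
by rewrite opprB addrC subrK.
Qed.

End Functional.
End Representation.

(** * The remainder seen through the smoothing kernel *)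

Section Pointwise.
Context {R : realType} {X : completeNormedModType R[i]}.
Notation mu := (@lebesgue_measure R).
Notation borelR := (g_sigma_algebraType R.-ocitv.-measurable).
Implicit Types (a y t s rho B : R).
Variables (f : R -> X) (E : set R) (u : nat -> R -> X).
Hypothesis uf : approximable mu Rplus E u f.
Hypothesis f_exp : forall a, 0 < a ->
  mu.-integrable E (EFin \o (fun s => expR (- (a * s)) * rnorm (f s))).

Let mE : @measurable _ borelR E.
Proof. by case: uf. Qed.

Let E0 s : E s -> 0 <= s.
Proof. by case: uf => _ ED _ _ _ /ED; rewrite RplusE. Qed.

(** [f] itself need not be integrable; the kernels provide the exponential. *)
Lemma integrable_exp_bound (D : set R) (k : R -> R) a K : 0 < a ->
  @measurable _ borelR D -> D `<=` E -> @measurable_fun _ _ borelR borelR D k ->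
  (forall s, D s -> `|k s| <= K * (expR (- (a * s)) * rnorm (f s))) ->
  mu.-integrable D (EFin \o k).
Proof.
move=> a0 mD DE mk kK.
apply: (@le_integrable _ _ _ mu D mD _
  (fun s => K%:E * (expR (- (a * s)) * rnorm (f s))%:E)%E).
- exact/measurable_EFinP.
- move=> s Ds; rewrite /= lee_fin; apply: le_trans (kK _ Ds) _.
  exact: ler_norm.
- apply: integrableZl => //; apply: integrableS (f_exp a0) => //.
Qed.

Lemma locally_integrable t :
  mu.-integrable (E `&` `[0, t]) (EFin \o (fun s => rnorm (f s))).
Proof.
have mI : @measurable _ borelR `[0, t] by exact: measurable_itv.
apply: (@integrable_exp_bound _ _ 1 (expR t)) => //.
- exact: measurableI.
- by apply: measurable_funS (approximable_norm_measurable uf) => //.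
move=> s [_ /=]; rewrite in_itv/= => /andP[_ st].
rewrite ger0_norm ?rnorm_ge0// mulrA -expRD mul1r -[leLHS]mul1r.
rewrite ler_wpM2r ?rnorm_ge0// -expR0 ler_expR; lra.
Qed.

Variable C : R.
Hypothesis C0 : 0 < C.
Hypothesis kern_C : forall rho u, 0 < rho ->
  `|kern rho u| <= C * (rho / (1 + rho * `|u|) ^+ 3).

Let K := C / 2 * expR 1.

Let sq_le rho v : 0 < rho -> 0 <= v -> rho / (1 + rho * v) ^+ 2 <= ck rho v.
Proof.
move=> r0 v0; have rv : 0 <= rho * v by rewrite mulr_ge0// ltW.
rewrite /ck ler_pM2l// lef_pV2 ?posrE ?exprn_gt0 ?ltr_pwDl ?sqr_ge0//.
have := sqr_ge0 (rho * v); nra.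
Qed.

(** How far [skern] is from a multiple of the step function: [skern_right]
    before time [t] and [skern_left] after it. *)
Lemma step_defect a rho s t : 0 < a -> 0 < rho -> 0 <= s -> a * t = 1 ->
  rho * `|skern a rho (t - s) - \1_`[0, t] s * skern a rho t| <= K * ck rho (t - s).
Proof.
move=> a0 r0 s0 at1; have Cpos := C0; have e1 : 1 <= expR 1 :> R.
  by have := @expR_ge1Dx R 1; lra.
have ckn : ck rho (t - s) = ck rho `|t - s|.
  by rewrite /ck !exprMn real_normK ?num_real.
have [st|ts] := leP s t.
  rewrite indicE mem_set ?mul1r; last by rewrite /= in_itv/= s0.
  have ts0 : 0 <= t - s by rewrite subr_ge0.
  rewrite distrC ckn (ger0_norm ts0).
  apply: (@le_trans _ _ (K * (rho / (1 + rho * (t - s)) ^+ 2))); last first.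
    by rewrite ler_wpM2l ?sq_le// /K mulr_ge0 ?expR_ge0// divr_ge0// ltW.
  rewrite mulrCA ler_pM2l//.
  by apply: (skern_right C0 kern_C) => //; [lra|rewrite at1].
rewrite indicE memNset ?mul0r ?subr0; last first.
  by rewrite /= in_itv/= => /andP[_]; rewrite leNgt ts.
apply: (@le_trans _ _ (K * (rho / (1 + rho * `|t - s|) ^+ 2))); last first.
  by rewrite ckn ler_wpM2l ?sq_le// /K mulr_ge0 ?expR_ge0// divr_ge0// ltW.
rewrite mulrCA ler_pM2l//; apply: le_trans (skern_left C0 kern_C a0 r0 _) _; first lra.
rewrite ler_wpM2r ?invr_ge0 ?sqr_ge0// /K -[leLHS]mulr1 ler_wpM2l//.
by rewrite divr_ge0// ltW.
Qed.

Variables (F : R[i] -> X).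

(** [skern a rho t * l (F 0)] occurs in [contour_identity]; subtracting the same
    multiple of [l (primitive f t)] turns the other term into the integral of
    [l (f s)] against the defect of [step_defect]. *)
Lemma primitive_estimate t a rho B : 0 < t -> a * t = 1 -> 0 < rho ->
  2 + 4 * (2 * C * expR 1 + C / 2) <= rho * t ->
  (forall y, - rho <= y <= rho -> cdiff_at F (a +i* y)) ->
  (forall y, F (a +i* y) = laplace f (a +i* y)) ->
  (forall l, real_linear l -> bounded_by 1 l ->
    `|sint (fun y => l (contour_fun F t a rho (a +i* y))) (- rho) rho| <= B) ->
  ((rho * rnorm (F 0%R - primitive f t)%R)%:E <=
   (4 * (rho * B))%:E + (4 * K)%:E *
     \int[mu]_(s in E) (rnorm (f s) * ck rho (t - s))%:E)%E.
Proof.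
move=> t0 at1 r0 rt dF Ff hB; have a0 : 0 < a by rewrite -(pmulr_lgt0 _ t0) at1.
have [l [ll l1 lg]] := hahn_banach_norming (F 0 - primitive f t).
have := hB _ ll l1; set J := sint _ _ _ => JB.
have JE : J = skern a rho t * l (F 0) - \int[mu]_(s in E) (l (f s) * skern a rho (t - s)).
  exact: (contour_identity uf f_exp ll l1).
have V4 := skern_lb C0 kern_C t0 at1 rt.
set V := skern a rho t in JE V4 *.
have mlf := measurable_functional1 uf ll l1.
have mI : @measurable _ borelR `[0, t] by exact: measurable_itv.
have lPE : l (primitive f t) = \int[mu]_(s in E) (l (f s) * \1_`[0, t] s).
  rewrite (primitive_linear uf locally_integrable ll l1 ler01) Rintegral_mkcondr.
  apply: eq_Rintegral => s _; rewrite /patch indicE.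
  by case: ifP => _; rewrite ?mulr1 ?mulr0.
have i1 : mu.-integrable E (EFin \o (fun s => l (f s) * skern a rho (t - s))).
  apply: (@integrable_exp_bound _ _ a (expR (a * t) * ((a + rho) / a ^+ 2 * (2 * rho)))) => //.
    apply: measurable_funM => //; apply: measurable_funTS.
    apply: continuous_measurable_fun => s.
    apply: (@continuous_comp _ _ _ (fun s => t - s) (skern a rho)).
      by eapply is_derive_cont; deriv.
    exact: is_derive_cont (skern_deriv _ a0 r0).
  move=> s Es; rewrite normrM mulrC mulrA.
  apply: ler_pM; rewrite ?normr_ge0//; last by have := l1 (f s); rewrite mul1r.
  apply: (le_trans (skern_bound _ a0 r0)).
  by rewrite mulrBr expRD [leRHS]mulrAC.
have i2 : mu.-integrable E (EFin \o (fun s => l (f s) * \1_`[0, t] s)).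
  apply: (@integrable_exp_bound _ _ 1 (expR t)) => //.
    by apply: measurable_funM => //; exact: measurable_indic.
  move=> s Es; rewrite normrM mulrA -expRD mulrC; apply: ler_pM; rewrite ?normr_ge0//.
    rewrite indicE; case: (boolP (_ \in _)) => [/set_mem|_]; last by rewrite normr0 expR_ge0.
    rewrite /= in_itv/= => /andP[_ st].
    by rewrite normr1 mul1r -expR0 ler_expR; lra.
  by have := l1 (f s); rewrite mul1r.
have i2' : mu.-integrable E (EFin \o (fun s => V * (l (f s) * \1_`[0, t] s))).
  rewrite (_ : _ \o _ = (fun s => V%:E * (l (f s) * \1_`[0, t] s)%:E)%E)//.
  exact: integrableZl.
pose h s := l (f s) * skern a rho (t - s) - V * (l (f s) * \1_`[0, t] s).
have ih : mu.-integrable E (EFin \o h).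
  rewrite (_ : _ \o _ = (fun s => (l (f s) * skern a rho (t - s))%:E -
    (V * (l (f s) * \1_`[0, t] s))%:E)%E)//; exact: integrableB.
have VE : V * l (F 0 - primitive f t) = J + \int[mu]_(s in E) h s.
  rewrite real_linearB// mulrBr lPE JE /h RintegralB// -RintegralZl//; ring.
have hle s : E s -> rho * `|h s| <= K * (rnorm (f s) * ck rho (t - s)).
  move=> Es; have := step_defect a0 r0 (E0 Es) at1; rewrite -/V => sd.
  rewrite (_ : h s = l (f s) * (skern a rho (t - s) - \1_`[0, t] s * V)); last first.
    by rewrite /h; ring.
  rewrite normrM mulrCA [leRHS]mulrCA; apply: ler_pM => //.
    by rewrite mulr_ge0 ?normr_ge0// ltW.
  by have := l1 (f s); rewrite mul1r.
have K0 : 0 < K by rewrite /K mulr_gt0 ?expR_gt0// divr_gt0.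
have mck : @measurable_fun _ _ borelR borelR E (fun s => rnorm (f s) * ck rho (t - s)).
  apply: measurable_funM; first exact: (approximable_norm_measurable uf).
  apply: measurable_funTS; apply: continuous_measurable_fun => s.
  under eq_fun do rewrite -ckN opprB; exact: continuous_ck.
have hint : ((rho * `|\int[mu]_(s in E) h s|)%:E <=
    K%:E * \int[mu]_(s in E) (rnorm (f s) * ck rho (t - s))%:E)%E.
  rewrite EFinM EFin_normr_Rintegral//.
  apply: (@le_trans _ _ (rho%:E * \int[mu]_(s in E) `|(h s)%:E|)%E).
    by rewrite lee_pmul2l// le_abse_integral//; case/integrableP: ih.
  have r0' : (0 <= rho%:E)%E by rewrite lee_fin ltW.
  have K0' : (0 <= K%:E)%E by rewrite lee_fin ltW.
  have mh : measurable_fun E (fun s => `|(h s)%:E|%E).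
    by apply: measurableT_comp => //; case/integrableP: ih.
  have mck' : measurable_fun E (fun s => (rnorm (f s) * ck rho (t - s))%:E).
    exact/measurable_EFinP.
  have ck0 s : E s -> (0 <= (rnorm (f s) * ck rho (t - s))%:E)%E.
    by move=> _; rewrite lee_fin mulr_ge0 ?rnorm_ge0// ck_ge0// ltW.
  rewrite -ge0_integralZl//; try exact: mh.
  rewrite -ge0_integralZl//; try exact: mck'.
  apply: le_lower_integral => s Es; first by rewrite mule_ge0// lee_fin ltW.
  by rewrite /= -!EFinM lee_fin hle.
apply: (@le_trans _ _ ((4 * (rho * B))%:E + 4%:E * (rho * `|\int[mu]_(s in E) h s|)%:E)%E).
  rewrite -EFinM -EFinD lee_fin -lg.
  have lg0 : 0 <= l (F 0 - primitive f t) by rewrite lg rnorm_ge0.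
  have : 1 / 4 * l (F 0 - primitive f t) <= B + `|\int[mu]_(s in E) h s|.
    apply: (@le_trans _ _ (V * l (F 0 - primitive f t))); first exact: ler_wpM2r.
    rewrite VE; apply: lerD; [exact: le_trans (ler_norm _) JB|exact: ler_norm].
  by move=> /(ler_wpM2l (ltW r0)); lra.
by rewrite leeD2l// [(4 * K)%:E]EFinM -muleA lee_pmul2l.
Qed.

End Pointwise.

(** * Continuity of the primitive *)

Section Primitive.
Context {R : realType} {X : completeNormedModType R[i]}.
Notation mu := (@lebesgue_measure R).
Notation borelR := (g_sigma_algebraType R.-ocitv.-measurable).
Implicit Types (a y t s : R).
Variables (f : R -> X) (E : set R) (u : nat -> R -> X).
Hypothesis uf : approximable mu Rplus E u f.
Hypothesis f_exp : forall a, 0 < a ->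
  mu.-integrable E (EFin \o (fun s => expR (- (a * s)) * rnorm (f s))).

Let mE : @measurable _ borelR E.
Proof. by case: uf. Qed.

Let mEt t : @measurable _ borelR (E `&` `[0, t]).
Proof. by apply: measurableI => //; exact: measurable_itv. Qed.

(** The starting point is negative so that the variation is continuous at 0
    from both sides. *)
Definition variation t : R := \int[mu]_(s in `[-1, t]) ((fun s => rnorm (f s)) \_ E) s.

Let inf_t t := locally_integrable uf f_exp t.

Let itv_domain t : `[-1, t] `&` E = E `&` `[0, t].
Proof.
have [_ ED _ _ _] := uf.
apply/seteqP; split=> s /=; rewrite !in_itv/=.
  by move=> [/andP[_ st] Es]; split=> //; rewrite st andbT -RplusE; exact: ED.
by move=> [Es /andP[s0 st]]; split=> //; rewrite st andbT; lra.
Qed.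

Lemma variationE t : variation t = \int[mu]_(s in E `&` `[0, t]) rnorm (f s).
Proof.
by rewrite /variation -Rintegral_mkcondr itv_domain.
Qed.

Lemma variation_cont t : 0 <= t -> {for t, continuous variation}.
Proof.
move=> t0; have t1 : -1 <= t + 1 by lra.
have ab : -1 < t + 1 :> R by lra.
have it : mu.-integrable `[-1, t + 1] (EFin \o ((fun s => rnorm (f s)) \_ E)).
  have mI : @measurable _ borelR `[-1, t + 1] by exact: measurable_itv.
  rewrite -restrict_EFin; apply: (@integrable_restrict _ _ _ mu E mE _ mI _).1.
  rewrite (_ : _ `&` _ = E `&` `[0, t + 1]); first exact: inf_t.
  exact: itv_domain.
have := parameterized_integral_continuous t1 it.
move=> /(continuous_within_itvP _ ab)[+ _ _]; apply.
by rewrite in_itv/=; apply/andP; split; lra.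
Qed.

(** For a norming [l] the function [rnorm (f s) - l (f s)] is nonnegative, so its
    integral over [[0, t]] increases with [t]. *)
Lemma primitive_dist s t : 0 <= s -> s <= t ->
  rnorm (primitive f t - primitive f s) <= variation t - variation s.
Proof.
move=> s0 st; have [l [ll l1 <-]] := hahn_banach_norming (primitive f t - primitive f s).
pose n r := rnorm (f r).
have il r : mu.-integrable (E `&` `[0, r]) (EFin \o (fun s => l (f s))).
  apply: (le_integrable (mEt r) _ _ (inf_t r)).
    apply/measurable_EFinP; apply: measurable_funS (measurable_functional1 uf ll l1) => //.
  move=> x _; rewrite /= lee_fin (ger0_norm (rnorm_ge0 _)).
  by have := l1 (f x); rewrite mul1r.
have E1 r : \int[mu]_(s in E `&` `[0, r]) (n s - l (f s)) = variation r - l (primitive f r).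
  rewrite (RintegralB (mEt r) (inf_t r) (il r)).
  by rewrite variationE (primitive_linear uf (locally_integrable uf f_exp) ll l1 ler01).
rewrite real_linearB//.
suff : variation s - l (primitive f s) <= variation t - l (primitive f t).
  by rewrite -subr_ge0 => h; rewrite -subr_ge0 opprD addrACA -opprD.
have i2 r : mu.-integrable (E `&` `[0, r]) (EFin \o (fun s => n s - l (f s))).
  rewrite (_ : _ \o _ = (fun s => (n s)%:E - (l (f s))%:E)%E)//.
  by apply: integrableB => //; exact: inf_t.
rewrite -!E1 /Rintegral fine_le//; [exact: integrable_fin_num..|].
apply: ge0_subset_integral => //.
- by case/integrableP: (i2 t).
- move=> x _; rewrite lee_fin subr_ge0.
  by have := l1 (f x); rewrite mul1r; exact: le_trans (ler_norm _).
- move=> x /= [Ex]; rewrite !in_itv/= => /andP[x0 xs]; split=> //.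
  by rewrite x0 (le_trans xs).
Qed.

Lemma variation_nd s t : 0 <= s -> s <= t -> variation s <= variation t.
Proof.
by move=> s0 st; rewrite -subr_ge0 (le_trans _ (primitive_dist s0 st))// rnorm_ge0.
Qed.

Lemma primitive_seq_continuous : seq_continuous (primitive f).
Proof.
move=> v t v0 vt; apply/cvg_rnormP.
have t0 : 0 <= t 
  by apply: (@closed_cvg _ _ _ _ v (fun x => 0 <= x) (@closed_ge _ 0) _ t vt); exact: nearW.
have cP : variation (v n) @[n --> \oo] --> variation t.
  by apply: cvg_comp vt (variation_cont t0).
apply: (@squeeze_cvgr _ _ _ _ (fun=> 0)
  (fun n => `|variation t - variation (v n)|)).
- apply: nearW => n; rewrite rnorm_ge0/=.
  have [tn|/ltW tn] := leP (v n) t.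
    rewrite ger0_norm; first exact: primitive_dist.
    by rewrite subr_ge0 variation_nd.
  rewrite -rnormN opprB ler0_norm ?opprB; first exact: primitive_dist.
  by rewrite subr_le0 variation_nd.
- exact: cvg_cst.
- rewrite -(normr0 R); apply: cvg_norm.
  by rewrite -[X in _ --> X](subrr (variation t)); apply: cvgB => //; exact: cvg_cst.
Qed.

End Primitive.

(** * The weighted remainder *)

Section Numerics.
Context {R : realType}.
Implicit Types (A m rho t : R).

(** The choice of [t] turns [expR (- (t * d))], with [2 * m * d = 1], into
    [Q ^- 8] for [Q = (1 + m) * (1 + rho)]. Half of it absorbs [rho] and [m], and
    the other half is [O(t ^- 2)] because [t <= 16 * Q ^+ 2]. *)
Lemma contour_budget A m rho t d : 0 <= A -> 2 <= m -> 1 <= rho -> 0 < t -> 2 * m * d = 1 ->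
  t = 16 * (m * (ln (1 + m) + ln (1 + rho))) ->
  [/\ 2 <= t & rho * (4 / t * (A * m / (rho ^+ 3 * t ^+ 2)) +
    64 * rho * m * expR (- (t * d)) / d) <= (4 * A + 2 ^+ 15) / t ^+ 2].
Proof.
move=> A0 m2 r1 t0 md tE; have m0 : 0 < m by lra.
have r0 : 0 < rho by lra.
have d0 : 0 < d by rewrite -(pmulr_rgt0 _ (_ : 0 < 2 * m)) ?md; lra.
pose Q := (1 + m) * (1 + rho).
have Q0 : 0 < Q by rewrite mulr_gt0//; lra.
have Q1 : 1 <= Q by rewrite -[1]mulr1 ler_pM//; lra.
have lnQ : ln Q = ln (1 + m) + ln (1 + rho) by rewrite lnM// posrE; lra.
have ln_le x : 0 < x -> ln (1 + x) <= x :> R.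
  by move=> x0; rewrite -ler_expR lnK ?posrE; [exact: expR_ge1Dx|lra].
have lnrho : 0 <= ln (1 + rho) by rewrite ln_ge0//; lra.
have lnm : 1 / 2 <= ln (1 + m).
  rewrite -[leLHS]opprK lerNl -lnV ?posrE; last lra.
  have -> : (1 + m)^-1 = 1 + (- (m / (1 + m))) by field; lra.
  have h : 1 / 2 <= m / (1 + m) by rewrite ler_pdivlMr; lra.
  have h1 : m / (1 + m) < 1 by rewrite ltr_pdivrMr; lra.
  apply: le_trans (le_ln1Dx _) _; lra.
have tm : m <= t.
  have : m * (1 / 2) <= m * (ln (1 + m) + ln (1 + rho)) by rewrite ler_wpM2l; lra.
  lra.
have tQ : t <= 16 * Q ^+ 2.
  have mQ : m <= Q by rewrite /Q -[leLHS]mulr1 ler_pM//; lra.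
  have mrQ : ln (1 + m) + ln (1 + rho) <= Q.
    have := ln_le _ m0; have := ln_le _ r0.
    have : 0 <= m * rho by rewrite mulr_ge0// ltW.
    rewrite /Q; lra.
  rewrite tE expr2 ler_pM2l// ler_pM//; lra.
have E8 : expR (- (t * d)) = Q ^- 8.
  have -> : t * d = ln Q *+ 8.
    rewrite -[RHS]mulr_natl lnQ tE.
    have -> : 16 * (m * (ln (1 + m) + ln (1 + rho))) * d =
      8 * (2 * m * d) * (ln (1 + m) + ln (1 + rho)) by ring.
    by rewrite md mulr1.
  by rewrite expRN -[in LHS](mulr_natl (ln Q)) expRM_natl lnK.
have rmQ : rho * m <= Q.
  have mr0 : 0 <= m * rho by rewrite mulr_ge0// ltW.
  rewrite /Q; lra.
split; first lra.
clear lnQ; clearbody Q.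
have dE : d^-1 = 2 * m by apply: (mulIf (lt0r_neq0 d0)); rewrite mulVf ?md// lt0r_neq0.
have [t20 t30 Q80] : [/\ 0 < t ^+ 2, 0 < rho ^+ 2 * t ^+ 3 & 0 < Q ^+ 8].
  by split; [exact: exprn_gt0|by apply: mulr_gt0; exact: exprn_gt0|exact: exprn_gt0].
have -> : rho * (4 / t * (A * m / (rho ^+ 3 * t ^+ 2)) +
    64 * rho * m * expR (- (t * d)) / d) =
    4 * A * (m / (rho ^+ 2 * t ^+ 3)) + 128 * ((rho * m) ^+ 2 / Q ^+ 8).
  rewrite E8 dE; field; rewrite !lt0r_neq0//.
rewrite [leRHS]mulrDl; apply: lerD.
  apply: ler_wpM2l; first exact: mulr_ge0.
  have -> : rho ^+ 2 * t ^+ 3 = (rho ^+ 2 * t) * t ^+ 2 by ring.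
  have rt0 : 0 < rho ^+ 2 * t by rewrite mulr_gt0// exprn_gt0.
  rewrite ler_pdivrMr ?mulr_gt0// [leRHS]mulrC mulfK ?lt0r_neq0//.
  apply: le_trans tm _.
  by rewrite -[leLHS]mul1r ler_wpM2r ?exprn_ege1// ltW.
have z0 : 0 <= rho * m * t by rewrite !mulr_ge0// ltW.
have z1 : rho * m * t <= 16 * Q ^+ 4.
  apply: (@le_trans _ _ (Q * (16 * Q ^+ 2))).
    by apply: ler_pM => //; [rewrite mulr_ge0// ltW|exact: ltW].
  have -> : Q * (16 * Q ^+ 2) = 16 * Q ^+ 3 * 1 by ring.
  have -> : 16 * Q ^+ 4 = 16 * Q ^+ 3 * Q by ring.
  by rewrite ler_wpM2l// mulr_ge0// exprn_ge0// ltW.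
have z2 : (rho * m * t) ^+ 2 <= (16 * Q ^+ 4) ^+ 2 by rewrite lerXn2r ?nnegrE// (le_trans z0).
rewrite ler_pdivlMr// -mulrA mulrAC.
have -> : (rho * m) ^+ 2 * t ^+ 2 / Q ^+ 8 = (rho * m * t) ^+ 2 / Q ^+ 8 by rewrite -exprMn.
apply: (@le_trans _ _ (128 * 256)); last by rewrite !exprS expr0; lra.
rewrite ler_pM2l// ler_pdivrMr//.
by apply: le_trans z2 _; rewrite le_eqVlt; apply/orP; left; apply/eqP; ring.
Qed.

End Numerics.

Section WeightedRemainder.
Context {R : realType} {X : completeNormedModType R[i]}.
Notation mu := (@lebesgue_measure R).
Notation borelR := (g_sigma_algebraType R.-ocitv.-measurable).
Implicit Types (a y t s rho : R).
Variables (f : R -> X) (E : set R) (u : nat -> R -> X).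
Hypothesis uf : approximable mu Rplus E u f.
Hypothesis f_exp : forall a, 0 < a ->
  mu.-integrable E (EFin \o (fun s => expR (- (a * s)) * rnorm (f s))).
Variables (M : R -> R) (F : R[i] -> X).
Hypothesis M_cont : {within Rplus, continuous M}.
Hypothesis M_nd : {in Rplus &, {homo M : s t / s <= t}}.
Hypothesis M_ge2 : forall s, 0 <= s -> 2 <= M s.
Hypothesis F_hol : holomorphic_on (Omega M) F.
Hypothesis F_laplace : forall z, 0 < complex.Re z -> F z = laplace f z.
Hypothesis F_M : forall z, Omega M z -> rnorm (F z) <= M `|complex.Im z|.

(** As [M] is nondecreasing, the rectangle lies in [Omega M] with room to
    spare, and one bound holds on all of it. *)
Lemma extension_on_rectangle rho d x y : 0 < d -> 2 * M rho * d = 1 -> 0 <= rho ->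
  - d <= x -> - rho <= y <= rho -> cdiff_at F (x +i* y) /\ rnorm (F (x +i* y)) <= M rho.
Proof.
move=> d0 Md r0 dx yr; have y_rho : `|y| <= rho by rewrite ler_norml.
have My : M `|y| <= M rho by apply: M_nd => //; rewrite inE RplusE.
have My2 : 2 <= M `|y| by apply: M_ge2.
have Om : Omega M (x +i* y).
  rewrite /Omega/=; apply: lt_le_trans dx; rewrite ltrN2.
  have -> : d = (2 * M rho)^-1.
    by apply: (mulfI (_ : 2 * M rho != 0)); rewrite ?Md ?mulfV// lt0r_neq0//; lra.
  by rewrite ltf_pV2 ?posrE; lra.
split; last exact: le_trans (F_M Om) My.
by apply: derivable_cdiff; exact: F_hol.
Qed.

Notation W t := (weight M (16^-1 * t)).
Notation phi := ((fun s => rnorm (f s)) \_ E).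

Let W1 t : 1 <= W t.
Proof. exact: weight_ge1. Qed.

Let W0 t : 0 < W t.
Proof. exact: lt_le_trans (W1 t). Qed.

(** At bounded times the remainder is bounded, and any bound will do. *)
Lemma weighted_remainder_early T : 0 <= T -> exists2 C, 0 <= C &
  forall t, 0 <= t -> t <= T -> W t * rnorm (F 0 - primitive f t) <= C * (1 + t) ^- 2.
Proof.
move=> T0.
pose G0 := rnorm (F 0 - primitive f 0) + (variation f E T - variation f E 0).
have G00 : 0 <= G0.
  by rewrite addr_ge0 ?rnorm_ge0// subr_ge0; exact: (variation_nd uf f_exp (lexx 0) T0).
exists (W T * G0 * (1 + T) ^+ 2) => [|t t0 tT].
  by apply: mulr_ge0 (sqr_ge0 _); apply: mulr_ge0 G00; exact: ltW.
have t1 : 0 < 1 + t by rewrite ltr_pwDl.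
rewrite ler_pdivlMr ?exprn_gt0//; apply: ler_pM.
- by rewrite mulr_ge0 ?rnorm_ge0// ltW.
- exact: sqr_ge0.
- apply: ler_pM; [exact: ltW|exact: rnorm_ge0| |].
    by apply: weight_nd => //; rewrite ler_pM2l// invr_gt0.
  have -> : F 0 - primitive f t =
      F 0 - primitive f 0 - (primitive f t - primitive f 0) by rewrite opprB addrA subrK.
  apply: le_trans (rnormB _ _) _; rewrite lerD2l.
  apply: (le_trans (primitive_dist uf f_exp (lexx 0) t0)).
  by rewrite lerD2r; exact: (variation_nd uf f_exp t0 tT).
- by rewrite lerXn2r ?nnegrE ?addr_ge0// lerD2l.
Qed.

Let remainder_integral t : (\int[mu]_(s in E) (rnorm (f s) * ck (W t) (t - s))%:E =
  \int[mu]_(s in Rplus) (phi s * ck (W t) (t - s))%:E)%E.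
Proof.
rewrite [LHS]integral_mkcond [RHS]integral_mkcond; apply: eq_integral => s _.
have [_ ED _ _ _] := uf.
rewrite /patch; case: ifPn => [/set_mem Es|_]; first by rewrite mem_set//; exact: ED.
by case: ifP => //; rewrite mul0r.
Qed.

Lemma weighted_remainder_late : exists T N K, [/\ 0 <= T, 0 <= N, 0 <= K &
  forall t, T < t -> ((W t * rnorm (F 0%R - primitive f t)%R)%:E <=
    (N * (1 + t) ^- 2)%:E +
    K%:E * \int[mu]_(s in Rplus) (phi s * ck (W t) (t - s))%:E)%E].
Proof.
have [C C0 kern_C] := @kern_bound R.
have e1 : 0 < expR 1 :> R by exact: expR_gt0.
have [N N0 budgetN] : exists2 N : R, 0 < N & forall m rho t d, 2 <= m -> 1 <= rho ->
    0 < t -> 2 * m * d = 1 -> t = 16 * (m * (ln (1 + m) + ln (1 + rho))) ->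
    2 <= t /\ rho * (4 / t * (144 * expR 1 * m / (rho ^+ 3 * t ^+ 2)) +
      64 * rho * m * expR (- (t * d)) / d) <= N / t ^+ 2.
  have A0 : 0 <= 144 * expR 1 :> R by rewrite ltW// mulr_gt0.
  (* The constant [144 * expR 1] is that of [contour_bound]. *)
  exists (4 * (144 * expR 1) + 2 ^+ 15) => [|m rho t d m2 r1 tp md tE].
    by apply: ltr_wpDl (exprn_gt0 _ _) => //; exact: mulr_ge0.
  by have [] := contour_budget A0 m2 r1 tp md tE.
have [T1 T12 T1C] : exists2 T1, 2 <= T1 & 2 + 4 * (2 * C * expR 1 + C / 2) <= T1.
  exists (2 + 4 * (2 * C * expR 1 + C / 2)) => //.
  by rewrite lerDl mulr_ge0// addr_ge0 ?divr_ge0 ?mulr_ge0 ?ltW.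
(* From this time on [weight] inverts [Mlog] and [skern_lb] applies. *)
exists (Num.max T1 (16 * Mlog M 1)), (16 * N), (4 * (C / 2 * expR 1)); split.
- by rewrite le_max (le_trans _ T12).
- by apply: mulr_ge0 => //; exact: ltW.
- by apply: mulr_ge0 => //; apply: mulr_ge0 (expR_ge0 _); rewrite divr_ge0// ltW.
move=> t Tt; have [tT1 tM] : T1 <= t /\ 16 * Mlog M 1 <= t.
  by move: Tt; rewrite gt_max => /andP[/ltW ? /ltW ?].
have [r1 Mr] : 1 <= W t /\ Mlog M (W t) = 16^-1 * t.
  by apply: weight_spec => //; rewrite ler_pdivlMl.
move: (remainder_integral t); set rho := W t in r1 Mr * => RI.
have r0 : 0 < rho by exact: lt_le_trans r1.
have m2 : 2 <= M rho by apply: M_ge2; exact: ltW.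
have m0 : 0 < M rho by exact: lt_le_trans m2.
pose d := (2 * M rho)^-1.
have d0 : 0 < d by rewrite invr_gt0 mulr_gt0.
have md : 2 * M rho * d = 1 by rewrite mulfV// lt0r_neq0// mulr_gt0.
have tE : t = 16 * (M rho * (ln (1 + M rho) + ln (1 + rho))).
  by rewrite -[X in 16 * X]/(Mlog M rho) Mr mulrA mulfV ?mul1r.
have tp : 0 < t by apply: lt_le_trans (le_trans T12 tT1).
have [t2 budget] := budgetN _ _ _ _ m2 r1 tp md tE.
pose a := t^-1; have at1 : a * t = 1 by rewrite mulVf// lt0r_neq0.
have a0 : 0 < a by rewrite invr_gt0.
have a12 : a <= 2^-1 by rewrite lef_pV2 ?posrE.
have d12 : d <= 2^-1.
  by rewrite lef_pV2 ?posrE ?mulr_gt0// ler_peMr// (le_trans _ m2)// ler1n.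
have ad1 : a + d <= 1 by rewrite [leRHS]splitr !mul1r lerD.
have rect x y : - d <= x -> - rho <= y <= rho ->
    cdiff_at F (x +i* y) /\ rnorm (F (x +i* y)) <= M rho.
  by apply: extension_on_rectangle => //; exact: ltW.
have rt : 2 + 4 * (2 * C * expR 1 + C / 2) <= rho * t.
  apply: le_trans T1C _; apply: le_trans tT1 _.
  by rewrite -[leLHS]mul1r ler_wpM2r// ltW.
have dF y : - rho <= y <= rho -> cdiff_at F (a +i* y).
  move=> yr; have [] // := rect a y _ yr.
  by rewrite (le_trans _ (ltW a0))// oppr_le0 ltW.
have Ff y : F (a +i* y) = laplace f (a +i* y) by exact: F_laplace.
pose B := 4 / t * (144 * expR 1 * M rho / (rho ^+ 3 * t ^+ 2)) +
  64 * rho * M rho * expR (- (t * d)) / d.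
have hB l : real_linear l -> bounded_by 1 l ->
    `|sint (fun y => l (contour_fun F t a rho (a +i* y))) (- rho) rho| <= B.
  move=> ll l1; apply: (contour_bound ll l1) => //; first exact: ltW.
  by move=> x y /andP[dx _]; exact: rect.
have := primitive_estimate uf f_exp C0 kern_C tp at1 r0 rt dF Ff hB.
rewrite RI => /le_trans; apply; rewrite leeD2r// lee_fin.
apply: (@le_trans _ _ (4 * (N / t ^+ 2))); first by rewrite ler_pM2l.
have t2p : 0 < t ^+ 2 by rewrite exprn_gt0.
have t21 : 0 < (1 + t) ^+ 2 by rewrite exprn_gt0// addr_gt0.
rewrite mulrA ler_pdivrMr// mulrAC ler_pdivlMr//.
have -> : 16 * N * t ^+ 2 = 4 * N * (2 * t) ^+ 2 by ring.
rewrite ler_wpM2l//; first by rewrite mulr_ge0// ltW.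
rewrite lerXn2r ?nnegrE ?addr_ge0 ?mulr_ge0 ?(ltW tp)//.
by rewrite mulr_natl mulr2n lerD2r (le_trans _ t2)// ler1n.
Qed.

Lemma weighted_remainder_bound : exists2 C1, 0 < C1 & forall t, 0 <= t ->
  ((W t * rnorm (F 0%R - primitive f t)%R)%:E <= C1%:E * (((1 + t) ^- 2)%:E +
    \int[mu]_(s in Rplus) (phi s * ck (W t) (t - s))%:E))%E.
Proof.
have [T [N [K [T0 N0 K0 late]]]] := weighted_remainder_late.
have [C C0 early] := weighted_remainder_early T0.
exists (1 + C + N + K) => [|t t0].
  by rewrite -!addrA ltr_pwDl// !addr_ge0.
have b0 : 0 <= (1 + t) ^- 2 by rewrite invr_ge0 sqr_ge0.
have I0 : (0 <= \int[mu]_(s in Rplus) (phi s * ck (W t) (t - s))%:E)%E.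
  apply: integral_ge0 => s _; rewrite lee_fin mulr_ge0//.
    by rewrite /patch; case: ifP => // _; exact: rnorm_ge0.
  exact/ck_ge0/ltW/W0.
rewrite ge0_muleDr//.
have [tT|Tt] := leP t T.
  rewrite -[leLHS]adde0; apply: leeD; last first.
    by rewrite mule_ge0// lee_fin !addr_ge0.
  rewrite -EFinM lee_fin (le_trans (early _ t0 tT))// ler_wpM2r//.
  by rewrite [1 + C]addrC -!addrA lerDl !addr_ge0.
apply: le_trans (late _ Tt) _; apply: leeD.
  rewrite -EFinM lee_fin ler_wpM2r// -[leLHS]add0r -addrA.
  by apply: lerD; [rewrite addr_ge0|rewrite lerDl].
by apply: lee_wpmul2r => //; rewrite lee_fin lerDr !addr_ge0.
Qed.

End WeightedRemainder.

(** * Integrability *)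

Section Lp.
Context {R : realType} {X : completeNormedModType R[i]}.
Notation mu := (@lebesgue_measure R).
Notation borelR := (g_sigma_algebraType R.-ocitv.-measurable).
Implicit Types (a s t r B : R).

Lemma lebesgue_setT_gt0 : (0 < mu setT)%E.
Proof. by rewrite -set_itvNyy lebesgue_measure_itv/= ltry. Qed.

Lemma Lnorm_lty (g : R -> R) r : 1 <= r ->
  ('N[mu]_r%:E[EFin \o g] < +oo)%E <-> (\int[mu]_s (`|g s| `^ r)%:E < +oo)%E.
Proof.
move=> r1; have rn0 : r != 0 by rewrite gt_eqF// (lt_le_trans ltr01).
split=> [|h].
  by move=> /poweR_lty -/(_ r); rewrite poweR_Lnorm.
by rewrite unlock /Lnorm; apply: poweR_lty; exact: h.
Qed.

Lemma integral_exp_lty a : 0 < a -> (\int[mu]_(s in Rplus) (expR (- (a * s)))%:E < +oo)%E.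
Proof.
move=> a0; have a20 : 0 < a / 2 by rewrite divr_gt0.
apply: (@le_lt_trans _ _ (\int[mu]_(s in Rplus) ((2 / a)%:E * (ck (a / 2) (s - 0))%:E))%E).
  apply: le_lower_integral => s; rewrite RplusE => s0; first by rewrite lee_fin expR_ge0.
  have D0 : 0 < 1 + (a / 2 * s) ^+ 2 by rewrite ltr_pwDl// sqr_ge0.
  have -> : (2 / a)%:E = ((a / 2)^-1)%:E by rewrite invf_div.
  rewrite -EFinM lee_fin /ck subr0 mulKf ?gt_eqF// expRN lef_pV2 ?posrE ?expR_gt0//.
  have h0 : 0 <= a * s by rewrite mulr_ge0// ltW.
  have := @expR_ge1Dxn R _ 1 h0; rewrite -[(2`!)%N]/2%N.
  by have := sqr_ge0 (a * s); lra.
rewrite ge0_integralZl//; first last.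
- by rewrite lee_fin divr_ge0// ltW.
- by move=> s _; rewrite lee_fin ck_ge0// ltW.
- apply/measurable_EFinP; apply: measurable_funTS; apply: continuous_measurable_fun.
  exact: continuous_ck.
- exact: measurable_Rplus.
apply: (@le_lt_trans _ _ ((2 / a)%:E * pi%:E)%E); last by rewrite -EFinM ltry.
by apply: lee_wpmul2l; [rewrite lee_fin divr_ge0// ltW|exact: ck_int].
Qed.

Section Split.
Variables (p : \bar R) (f : R -> X) (E : set R) (u : nat -> R -> X).
Hypothesis p1 : (1 <= p)%E.
Hypothesis fp : memLp mu Rplus p f.
Hypothesis uf : approximable mu Rplus E u f.

(** Extending [rnorm (f s)] by 0 from [E], where it is measurable, rather than
    from the half line makes it measurable; the norm in [L^p] can only
    decrease. *)
Notation phi := ((fun s => rnorm (f s)) \_ E).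

Lemma trace_ge0 s : 0 <= phi s.
Proof. by rewrite /patch; case: ifP => // _; exact: rnorm_ge0. Qed.

Lemma measurable_trace : @measurable_fun _ _ borelR borelR setT phi.
Proof.
have [mE _ _ _ _] := uf; apply/(measurable_restrictT _ _).1 => //.
exact: (approximable_norm_measurable uf).
Qed.

Lemma trace_le s : phi s <= ((fun s => rnorm (f s)) \_ Rplus) s.
Proof.
have [_ ED _ _ _] := uf.
rewrite /patch; case: ifPn => [/set_mem Es|_]; first by rewrite mem_set//; exact: ED.
by case: ifP => // _; exact: rnorm_ge0.
Qed.

Lemma trace_powR r : p = r%:E -> (\int[mu]_(s in Rplus) (phi s `^ r)%:E < +oo)%E.
Proof.
move=> pr; have r1 : 1 <= r by rewrite -lee_fin -pr.
have [_ fN] := fp; rewrite pr in fN; have {}fN := (Lnorm_lty _ r1).1 fN.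
apply: le_lt_trans fN; rewrite integral_mkcond; apply: le_lower_integral => s _.
  by rewrite /patch; case: ifP => // _; rewrite lee_fin powR_ge0.
rewrite [leLHS]/patch; case: ifP => _; last by rewrite lee_fin powR_ge0.
rewrite lee_fin; apply: ge0_ler_powR; rewrite ?nnegrE ?trace_ge0//.
  exact: le_trans ler01 r1.
exact: le_trans (trace_le s) (ler_norm _).
Qed.

Lemma trace_bounded : p = +oo%E -> exists2 B, 0 <= B & {ae mu, forall s, phi s <= B}.
Proof.
move=> poo; have [_ fN] := fp; move: fN; rewrite poo unlock /Lnorm.
rewrite ifT; last first.
  exact: lebesgue_setT_gt0.
set es := ess_sup _ _ => es_oo.
have := @ess_sup_ge _ _ _ mu (abse \o (EFin \o (fun s => rnorm (f s)) \_ Rplus)).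
rewrite -/es => aes.
exists (Num.max 0 (fine es)); first by rewrite le_max lexx.
apply: filterS aes => s /= h.
apply: le_trans (trace_le s) _; apply: le_trans (ler_norm _) _.
rewrite le_max; apply/orP; right.
rewrite -lee_fin fineK//.
rewrite fin_real// es_oo andbT (lt_le_trans _ h)// ltNyr//.
Qed.

(** Every [p] is covered by the sum of a bounded and an integrable function:
    for finite [p] use [x <= 1 + x `^ p], otherwise cut off a null set. *)
Lemma trace_split : exists B (psi : R -> R), [/\ 0 <= B, forall s, 0 <= psi s,
  measurable_fun setT psi, (\int[mu]_(s in Rplus) (psi s)%:E < +oo)%E &
  forall s, phi s <= B + psi s].
Proof.
have mphi := measurable_trace.
case: p p1 fp trace_powR trace_bounded => [r| |] // r1 _ hr hb.
  have {}r1 : 1 <= r by rewrite -lee_fin.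
  have r0 : 0 < r by exact: lt_le_trans r1.
  exists 1, (fun s => phi s `^ r); split=> //; last 1 first.
  - move=> s; have [s1|s1] := leP (phi s) 1.
      by rewrite (le_trans s1)// lerDl powR_ge0.
    rewrite (@le_trans _ _ (phi s `^ r))//; last by rewrite lerDr.
    by rewrite -{1}(powRr1 (trace_ge0 s)) ler_powR// ltW.
  - by move=> s; exact: powR_ge0.
  - exact: (measurableT_comp (measurable_powR r) mphi).
  - exact: hr.
have [B B0 aeB] := hb erefl.
pose A := phi @^-1` `]B, +oo[.
have mA : @measurable _ borelR A by rewrite -[A]setTI; exact: mphi.
exists B, (fun s => phi s * \1_A s); split=> //.
- by move=> s; rewrite mulr_ge0 ?trace_ge0// indicE ler0n.
- by apply: measurable_funM => //; exact: measurable_indic.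
- rewrite (ge0_ae_eq_integral (g := cst 0%E))//; first by rewrite integral0.
  + exact: measurable_Rplus.
  + apply/measurable_EFinP; apply: measurable_funTS; apply: measurable_funM mphi _.
    exact: (@measurable_indic _ borelR R setT A mA).
  + by move=> s _; rewrite lee_fin mulr_ge0 ?trace_ge0// indicE ler0n.
  + have [N [mN N0 NB]] := aeB; exists N; split=> //.
    apply: subset_trans NB => s; apply: contra_not => /= sB _; rewrite indicE memNset ?mulr0//.
    by apply/negP; rewrite /A/= in_itv/= andbT -leNgt.
- move=> s; rewrite indicE; case: (boolP (s \in A)) => sA; first by rewrite mulr1 lerDr.
  rewrite mulr0 addr0 leNgt; apply/negP => Bs; move/negP: sA; apply.
  by rewrite inE /A/= in_itv/= Bs.
Qed.

Lemma Lp_laplace_integrable a : 0 < a ->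
  mu.-integrable E (EFin \o (fun s => expR (- (a * s)) * rnorm (f s))).
Proof.
move=> a0; have [mE ED _ _ _] := uf.
have [B [psi [B0 psi0 mpsi psioo phile]]] := trace_split.
have me (D : set R) : @measurable_fun _ _ borelR borelR D (fun s => expR (- (a * s))).
  apply: measurable_funTS; apply: continuous_measurable_fun => s.
  by eapply is_derive_cont; deriv.
apply/integrableP; split.
  apply/measurable_EFinP; apply: measurable_funM; first exact: me.
  exact: (approximable_norm_measurable uf).
apply: (@le_lt_trans _ _ (\int[mu]_(s in Rplus)
    (B%:E * (expR (- (a * s)))%:E + (psi s)%:E))%E).
  rewrite integral_mkcond [leRHS]integral_mkcond; apply: le_lower_integral => s _.
    by rewrite /patch; case: ifP => // _; exact: abse_ge0.
  rewrite [leLHS]/patch; case: ifPn => [/set_mem Es|_]; last first.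
    rewrite /patch; case: ifP => // _.
    by rewrite -EFinM -EFinD lee_fin addr_ge0// mulr_ge0// expR_ge0.
  have sR := ED _ Es; rewrite /patch mem_set//.
  rewrite -EFinM -EFinD lee_fin ger0_norm ?mulr_ge0 ?expR_ge0 ?rnorm_ge0//.
  have := phile s; rewrite {1}/patch mem_set// => h.
  apply: (le_trans (ler_wpM2l (expR_ge0 _) h)); rewrite mulrDr [B * _]mulrC lerD2l.
  rewrite -[leRHS]mul1r ler_wpM2r// -expR0 ler_expR oppr_le0.
  by rewrite mulr_ge0 ?(ltW a0)// -RplusE.
rewrite ge0_integralD//; first last.
- by apply/measurable_EFinP; exact: measurable_funTS.
- by move=> s _; rewrite lee_fin.
- by apply: measurable_funeM; apply/measurable_EFinP; exact: me.
- by move=> s _; rewrite mule_ge0// lee_fin ?expR_ge0.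
- exact: measurable_Rplus.
have mR := @measurable_Rplus R.
have me' : @measurable_fun _ _ borelR _ Rplus (fun s => (expR (- (a * s)))%:E).
  by apply/measurable_EFinP; exact: me.
have e0 s : Rplus s -> (0 <= (expR (- (a * s)))%:E :> \bar R)%E by rewrite lee_fin expR_ge0.
rewrite ge0_integralZl//.
have I0 : (0 <= \int[mu]_(s in Rplus) (expR (- (a * s)))%:E)%E by exact: integral_ge0.
have := integral_exp_lty a0; rewrite -ge0_fin_numE// => /fineK fI.
by apply: lte_add_pinfty => //; rewrite -fI -EFinM ltry.
Qed.

End Split.
End Lp.

(** * The weighted remainder in the Lebesgue space *)

Section Conclusion.
Context {R : realType} {X : completeNormedModType R[i]}.
Notation mu := (@lebesgue_measure R).
Notation borelR := (g_sigma_algebraType R.-ocitv.-measurable).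
Implicit Types (a s t r B : R).
Variables (p : \bar R) (f : R -> X) (E : set R) (u : nat -> R -> X).
Hypothesis p1 : (1 <= p)%E.
Hypothesis fp : memLp mu Rplus p f.
Hypothesis uf : approximable mu Rplus E u f.
Variables (M : R -> R) (F : R[i] -> X).
Hypothesis M_cont : {within Rplus, continuous M}.
Hypothesis M_nd : {in Rplus &, {homo M : s t / s <= t}}.
Hypothesis M_ge2 : forall s, 0 <= s -> 2 <= M s.
Hypothesis F_hol : holomorphic_on (Omega M) F.
Hypothesis F_laplace : forall z, 0 < complex.Re z -> F z = laplace f z.
Hypothesis F_M : forall z, Omega M z -> rnorm (F z) <= M `|complex.Im z|.

Notation W := (fun t => weight M (16^-1 * t)).
Notation phi := ((fun s => rnorm (f s)) \_ E).

Let weighted t : X := (W t)%:C *: (F 0 - primitive f t).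

Let W1 t : 1 <= W t.
Proof. exact: weight_ge1. Qed.

Let W_nd : {homo W : s t / s <= t}.
Proof. by move=> s t st; apply: weight_nd => //; rewrite ler_pM2l// invr_gt0. Qed.

Let L1 : 1 <= 2 * expR 1 :> R.
Proof. by have := @expR_ge1Dx R 1; lra. Qed.

Let W_slow s t : 0 <= s -> 0 <= t -> `|t - s| <= 1 -> W t <= 2 * expR 1 * W s.
Proof.
move=> s0 t0 ts1.
have [ts|/ltW st] := leP t s.
  apply: le_trans (W_nd ts) _; rewrite -[leLHS]mul1r ler_wpM2r// (le_trans ler01)//.
have v12 : 16^-1 * s <= 16^-1 * t by rewrite ler_pM2l// invr_gt0.
apply: le_trans (weight_slow M_cont M_nd M_ge2 v12) _.
rewrite mulrCA mulrA ler_wpM2r ?(le_trans ler01 (W1 s))// ler_pM2l// ler_expR.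
by move: ts1; rewrite ger0_norm; lra.
Qed.

Lemma weighted_measurable : strongly_measurable mu Rplus weighted.
Proof.
apply: strongly_measurable_seq_continuous => v t v0 vt.
have t0 : 0 <= t.
  by apply: (@closed_cvg _ _ _ _ v (fun x => 0 <= x) (@closed_ge _ 0) _ t vt); exact: nearW.
have cW : continuous W.
  move=> x; apply: (@continuous_comp _ _ _ (fun t => 16^-1 * t) (weight M)).
    by eapply is_derive_cont; deriv.
  exact: weight_cont.
have c0 : continuous (fun _ : R => 0 : R) by move=> x; exact: cvg_cst.
have cWc := seq_continuous_complex cW c0 v0 vt.
apply: (@cvgZ _ _ _ _ _ (fun n => (W (v n))%:C : R[i]^o)); first exact: cWc.
apply: cvgB; first exact: cvg_cst.
exact: (primitive_seq_continuous uf (Lp_laplace_integrable p1 fp uf) v0 vt).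
Qed.

Let rnorm_weighted t : rnorm (weighted t) = W t * rnorm (F 0 - primitive f t).
Proof. by rewrite rnormZr ger0_norm// (le_trans ler01 (W1 t)). Qed.

Lemma square_decay_lty : (\int[mu]_(t in Rplus) ((1 + t) ^- 2)%:E < +oo)%E.
Proof.
apply: le_lt_trans (ltry pi); apply: le_trans (ck_int 0 ltr01).
apply: le_lower_integral => t; rewrite RplusE => t0; first by rewrite lee_fin invr_ge0 sqr_ge0.
rewrite lee_fin /ck !mul1r subr0 lef_pV2 ?posrE ?exprn_gt0 ?ltr_pwDl ?sqr_ge0//.
nra.
Qed.

Lemma weighted_Lp : memLp mu Rplus p weighted.
Proof.
split; first exact: weighted_measurable.
have [C C0 bound] := weighted_remainder_bound uf (Lp_laplace_integrable p1 fp uf)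
  M_cont M_nd M_ge2 F_hol F_laplace F_M.
have mR := @measurable_Rplus R.
have mphi := measurable_trace uf; have phi0 := trace_ge0 f E.
have ck0 t s : 0 <= ck (W t) (t - s) by apply: ck_ge0; exact: le_trans ler01 (W1 t).
case: p p1 fp (@trace_powR _ _ p f E u p1 fp uf) (@trace_bounded _ _ p f E u fp uf)
  => [r r1|_ |//] fp' hr hb.
  have {}r1 : 1 <= r by rewrite -lee_fin.
  have phir0 s : 0 <= phi s `^ r by exact: powR_ge0.
  have mphir : @measurable_fun _ _ borelR borelR setT (fun s => phi s `^ r).
    exact: (measurableT_comp (measurable_powR r) mphi).
  apply/(Lnorm_lty _ r1).
  pose D := (C * (2 + pi)) `^ r.
  have D0 : 0 <= D by exact: powR_ge0.
  pose I t : \bar R := (\int[mu]_(s in Rplus) (phi s `^ r * ck (W t) (t - s))%:E)%E.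
  have I0 t : (0 <= I t)%E by apply: integral_ge0 => s _; rewrite lee_fin mulr_ge0.
  have mI : @measurable_fun _ _ borelR _ Rplus I by exact: measurable_schur.
  have msq : @measurable_fun _ _ borelR _ Rplus (fun t => ((1 + t) ^- 2)%:E : \bar R).
    apply/measurable_EFinP; apply: (eq_measurable_fun (fun t => (1 + `|t|) ^- 2)).
      by move=> t; rewrite inE RplusE => t0; rewrite ger0_norm.
    apply: measurable_funTS; apply: continuous_measurable_fun => t.
    apply: (@continuous_comp _ _ _ (fun t : R => `|t|) (fun x => (1 + x) ^- 2)).
      exact: norm_continuous.
    have t1 : 1 + `|t| != 0 by rewrite gt_eqF// ltr_pwDl.
    by eapply is_derive_cont; deriv; rewrite expf_neq0.
  have sq0 t : (0 <= ((1 + t) ^- 2)%:E :> \bar R)%E by rewrite lee_fin invr_ge0 sqr_ge0.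
  apply: (@le_lt_trans _ _ (\int[mu]_(t in Rplus) (D%:E * (((1 + t) ^- 2)%:E + I t)))%E).
    rewrite [leRHS]integral_mkcond; apply: le_lower_integral => t _.
      by rewrite lee_fin powR_ge0.
    rewrite /patch; case: ifPn => [/set_mem|_]; last by rewrite normr0 powR0// gt_eqF// (lt_le_trans ltr01).
    rewrite RplusE => t0; rewrite ger0_norm ?rnorm_ge0// rnorm_weighted.
    apply: (schur_power W1) => //; last exact: bound.
    by rewrite mulr_ge0 ?rnorm_ge0// (le_trans ler01 (W1 t)).
  rewrite ge0_integralZl ?lee_fin//; first last.
  - by move=> t _; rewrite adde_ge0.
  - exact: emeasurable_funD.
  rewrite ge0_integralD//.
  have JI : (\int[mu]_(t in Rplus) I t < +oo)%E.
    apply: le_lt_trans (schur_L1 W1 W_nd L1 W_slow phir0 mphir) _.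
    have := hr _ erefl; rewrite -ge0_fin_numE; last by apply: integral_ge0 => s _; rewrite lee_fin.
    by move=> /fineK <-; rewrite -EFinM ltry.
  have : (\int[mu]_(t in Rplus) ((1 + t) ^- 2)%:E + \int[mu]_(t in Rplus) I t < +oo)%E.
    by rewrite lte_add_pinfty// square_decay_lty.
  rewrite -ge0_fin_numE; last by rewrite adde_ge0// integral_ge0.
  by move=> /fineK <-; rewrite -EFinM ltry.
have [B B0 phiB] := hb erefl.
rewrite unlock /Lnorm ifT; last exact: lebesgue_setT_gt0.
apply: le_lt_trans (ltry (C * (1 + B * pi))).
apply: ess_sup_ler => t.
rewrite ger0_norm; last by rewrite /patch; case: ifP => // _; exact: rnorm_ge0.
rewrite lee_fin /patch; case: ifPn => [/set_mem|_]; last first.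
  rewrite -[point]/(0 : R); apply: mulr_ge0; first exact: ltW.
  by rewrite addr_ge0// mulr_ge0// pi_ge0.
rewrite RplusE => t0; rewrite rnorm_weighted -lee_fin.
apply: le_trans (bound _ t0) _; rewrite EFinM lee_pmul2l// EFinD leeD//.
  by rewrite lee_fin invf_le1 ?exprn_ege1 ?exprn_gt0//; lra.
apply: (@le_trans _ _ (\int[mu]_(s in Rplus) (B%:E * (ck (W t) (t - s))%:E))%E).
  have mck : @measurable_fun _ _ borelR _ Rplus (fun s => ck (W t) (t - s)).
    exact: (@measurable_ckr R W Rplus t).
  apply: ae_ge0_le_integral => //.
  - by move=> s _; rewrite lee_fin mulr_ge0.
  - by apply/measurable_EFinP; apply: measurable_funM => //; exact: measurable_funTS.
  - by move=> s _; rewrite -EFinM lee_fin mulr_ge0.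
  - by apply: measurable_funeM; exact/measurable_EFinP.
  have [N [mN N0 NB]] := phiB; exists N; split=> //.
  apply: subset_trans NB => s; apply: contra_not => /= sB _.
  by rewrite -EFinM lee_fin ler_wpM2r.
rewrite ge0_integralZl ?lee_fin//; first last.
- by move=> s _; rewrite lee_fin.
- by apply/measurable_EFinP; exact: (@measurable_ckr R W Rplus t).
by rewrite EFinM lee_wpmul2l ?lee_fin//; exact: (ck_int_s W1).
Qed.

End Conclusion.

Theorem theorem1p6 (R : realType) (p : \bar R) (p_ge1 : (1 <= p)%E) :
  exists c : R, 0 < c /\
    forall (X : completeNormedModType R[i]) (M : R -> R) (f : R -> X)
      (F : R[i] -> X),
      {within Rplus, continuous M} ->
      {in Rplus &, {homo M : s t / s <= t}} ->
      (forall s, 0 <= s -> 2 <= M s) ->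
      memLp (@lebesgue_measure R) Rplus p f ->
      holomorphic_on (Omega M) F ->
      (forall z, 0 < complex.Re z -> F z = laplace f z) ->
      (forall z, Omega M z -> rnorm (F z) <= M `|complex.Im z|) ->
      memLp (@lebesgue_measure R) Rplus p
        (fun t => (weight M (c * t))%:C *: (F 0 - primitive f t)).
Proof.
exists 16^-1; split; first by rewrite invr_gt0.
move=> X M f F M_cont M_nd M_ge2 fp F_hol F_laplace F_M.
have [E [u uf]] := strongly_measurable_approximable (@measurable_Rplus R) (proj1 fp).
exact: (weighted_Lp p_ge1 fp uf M_cont M_nd M_ge2 F_hol F_laplace F_M).
Qed.
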